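(* Let $\Gamma$ be a finitely generated group, and suppose we have an oracle that solves the word problem over $\Gamma$ in time $\phi(n)$ on input words of length $n$. Let $(G,\gamma)$ be a connected $\Gamma$-labeled graph with $m$ edges such that every arc is labeled by a word of length $1$ (over the generators of $\Gamma$ and their inverses), and let $a,b$ be vertices of $G$. Then one can decide in time $\mathcal{O}(m^2)\cdot\phi(12m)$ whether every Eulerian trail of $G$ from $a$ to $b$ has the same label. Moreover, if not, then one can find two Eulerian trails of $G$ from $a$ to $b$ with different labels in time $\mathcal{O}(m^4)\cdot\phi(12m)$.
   Context: Graphs are finite and undirected, with parallel edges and loops allowed. Each edge $e$ has two orientations (arcs) $\vec e$ and $\vec e^{-1}$, each with a tail and a head. A group-labeled graph $(G,\gamma)$ consists of a graph $G$ and a function $\gamma$ assigning to each arc an element of a group $\Gamma$ (written multiplicatively, identity $1$) such that $\gamma(\vec e^{-1})=\gamma(\vec e)^{-1}$ for every edge $e$. A trail is a sequence of arcs whose underlying edges are pairwise distinct and such that the head of each arc is the tail of the next; it goes from the tail of its first arc to the head of its last arc. Its label is the product $\gamma(\vec e_1)\gamma(\vec e_2)\cdots\gamma(\vec e_t)$ in order. A trail is Eulerian if it contains exactly one orientation of every edge of $G$. The word problem oracle takes a word over the generators of $\Gamma$ and their inverses (as formal symbols) and decides whether it equals the identity. The graph is given as an adjacency list in which each arc label is stored as a word over the generators and their inverses, and the label of $\vec e^{-1}$ is the formal inverse word of the label of $\vec e$. *)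

(* Defs.v *)
From HB Require Import structures.
From mathcomp Require Import all_boot.

Set Implicit Arguments.
Unset Strict Implicit.
Unset Printing Implicit Defensive.

(* Parallel edges and loops are allowed.  [src]/[tgt] fix a reference
   orientation of each edge. *)
Record graph := Graph {
  nverts : nat;
  nedges : nat;
  src : 'I_nedges -> 'I_nverts;
  tgt : 'I_nedges -> 'I_nverts
}.

Section Graphs.
Variable G : graph.

Definition vertex := 'I_(nverts G).
Definition edge := 'I_(nedges G).

(* [(e, false)] is [e] with its reference orientation, [(e, true)] the
   opposite arc; a loop thus has two distinct arcs. *)
Definition arc_of := (edge * bool)%type.

Definition arc_edge (x : arc_of) : edge := x.1.
Definition arc_inv (x : arc_of) : arc_of := (x.1, ~~ x.2).
Definition arc_tail (x : arc_of) : vertex := if x.2 then tgt x.1 else src x.1.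
Definition arc_head (x : arc_of) : vertex := if x.2 then src x.1 else tgt x.1.

Definition adjacent : rel vertex :=
  fun u v => [exists x : arc_of, (arc_tail x == u) && (arc_head x == v)].

Definition connected_graph : Prop :=
  0 < nverts G /\ forall u v : vertex, connect adjacent u v.

(* Only for an empty sequence of arcs are the end vertices not determined by
   the arcs; it goes from every vertex to itself. *)
Fixpoint walk (a b : vertex) (s : seq arc_of) : bool :=
  if s is x :: s' then (arc_tail x == a) && walk (arc_head x) b s' else a == b.

Definition trail (a b : vertex) (s : seq arc_of) : bool :=
  walk a b s && uniq [seq arc_edge x | x <- s].

Definition eulerian_trail (a b : vertex) (s : seq arc_of) : Prop :=
  trail a b s /\ forall e : edge, e \in [seq arc_edge x | x <- s].

Definition arc_code (x : arc_of) : nat :=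
  if x.2 then nedges G + x.1 else x.1.

End Graphs.

Section Labels.
Local Open Scope group_scope.
Variable Gamma : groupType.

Definition group_labeling (G : graph) (gamma : arc_of G -> Gamma) : Prop :=
  forall x, gamma (arc_inv x) = (gamma x)^-1.

Definition trail_label (G : graph) (gamma : arc_of G -> Gamma) (s : seq (arc_of G))
  : Gamma := \prod_(x <- s) gamma x.

Definition same_eulerian_labels (G : graph) (gamma : arc_of G -> Gamma)
    (a b : vertex G) : Prop :=
  forall s1 s2, eulerian_trail a b s1 -> eulerian_trail a b s2 ->
    trail_label gamma s1 = trail_label gamma s2.

Variable k : nat.

(* [(i, false)] is the i-th generator and [(i, true)] its formal inverse. *)
Definition letter := ('I_k * bool)%type.
Definition word := seq letter.

Definition letter_inv (l : letter) : letter := (l.1, ~~ l.2).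
Definition word_inv (w : word) : word := rev [seq letter_inv l | l <- w].

Definition letter_code (l : letter) : nat := (if l.2 then k + l.1 else l.1)%N.

Variable gen : 'I_k -> Gamma.

Definition eval_letter (l : letter) : Gamma :=
  if l.2 then (gen l.1)^-1 else gen l.1.

Definition eval_word (w : word) : Gamma := \prod_(l <- w) eval_letter l.

Definition generates : Prop := forall g : Gamma, exists w, eval_word w = g.

(* Nothing is required of the answer on sequences that encode no word. *)
Definition solves_word_problem (oracle : seq nat -> bool) : Prop :=
  forall w : word,
    oracle [seq letter_code l | l <- w] <-> eval_word w = 1.

Definition word_labeling (G : graph) (gamma : arc_of G -> Gamma)
    (lab : arc_of G -> word) : Prop :=
  forall x, eval_word (lab x) = gamma x /\ lab (arc_inv x) = word_inv (lab x).

End Labels.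

(* A structured program for a RAM under the uniform cost criterion, with
   natural-number registers and finitely many (those the program mentions)
   unbounded arrays.  The arithmetic is limited to addition and truncated
   subtraction, so that unit cost per operation is a realistic measure. *)

Inductive expr :=
| ECst of nat
| EReg of nat
| EGet of nat & expr
| EAdd of expr & expr
| ESub of expr & expr
| ELt of expr & expr
| EEq of expr & expr.

Inductive cmd :=
| CSkip
| CSet of nat & expr
| CPut of nat & expr & expr
| CSeq of cmd & cmd
| CIf of expr & cmd & cmd
| CWhile of expr & cmd
| CQuery of nat & nat & expr.

Record state := State {
  reg : nat -> nat;
  arr : nat -> nat -> nat
}.

Definition set_reg (s : state) (r v : nat) : state :=
  State (fun r' => if r' == r then v else reg s r') (arr s).

Definition set_arr (s : state) (t i v : nat) : state :=
  State (reg s)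
    (fun t' i' => if (t' == t) && (i' == i) then v else arr s t' i').

Fixpoint eval_expr (s : state) (e : expr) : nat :=
  match e with
  | ECst n => n
  | EReg r => reg s r
  | EGet t e1 => arr s t (eval_expr s e1)
  | EAdd e1 e2 => eval_expr s e1 + eval_expr s e2
  | ESub e1 e2 => eval_expr s e1 - eval_expr s e2
  | ELt e1 e2 => eval_expr s e1 < eval_expr s e2
  | EEq e1 e2 => eval_expr s e1 == eval_expr s e2
  end.

Fixpoint expr_cost (e : expr) : nat :=
  match e with
  | ECst _ | EReg _ => 1
  | EGet _ e1 => (expr_cost e1).+1
  | EAdd e1 e2 | ESub e1 e2 | ELt e1 e2 | EEq e1 e2 =>
      (expr_cost e1 + expr_cost e2).+1
  end.

(* [exec oracle phi c s t s']: started in state [s], the command [c] halts in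
   state [s'] after exactly [t] time units.  [CQuery r t e] submits the first
   [e] cells of array [t] to the oracle, stores the answer in register [r], and
   is charged [phi n] for a query of length [n]; writing the query into the
   array is paid for separately. *)
Inductive exec (oracle : seq nat -> bool) (phi : nat -> nat) :
    cmd -> state -> nat -> state -> Prop :=
| ExecSkip s :
    exec oracle phi CSkip s 1 s
| ExecSet r e s :
    exec oracle phi (CSet r e) s (expr_cost e).+1 (set_reg s r (eval_expr s e))
| ExecPut t e1 e2 s :
    exec oracle phi (CPut t e1 e2) s (expr_cost e1 + expr_cost e2).+1
      (set_arr s t (eval_expr s e1) (eval_expr s e2))
| ExecSeq c1 c2 s s1 s2 t1 t2 :
    exec oracle phi c1 s t1 s1 -> exec oracle phi c2 s1 t2 s2 ->
    exec oracle phi (CSeq c1 c2) s (t1 + t2) s2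
| ExecIfTrue e c1 c2 s t s' :
    eval_expr s e != 0 -> exec oracle phi c1 s t s' ->
    exec oracle phi (CIf e c1 c2) s (expr_cost e + t).+1 s'
| ExecIfFalse e c1 c2 s t s' :
    eval_expr s e = 0 -> exec oracle phi c2 s t s' ->
    exec oracle phi (CIf e c1 c2) s (expr_cost e + t).+1 s'
| ExecWhileTrue e c s s1 s2 t1 t2 :
    eval_expr s e != 0 ->
    exec oracle phi c s t1 s1 -> exec oracle phi (CWhile e c) s1 t2 s2 ->
    exec oracle phi (CWhile e c) s (expr_cost e + t1 + t2).+1 s2
| ExecWhileFalse e c s :
    eval_expr s e = 0 ->
    exec oracle phi (CWhile e c) s (expr_cost e).+1 s
| ExecQuery r t e s :
    exec oracle phi (CQuery r t e) s
      (expr_cost e + phi (eval_expr s e)).+1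
      (set_reg s r (oracle (mkseq (arr s t) (eval_expr s e)))).

Section Input.
Variables (k : nat) (G : graph).

(* The order of the arcs in the list of each vertex is arbitrary. *)
Definition adjacency_lists (adj : vertex G -> seq (arc_of G)) : Prop :=
  forall v, uniq (adj v) /\ forall x, (x \in adj v) = (arc_tail x == v).

Definition adjacency_entries (adj : vertex G -> seq (arc_of G)) : seq (arc_of G) :=
  flatten [seq adj v | v <- enum 'I_(nverts G)].

Definition adjacency_offsets (adj : vertex G -> seq (arc_of G)) : seq nat :=
  0 :: scanl addn 0 [seq size (adj v) | v <- enum 'I_(nverts G)].

(* The adjacency lists are stored consecutively: the list of vertex [v] occupies
   the positions [p] with
     [nth 0 (adjacency_offsets adj) v <= p < nth 0 (adjacency_offsets adj) v.+1],
   and position [p] of arrays 1, 2 and 3 holds the code of its arc, the head of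
   that arc and the label of that arc.  Array 3 is the concatenation of the label
   words; it is aligned with arrays 1 and 2 because it is only used for labels
   of length 1. *)
Definition input_state (adj : vertex G -> seq (arc_of G))
    (lab : arc_of G -> word k) (a b : vertex G) : state :=
  let entries := adjacency_entries adj in
  State
    (nth 0 [:: nverts G; nedges G; nat_of_ord a; nat_of_ord b])
    (fun t => nth 0 (nth [::]
       [:: adjacency_offsets adj;
           [seq arc_code x | x <- entries];
           [seq nat_of_ord (arc_head x) | x <- entries];
           flatten [seq [seq letter_code l | l <- lab x] | x <- entries]] t)).

End Input.

(* The trail is stored as arc codes in the first [nedges G] cells of array [t]. *)
Definition stores_trail (G : graph) (s : state) (t : nat) (p : seq (arc_of G))
  : Prop := mkseq (arr s t) (nedges G) = [seq arc_code x | x <- p].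

(* Main.v *)
Require Import Defs.
From HB Require Import structures.
From mathcomp Require Import all_boot zify.

Set Implicit Arguments.
Unset Strict Implicit.
Unset Printing Implicit Defensive.

(* A trail [W] visits vertices at the times [0], ..., [n]; a chord is a pair of times at which
   it visits the same vertex, and it carries the label of the closed segment in between,
   conjugated by the label of the prefix.  Reversing closed segments connects all trails with
   the same ends and edges (Kotzig), and reversing a chord preserves the label exactly when
   the label of the chord squares to 1.  Reversal of a chord [y] performs a local
   complementation on the graph of crossing chords and multiplies by the label of [y] the
   labels of the chords that cross [y].  Hence all Eulerian trails have the same label iff, for
   a single [W], any two chords at vertices linked by a chain of crossing chords have labels
   that square to 1 and commute; it is enough to test this, by queries of length at most
   [8 m], for the chords from a time to a representative time of its vertex.

   For the decision, [W] is found by Hierholzer's algorithm.  For the search, a prefix of [W]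
   is extended arc by arc: among the possible next arcs, either one leads to a trail with
   another label, or one leaves a rest that still admits two labels. *)

(** * Crossing chords *)

(** A trail can have order m^2 chords, so testing all pairs would take order m^4 queries. Three
    facts bring this down to m^2. All chord labels are conjugated to the start of the trail, so
    chords at one vertex compose and those from a representative time generate the others. Crossing
    is a parity, additive in each chord, so interlaced vertices are already detected by
    representative chords. And the commutation that equal labels force depends only on the two
    vertices being linked, not on the chosen chords crossing. For involutions x and y, commutation
    means (xy)^2 = 1, and y = 1 gives x^2 = 1, so queries of the single form xyxy suffice.

    For the time bounds, a linear scan costs no more than a query because n <= phi n. The decision
    is thus two loops around a scan or a query; the search puts it inside two more, over the
    positions and the candidate arcs.

    Removing a prefix may disconnect the graph. In the correctness of Hierholzer's algorithm an
    assumed completion of the prefix therefore stands in for connectivity. *)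

Section Crossing.

(** Interleaving in parity form. With xor instead of sorted ends, crossing is indifferent to the
    order of the ends and additive when a chord is split. *)
Definition cross (i1 i2 j1 j2 : nat) : bool :=
  (i1 < j1) (+) (i2 < j1) (+) ((i1 < j2) (+) (i2 < j2)).

Definition flip (r q t : nat) : nat := if r <= t <= q then r + q - t else t.

Lemma flipK r q t : flip r q (flip r q t) = t.
Proof.
rewrite /flip; case: (boolP (r <= t <= q)) => h; last by rewrite (negbTE h).
by case: ifP => h'; lia.
Qed.

Lemma flip_in r q t : (r <= flip r q t <= q) = (r <= t <= q).
Proof. rewrite /flip; case: ifP => h //; lia. Qed.

Lemma flip_le r q n t : q <= n -> t <= n -> flip r q t <= n.
Proof. rewrite /flip; case: ifP => h; lia. Qed.

Lemma ltn_flip r q i j : i != j ->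
  (flip r q i < flip r q j) = (i < j) (+) ((r <= i <= q) && (r <= j <= q)).
Proof.
rewrite /flip; case: (boolP (r <= i <= q)) => hi; case: (boolP (r <= j <= q)) => hj nij /=;
by rewrite ?addbF //; lia.
Qed.

(** Local complementation. By [ltn_flip] the order of two times changes exactly when both lie in the
    reversed segment; the four changes sum to a product, which is 1 when each chord has exactly one
    end there. *)
Lemma cross_flip r q i1 i2 j1 j2 :
  i1 != j1 -> i1 != j2 -> i2 != j1 -> i2 != j2 ->
  cross (flip r q i1) (flip r q i2) (flip r q j1) (flip r q j2) =
  cross i1 i2 j1 j2 (+)
  (((r <= i1 <= q) (+) (r <= i2 <= q)) && ((r <= j1 <= q) (+) (r <= j2 <= q))).
Proof.
move=> h1 h2 h3 h4; rewrite /cross !ltn_flip //.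
by do 4!case: (_ < _); do 4!case: (_ <= _ <= _).
Qed.

Lemma crossC i1 i2 j1 j2 :
  i1 != j1 -> i1 != j2 -> i2 != j1 -> i2 != j2 ->
  cross i1 i2 j1 j2 = cross j1 j2 i1 i2.
Proof.
move=> h1 h2 h3 h4; rewrite /cross.
have E i j : i != j -> (j < i) = ~~ (i < j) by lia.
rewrite (E i1 j1) // (E i1 j2) // (E i2 j1) // (E i2 j2) //.
by do 4!case: (_ < _).
Qed.

Lemma cross_swapr i1 i2 j1 j2 : cross i1 i2 j2 j1 = cross i1 i2 j1 j2.
Proof. by rewrite /cross addbC. Qed.

Lemma cross_swapl i1 i2 j1 j2 : cross i2 i1 j1 j2 = cross i1 i2 j1 j2.
Proof. by rewrite /cross (addbC (i1 < j1)) (addbC (i1 < j2)). Qed.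

Lemma cross_transl i1 i2 i3 j1 j2 :
  cross i1 i3 j1 j2 = cross i1 i2 j1 j2 (+) cross i2 i3 j1 j2.
Proof. by rewrite /cross; do 6!case: (_ < _). Qed.

Lemma cross_transr i1 i2 j1 j2 j3 :
  cross i1 i2 j1 j3 = cross i1 i2 j1 j2 (+) cross i1 i2 j2 j3.
Proof. by rewrite /cross; do 6!case: (_ < _). Qed.

Lemma cross_in r q j1 j2 : r <= q ->
  r != j1 -> q != j1 -> r != j2 -> q != j2 ->
  cross r q j1 j2 = (r <= j1 <= q) (+) (r <= j2 <= q).
Proof.
move=> rq h1 h2 h3 h4; rewrite /cross.
have E j : r != j -> q != j -> (r < j) (+) (q < j) = (r <= j <= q).
  by move=> a b; case: ltngtP a => //; case: ltngtP b => //=; lia.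
by rewrite !E.
Qed.

(** If neither given pair is separated by both tests, [a1] and [a2] agree in [g] and some [b]
    differs from them in [g]; one of [a1], [a2] also differs from that [b] in [f]. This provides a
    chord that crosses two given chords. *)
Lemma separate_both (T : Type) (f g : T -> bool) (P : T -> Prop) a1 a2 b1 b2 :
  P a1 -> P a2 -> P b1 -> P b2 -> f a1 (+) f a2 -> g b1 (+) g b2 ->
  exists t1 t2, [/\ P t1, P t2, f t1 (+) f t2 & g t1 (+) g t2].
Proof.
move=> Pa1 Pa2 Pb1 Pb2 hf hg.
case: (boolP ((f a1 (+) f a2) && (g a1 (+) g a2))) => [/andP[]|h1]; first by exists a1, a2.
case: (boolP ((f b1 (+) f b2) && (g b1 (+) g b2))) => [/andP[]|h2]; first by exists b1, b2.
case: (boolP ((f a1 (+) f b1) && (g a1 (+) g b1))) => [/andP[]|h3]; first by exists a1, b1.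
case: (boolP ((f a2 (+) f b1) && (g a2 (+) g b1))) => [/andP[]|h4]; first by exists a2, b1.
case: (boolP ((f a1 (+) f b2) && (g a1 (+) g b2))) => [/andP[]|h5]; first by exists a1, b2.
exists a2, b2; split=> //; move: hf hg h1 h2 h3 h4 h5;
by do 4!case: (f _); do 4!case: (g _).
Qed.

End Crossing.

(** * Elements whose square is the identity *)

Section Involutions.
Local Open Scope group_scope.
Variable Gamma : groupType.
Implicit Types x y z : Gamma.

Definition sq1 x := x * x = 1.

Lemma sq1V x : sq1 x -> x^-1 = x.
Proof. exact: mulg1_eq. Qed.

Lemma sq1_commute x y : sq1 x -> sq1 y -> sq1 (x * y) -> commute x y.
Proof.
move=> hx hy hxy; rewrite /commute -(sq1V hxy).
by rewrite invgM (sq1V hx) (sq1V hy).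
Qed.

Lemma sq1M x y : sq1 x -> sq1 y -> commute x y -> sq1 (x * y).
Proof. by move=> hx hy c; rewrite /sq1 {2}c mulgA -(mulgA x) hy mulg1 hx. Qed.

Lemma sq1_1 : sq1 (1 : Gamma). Proof. by rewrite /sq1 mulg1. Qed.

Lemma sq1J x z : sq1 x -> sq1 (z * x * z^-1).
Proof. by move=> h; rewrite /sq1 !mulgA mulgVK -(mulgA z x x) h mulg1 mulgV. Qed.

Lemma commute_prodl x y z : commute x z -> commute y z -> commute (x * y) z.
Proof. by move=> h1 h2; apply/commute_sym/commuteM; apply/commute_sym. Qed.

End Involutions.

(** * Linked vertices of a trail and reversals *)

(* A trail with [n] arcs is seen as the sequence [v] of the vertices it visits at the
   times [0], ..., [n] together with the labels [p] of its prefixes.  A chord is a pair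
   of times at which the same vertex is visited. *)
Section Times.
Local Open Scope group_scope.
Variables (V : eqType) (Gamma : groupType) (n : nat).
Implicit Types (v : nat -> V) (p : nat -> Gamma) (u w : V).

Definition chord v u (i1 i2 : nat) : Prop :=
  [/\ (i1 <= n)%N, (i2 <= n)%N, v i1 = u & v i2 = u].

Definition interl v u w : Prop :=
  u != w /\ exists i1 i2 j1 j2, [/\ chord v u i1 i2, chord v w j1 j2 & cross i1 i2 j1 j2].

Fixpoint chain v k u w : Prop :=
  if k is k'.+1 then exists2 u', interl v u u' & chain v k' u' w else u = w.

Definition gdiff p (i j : nat) : Gamma := p j * (p i)^-1.

(** The second chord may be trivial, at the same vertex, which makes every chord label an
    involution; the product condition then amounts to commutation by [sq1_commute]. One equation
    covers both requirements. *)
Definition good v p : Prop :=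
  forall k u w i1 i2 j1 j2, chord v u i1 i2 -> chord v w j1 j2 -> chain v k u w ->
    sq1 (gdiff p i1 i2 * gdiff p j1 j2).

(** If the reversed segment has label z = z1 z2 with z^2 = 1, then the inverse of z2 is z z1. So the
    prefix label at a time inside the segment becomes that of the mirrored time, multiplied on the
    left by the label of the whole chord. *)
Definition twist p (r q t : nat) : Gamma := if (r <= t <= q)%N then gdiff p r q else 1.

Definition reversal (r q : nat) v p v' p' : Prop :=
  [/\ (r <= q <= n)%N, v r = v q, sq1 (gdiff p r q),
      forall t, (t <= n)%N -> v' t = v (flip r q t) &
      forall t, (t <= n)%N -> p' t = twist p r q t * p (flip r q t)].

Lemma gdiff_trans p i j k : gdiff p i k = gdiff p j k * gdiff p i j.
Proof. by rewrite /gdiff mulgA mulgVK. Qed.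

Lemma gdiffV p i j : (gdiff p i j)^-1 = gdiff p j i.
Proof. by rewrite /gdiff invgF. Qed.

Lemma gdiffxx p i : gdiff p i i = 1.
Proof. by rewrite /gdiff mulgV. Qed.

Lemma chord_neq v u w i1 i2 j1 j2 : chord v u i1 i2 -> chord v w j1 j2 -> u != w ->
  [/\ i1 != j1, i1 != j2, i2 != j1 & i2 != j2].
Proof.
move=> [_ _ a1 a2] [_ _ b1 b2] uw.
by split; apply: contraNneq uw => E; apply/eqP; congruence.
Qed.

Lemma chord_sym v u i1 i2 : chord v u i1 i2 -> chord v u i2 i1.
Proof. by case. Qed.

Lemma interl_sym v u w : interl v u w -> interl v w u.
Proof.
move=> [uw [i1 [i2 [j1 [j2 [c d x]]]]]]; split; first by rewrite eq_sym.
exists j1, j2, i1, i2; split=> //.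
by have [h1 h2 h3 h4] := chord_neq c d uw; rewrite -crossC.
Qed.

Lemma chain_cat v k l u w z : chain v k u w -> chain v l w z -> chain v (k + l) u z.
Proof.
elim: k u => [|k IH] u /=; first by move=> ->.
by case=> u' h c d; exists u'; last exact: IH.
Qed.

Lemma chain_sym v k u w : chain v k u w -> chain v k w u.
Proof.
elim: k u => [|k IH] u /=; first by move=> ->.
case=> u' h /IH c; have := @chain_cat v k 1%N w u' u c; rewrite addn1; apply.
by exists u => //; apply: interl_sym.
Qed.

Definition near v u w : Prop := u = w \/ interl v u w.

(** * Effect of one reversal on chords, chains and goodness *)

Section Reversal.
Variables (r q : nat) (v : nat -> V) (p : nat -> Gamma) (v' : nat -> V) (p' : nat -> Gamma).
Hypothesis rev : reversal r q v p v' p'.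

Local Notation inrq t := (r <= t <= q)%N.
Local Notation y := (gdiff p r q).

Lemma near_in u i1 i2 : chord v u i1 i2 -> inrq i1 (+) inrq i2 -> near v u (v r).
Proof.
case: rev => /andP[rq qn] vrq _ _ _ c x.
have [->|ne] := eqVneq u (v r); [by left | right].
have cr : chord v (v r) r q by split=> //; apply: leq_trans qn.
apply: interl_sym; split; first by rewrite eq_sym.
exists r, q, i1, i2; split=> //.
have [h1 h2 h3 h4] := chord_neq c cr ne.
by rewrite cross_in // eq_sym.
Qed.

Lemma near_chain u w : near v u w -> exists k, chain v k u w.
Proof. by case=> [->|h]; [exists 0%N | exists 1%N; exists w]. Qed.

Lemma chord_flip u i1 i2 : chord v' u i1 i2 -> chord v u (flip r q i1) (flip r q i2).
Proof.
case: rev => /andP[rq qn] _ _ hv _ [a b c d].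
by split; rewrite ?flip_le // -hv.
Qed.

Lemma chord_unflip u i1 i2 : chord v u i1 i2 -> chord v' u (flip r q i1) (flip r q i2).
Proof.
case: rev => /andP[rq qn] _ _ hv _ [a b c d].
by split; rewrite ?flip_le // hv ?flipK ?flip_le.
Qed.

Lemma gdiff_rev i1 i2 : (i1 <= n)%N -> (i2 <= n)%N ->
  gdiff p' i1 i2 =
  twist p r q i2 * gdiff p (flip r q i1) (flip r q i2) * (twist p r q i1)^-1.
Proof.
case: rev => _ _ _ _ hp h1 h2.
by rewrite {1}/gdiff !hp // invgM /gdiff !mulgA.
Qed.

(** A crossing created by the reversal is between chords with exactly one end in the segment, and
    [near_in] puts both vertices at or next to [v r]. Hence a reversal never joins two classes:
    [chain_rev] reroutes through [v r]. *)
Lemma interl_rev u w : interl v' u w ->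
  interl v u w \/ near v u (v r) /\ near v w (v r).
Proof.
move=> [uw [i1 [i2 [j1 [j2 [/chord_flip c /chord_flip d x]]]]]].
have [h1 h2 h3 h4] := chord_neq c d uw.
have := cross_flip r q h1 h2 h3 h4; rewrite !flipK x => /esym E.
case: (boolP (inrq (flip r q i1) (+) inrq (flip r q i2))) E => hi.
  case: (boolP (inrq (flip r q j1) (+) inrq (flip r q j2))) => hj.
    by right; split; [apply: near_in hi | apply: near_in hj].
  rewrite addbF => E; left; split=> //.
  by exists (flip r q i1), (flip r q i2), (flip r q j1), (flip r q j2).
rewrite addbF => E; left; split=> //.
by exists (flip r q i1), (flip r q i2), (flip r q j1), (flip r q j2).
Qed.

Lemma chain_rev k u w : chain v' k u w -> exists l, chain v l u w.
Proof.
elim: k u => [|k IH] u /=; first by exists 0.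
case=> u' /interl_rev h /IH[l c]; case: h => [h|[/near_chain[l1 h1] /near_chain[l2 h2]]].
  by exists l.+1, u'.
by exists (l1 + l2 + l)%N; apply: chain_cat c; apply: chain_cat h1 (chain_sym h2).
Qed.

(* A class of linked vertices lies on one side of the reversed segment, unless it
   contains the end vertex of that segment. *)
Lemma chain_side k u w i j : (i <= n)%N -> (j <= n)%N -> v i = u -> v j = w ->
  chain v k u w -> inrq i (+) inrq j -> exists l, chain v l u (v r).
Proof.
elim: k u i => [|k IH] u i hi hj vi vj /=.
  by move=> E x; apply/near_chain/(near_in (i1 := i) (i2 := j)) => //; split=> //; rewrite vj.
move=> [u' [uu' [i1 [i2 [j1 [j2 [c d x]]]]]] ch] hx.
have step : interl v u u' by split=> //; exists i1, i2, j1, j2.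
have [[i1n i2n vi1 vi2] [j1n j2n vj1 vj2]] := (c, d).
case: (boolP (inrq i (+) inrq i1)) => [h|h1].
  by apply/near_chain/(near_in _ h).
case: (boolP (inrq i (+) inrq i2)) => [h|h2].
  by apply/near_chain/(near_in _ h).
case: (boolP (inrq j1 (+) inrq j2)) => [h|h3].
  by have [l cl] := near_chain (near_in d h); exists l.+1, u'.
case: (boolP (inrq j1 (+) inrq j)) => [h|h4].
  by have [l cl] := IH u' j1 j1n hj vj1 vj ch h; exists l.+1, u'.
(* Now [i1], [i2] lie on the side of [i] and [j1], [j2] on the side of [j]. Two times inside the
   segment and two outside cannot interleave. *)
exfalso; move: x; rewrite /cross; case: rev => /andP[rq qn] vrq _ _ _.
lia.
Qed.

Lemma good_rev : good v p -> good v' p'.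
Proof.
move=> G k u w i1 i2 j1 j2 c d /chain_rev[{}k ch].
have [[i1n i2n _ _] [j1n j2n _ _]] := (c, d).
rewrite !gdiff_rev //.
have [rq vrq sy _ _] := rev; case/andP: rq => rq qn.
have cy : chord v (v r) r q by split=> //; apply: leq_trans qn.
have c' := chord_flip c; have d' := chord_flip d.
(* In the class of [v r], both chord labels commute with each other and with [y], and all three are
   involutions. The twists are [y] or 1, so any product of these factors is again an involution. *)
have linked l : chain v l u (v r) ->
    sq1 (twist p r q i2 * gdiff p (flip r q i1) (flip r q i2) * (twist p r q i1)^-1 *
        (twist p r q j2 * gdiff p (flip r q j1) (flip r q j2) * (twist p r q j1)^-1)).
  move=> lu.
  have lw : chain v (k + l) w (v r) by apply: chain_cat (chain_sym ch) lu.
  set g := gdiff p (flip r q i1) _; set h := gdiff p (flip r q j1) _.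
  have sg : sq1 g.
    have cc : chord v u (flip r q i1) (flip r q i1) by case: c'.
    by have := G 0 _ _ _ _ _ _ c' cc erefl; rewrite gdiffxx mulg1.
  have sh : sq1 h.
    have cc : chord v w (flip r q j1) (flip r q j1) by case: d'.
    by have := G 0 _ _ _ _ _ _ d' cc erefl; rewrite gdiffxx mulg1.
  have cgh : commute g h by apply: sq1_commute => //; apply: G ch.
  have cgy : commute g y by apply: sq1_commute => //; apply: G c' cy lu.
  have chy : commute h y by apply: sq1_commute => //; apply: G d' cy lw.
  have T t : (twist p r q t = y \/ twist p r q t = 1) by rewrite /twist; case: ifP; [left|right].
  have tg t : commute g (twist p r q t) by case: (T t) => -> //; apply: commute1.
  have th t : commute h (twist p r q t) by case: (T t) => -> //; apply: commute1.
  have tt s t : commute (twist p r q s) (twist p r q t).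
    case: (T s) => ->; last exact/commute_sym/commute1.
    by case: (T t) => ->; last exact: commute1.
  have st t : sq1 (twist p r q t) by case: (T t) => -> //; apply: sq1_1.
  rewrite !(sq1V (st _)).
  have hg := commute_sym cgh; have gt t := commute_sym (tg t); have ht t := commute_sym (th t).
  clearbody g h; move: (twist p r q) st tt tg th gt ht => e st tt tg th gt ht.
  by do ?[by [] | apply: sq1M | apply: commuteM | apply: commute_prodl].
case: (boolP (inrq i1 (+) inrq i2)) => hi.
  have [|l] := @near_chain u (v r); last exact: linked.
  by apply: near_in c' _; rewrite !flip_in.
case: (boolP (inrq j1 (+) inrq j2)) => hj.
  have [|l hl] := @near_chain w (v r); last exact: (linked (k + l)%N (chain_cat ch hl)).
  by apply: near_in d' _; rewrite !flip_in.
case: (boolP (inrq i1 (+) inrq j1)) => hij.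
  have [i1' _ vi1 _] := c'; have [j1' _ vj1 _] := d'.
  have [|l] := chain_side i1' j1' vi1 vj1 ch _; last exact: linked.
  by rewrite !flip_in.
(* In the remaining case all four ends lie on one side of the segment, so a single twist conjugates
   the whole product. *)
have E t : inrq t = inrq i1 -> twist p r q t = twist p r q i1 by rewrite /twist => ->.
rewrite (E i2) ?(E j2) ?(E j1); last 3 first.
- by move: hij; case: (inrq i1); case: (inrq j1).
- by move: hij hj; case: (inrq i1); case: (inrq j1); case: (inrq j2).
- by move: hi; case: (inrq i1); case: (inrq i2).
have J (e g h : Gamma) : e * g * e^-1 * (e * h * e^-1) = e * (g * h) * e^-1.
  by rewrite !mulgA mulgVK.
rewrite J; apply: sq1J.
exact: G ch.
Qed.

End Reversal.

(** * Commutation forced by equal labels *)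

Section Uniform.
(** Meant for the visits and prefix labels of all trails with given ends and edges, when these
    trails share one label. The chain argument then needs no walks. *)
Variable U : (nat -> V) -> (nat -> Gamma) -> Prop.
Hypothesis U_sq1 : forall v p r q, U v p -> (r <= q <= n)%N -> v r = v q -> sq1 (gdiff p r q).
Hypothesis U_rev : forall v p r q, U v p -> (r <= q <= n)%N -> v r = v q ->
  exists v' p', U v' p' /\ reversal r q v p v' p'.

Lemma U_chord_sq1 v p u i1 i2 : U v p -> chord v u i1 i2 -> sq1 (gdiff p i1 i2).
Proof.
move=> Uv [a b c d]; have [h|h] := leqP i1 i2.
  by apply: (U_sq1 Uv); rewrite ?h ?b // c d.
have S : sq1 (gdiff p i2 i1) by apply: (U_sq1 Uv); rewrite ?(ltnW h) ?a // c d.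
by rewrite -gdiffV (sq1V S).
Qed.

(** The labels of chords from [i1] are involutions, and so is the quotient of any two of them, being
    the label of another chord at [u]. Hence they commute. *)
Lemma commute_same v p u i1 i2 j1 j2 : U v p -> chord v u i1 i2 -> chord v u j1 j2 ->
  commute (gdiff p i1 i2) (gdiff p j1 j2).
Proof.
move=> Uv c d; have [[a1 a2 b1 b2] [a3 a4 b3 b4]] := (c, d).
have S i j : (i <= n)%N -> (j <= n)%N -> v i = u -> v j = u -> sq1 (gdiff p i j).
  by move=> *; apply: (U_chord_sq1 (u := u) Uv).
have C j : (j <= n)%N -> v j = u -> commute (gdiff p i1 i2) (gdiff p i1 j).
  move=> jn vj; apply: sq1_commute; [exact: S | exact: S |].
  by rewrite -(sq1V (S i1 j _ _ _ _)) // gdiffV -gdiff_trans; apply: S.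
rewrite (gdiff_trans p j1 i1 j2); apply: commuteM; first exact: C.
by rewrite -(gdiffV p i1 j1); apply: commuteV; apply: C.
Qed.

(** Reversing the first chord multiplies the label of the second by that of the first, on one side
    only. The product labels a chord of another member of [U], so it is an involution as well. *)
Lemma commute_cross v p u w i1 i2 j1 j2 : U v p -> u != w ->
  chord v u i1 i2 -> chord v w j1 j2 -> cross i1 i2 j1 j2 ->
  commute (gdiff p i1 i2) (gdiff p j1 j2).
Proof.
move=> Uv uw; wlog le_i : i1 i2 / (i1 <= i2)%N => [wl|] c d x.
  have [h|h] := leqP i1 i2; first exact: wl.
  rewrite -gdiffV; apply/commute_sym/commuteV/commute_sym/wl => //.
  - exact: ltnW.
  - exact: chord_sym.
  - by rewrite cross_swapl.
have [i1n i2n vi1 vi2] := c.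
have rng : (i1 <= i2 <= n)%N by rewrite le_i.
have [v' [p' [Uv' rev]]] := U_rev Uv rng (etrans vi1 (esym vi2)).
have d' := chord_unflip rev d; have [j1n j2n _ _] := d'.
have := U_chord_sq1 Uv' d'; rewrite (gdiff_rev rev) // !flipK /twist !flip_in.
have sy := U_chord_sq1 Uv c; have sg := U_chord_sq1 Uv d.
have [h1 h2 h3 h4] := chord_neq c d uw.
move: x; rewrite cross_in //; case: (i1 <= j1 <= i2)%N; case: (i1 <= j2 <= i2)%N => //= _.
  by rewrite mul1g (sq1V sy) => /(sq1_commute sg sy)/commute_sym.
by rewrite invg1 mulg1 => /(sq1_commute sy sg).
Qed.

(** Only some pair of chords is known to cross. A chord that does not cross is split at an end of a
    crossing chord at its vertex, chosen so that one part crosses; by additivity so does the other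
    part. This is done for each of the two chords. *)
Lemma commute_interl v p u w i1 i2 j1 j2 : U v p -> interl v u w ->
  chord v u i1 i2 -> chord v w j1 j2 -> commute (gdiff p i1 i2) (gdiff p j1 j2).
Proof.
move=> Uv [uw [a1 [a2 [b1 [b2 [ca cb xab]]]]]] c d.
have [[i1n i2n vi1 vi2] [j1n j2n vj1 vj2]] := (c, d).
have [[a1n a2n va1 va2] [b1n b2n vb1 vb2]] := (ca, cb).
have left_any d1 d2 : chord v w d1 d2 -> cross a1 a2 d1 d2 ->
    commute (gdiff p i1 i2) (gdiff p d1 d2).
  move=> cd xd; case: (boolP (cross i1 i2 d1 d2)) => [x|x].
    exact: (commute_cross Uv uw c cd).
  have [a [an va x1 x2]] :
      exists a, [/\ (a <= n)%N, v a = u, cross i1 a d1 d2 & cross a i2 d1 d2].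
    move: x; case: (boolP (cross i1 a1 d1 d2)) => y x.
      by exists a1; split=> //; move: x; rewrite (cross_transl i1 a1) y; case: cross.
    exists a2; split=> //; first by rewrite (cross_transl i1 a1) (negbTE y) xd.
    move: x; rewrite (cross_transl i1 a1) (cross_transl a1 a2) (negbTE y) xd.
    by case: cross.
  rewrite (gdiff_trans p i1 a i2); apply: commute_prodl.
    by apply: (commute_cross Uv uw _ cd x2).
  by apply: (commute_cross Uv uw _ cd x1).
case: (boolP (cross a1 a2 j1 j2)) => [x|x]; first exact: left_any.
have [b [bn vb x1 x2]] :
    exists b, [/\ (b <= n)%N, v b = w, cross a1 a2 j1 b & cross a1 a2 b j2].
  move: x; case: (boolP (cross a1 a2 j1 b1)) => y x.
    by exists b1; split=> //; move: x; rewrite (cross_transr a1 a2 j1 b1) y; case: cross.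
  exists b2; split=> //; first by rewrite (cross_transr a1 a2 j1 b1) (negbTE y) xab.
  move: x; rewrite (cross_transr a1 a2 j1 b1) (cross_transr a1 a2 b1 b2) (negbTE y) xab.
  by case: cross.
by rewrite (gdiff_trans p j1 b j2); apply: commuteM; apply: left_any.
Qed.

(** A link is lost only if its far vertex is [v r] or interlaced with [v r]. The rest of the chain,
    entered from [v r], is then no longer than the whole. *)
Lemma chain_rev_or_short r q v p v' p' k u w : reversal r q v p v' p' -> chain v k u w ->
  chain v' k u w \/ exists2 l, (l <= k)%N & chain v l (v r) w.
Proof.
move=> rev; elim: k u => [|k IH] u /=; first by left.
case=> u' [uu' [i1 [i2 [j1 [j2 [c d x]]]]]] ch.
have [h1 h2 h3 h4] := chord_neq c d uu'.
case: (boolP (((r <= i1 <= q) (+) (r <= i2 <= q)) && ((r <= j1 <= q) (+) (r <= j2 <= q)))%N).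
  case/andP=> _ /(near_in rev d) [E|/interl_sym h]; right.
    by exists k => //; rewrite -E.
  by exists k.+1 => //; exists u'.
move=> nb; case: (IH _ ch) => [ch'|[l lk cl]]; last by right; exists l => //; apply: leqW.
left; exists u' => //; split=> //.
exists (flip r q i1), (flip r q i2), (flip r q j1), (flip r q j2); split.
- exact: chord_unflip rev _ _ _ c.
- exact: chord_unflip rev _ _ _ d.
- by rewrite cross_flip // (negbTE nb) addbF.
Qed.

(* Reversing a chord at [u'] that crosses a chord at [u] and one at [u''] makes [u] and
   [u''] interlaced, which shortens the chain [u], [u'], [u''], ..., [w]. *)
Lemma commute_chain k v p u w i1 i2 j1 j2 : U v p -> chain v k u w ->
  chord v u i1 i2 -> chord v w j1 j2 -> commute (gdiff p i1 i2) (gdiff p j1 j2).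
Proof.
elim/ltn_ind: k => -[|[|k]] IH in v p u w i1 i2 j1 j2 * => Uv /=.
- by move=> -> c d; apply: commute_same Uv c d.
- by move=> [u' h <-] c d; apply: commute_interl Uv h c d.
move=> [u1 h01 [u2 h12 ch]] c d.
have [u02|nu02] := eqVneq u u2.
  by apply: (IH k _ v p u w) => //; rewrite u02.
have [n01 [x1 [x2 [a1 [a2 [cx ca xa]]]]]] := h01.
have [n12 [b1 [b2 [z1 [z2 [cb cz bz]]]]]] := h12.
have [e1 e2 e3 e4] := chord_neq cb cz n12.
have [[a1n a2n va1 va2] [b1n b2n vb1 vb2]] := (ca, cb).
have [[x1n x2n vx1 vx2] [z1n z2n vz1 vz2]] := (cx, cz).
case: (boolP (cross x1 x2 z1 z2)) => xz.
  apply: (IH k.+1 _ v p u w) => //; exists u2 => //.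
  by split=> //; exists x1, x2, z1, z2.
(* The chord [a1], [a2] at [u1] crosses a chord at [u], and [b1], [b2] crosses one at [u2]. Two of
   these four times form a chord that crosses both. *)
have [r [q [rq [rn vr] [qn vq] xr zr]]] : exists r q, [/\ (r <= q)%N,
    (r <= n)%N /\ v r = u1, (q <= n)%N /\ v q = u1, cross x1 x2 r q & cross z1 z2 r q].
  have zb : cross z1 z2 b1 b2 by rewrite -crossC.
  have [r [q [[rn vr] [qn vq] xr zr]]] := @separate_both nat
    (fun t => (x1 < t)%N (+) (x2 < t)%N) (fun t => (z1 < t)%N (+) (z2 < t)%N)
    (fun t => (t <= n)%N /\ v t = u1) a1 a2 b1 b2
    (conj a1n va1) (conj a2n va2) (conj b1n vb1) (conj b2n vb2) xa zb.
  have [rq|/ltnW rq] := leqP r q; first by exists r, q.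
  by exists q, r; rewrite cross_swapr (cross_swapr z1).
have rng : (r <= q <= n)%N by rewrite rq.
have [v' [p' [Uv' rev]]] := U_rev Uv rng (etrans vr (esym vq)).
have cr : chord v u1 r q by [].
have [f1 f2 f3 f4] := chord_neq cx cr n01.
have [f5 f6 f7 f8] := chord_neq cr cz n12.
have [f9 f10 f11 f12] := chord_neq cx cz nu02.
(* If the reversal breaks the chain from [u2], at most [k] links lead from [u1] to [w]; with the
   link from [u] to [u1] this stays below [k.+2]. *)
case: (chain_rev_or_short rev ch) => [ch'|[l lk]]; last first.
  rewrite vr => cl; apply: (IH l.+1 _ v p u w) => //.
  by exists u1.
have cxy : commute (gdiff p i1 i2) (gdiff p r q) by apply: commute_interl Uv h01 c cr.
have czy : commute (gdiff p j1 j2) (gdiff p r q).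
  by apply/commute_sym/(IH k.+1 _ v p u1 w) => //; exists u2.
have := IH k.+1 _ v' p' u w _ _ _ _ Uv' _ (chord_unflip rev c) (chord_unflip rev d).
have [[i1n i2n _ _] [j1n j2n _ _]] := (c, d).
rewrite !(gdiff_rev rev) ?flip_le // !flipK => C.
set tw := twist p r q in C.
have T t : tw t = gdiff p r q \/ tw t = 1 by rewrite /tw /twist; case: ifP; [left|right].
have tx t : commute (gdiff p i1 i2) (tw t) by case: (T t) => ->; [|apply: commute1].
have tz t : commute (gdiff p j1 j2) (tw t) by case: (T t) => ->; [|apply: commute1].
have tt s t : commute (tw s) (tw t).
  case: (T s) => ->; last exact/commute_sym/commute1.
  by case: (T t) => ->; last exact: commute1.
have {}C := C (ltnSn _).
set X := gdiff p i1 i2 in tx cxy C *; set Z := gdiff p j1 j2 in tz czy C *.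
(* The reversal makes [u] and [u2] interlaced, so induction gives that [X * e] and [Z * f] commute,
   where [e] and [f] are products of twists. These commute with everything here and can be stripped
   off. *)
move: C; rewrite -tx -(tz (flip r q j2)) -(mulgA X) -(mulgA Z).
set e := (_ * _^-1); set f := (tw (flip r q j2) * _) => C.
have xe : commute X e by apply: commuteM => //; apply: commuteV.
have xf : commute X f by apply: commuteM => //; apply: commuteV.
have ze : commute Z e by apply: commuteM => //; apply: commuteV.
have zf : commute Z f by apply: commuteM => //; apply: commuteV.
have ef : commute e f.
  apply: commuteM; last apply: commuteV; apply: commute_prodl => //.
    by apply/commute_sym/commuteV.
  by apply/commute_sym/commuteV.
have {}C : commute (X * e) (Z * f).
  apply: C; exists u2 => //; split=> //.
  exists (flip r q x1), (flip r q x2), (flip r q z1), (flip r q z2); split.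
  - exact: chord_unflip rev _ _ _ cx.
  - exact: chord_unflip rev _ _ _ cz.
  have xin : (r <= x1 <= q)%N (+) (r <= x2 <= q)%N.
    by rewrite -cross_in ?(eq_sym r) ?(eq_sym q) // -crossC.
  have zin : (r <= z1 <= q)%N (+) (r <= z2 <= q)%N by rewrite -cross_in // crossC.
  by rewrite cross_flip // (negbTE xz) xin zin.
have X' : X = (X * e) * e^-1 by rewrite mulgK.
have Z' : Z = (Z * f) * f^-1 by rewrite mulgK.
rewrite X' Z'; apply: commuteM; last by apply: commuteV; rewrite mulgK.
by apply: commute_prodl => //; apply/commute_sym/commuteV/commute_prodl.
Qed.

Lemma uniform_good v p : U v p -> good v p.
Proof.
move=> Uv k u w i1 i2 j1 j2 c d ch.
apply: sq1M; [exact: U_chord_sq1 Uv c | exact: U_chord_sq1 Uv d |].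
exact: commute_chain Uv ch c d.
Qed.

End Uniform.

End Times.

(** * Reversals connect the trails with given ends and edges *)

Section Walks.
Variable G : graph.
Implicit Types (a b c : vertex G) (x y f : arc_of G) (s S T P Q R : seq (arc_of G)).

Definition edges_of s : seq (edge G) := [seq arc_edge x | x <- s].

Definition endv a s : vertex G := last a [seq arc_head x | x <- s].

Definition rev_walk s : seq (arc_of G) := rev [seq arc_inv x | x <- s].

Definition rev_step a s s' : Prop :=
  exists P Q R, [/\ s = P ++ Q ++ R, s' = P ++ rev_walk Q ++ R & endv a P = endv a (P ++ Q)].

Lemma arc_invK : involutive (@arc_inv G).
Proof. by case=> e o; rewrite /arc_inv negbK. Qed.

Lemma arc_tail_inv x : arc_tail (arc_inv x) = arc_head x.
Proof. by case: x => e []. Qed.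

Lemma arc_head_inv x : arc_head (arc_inv x) = arc_tail x.
Proof. by case: x => e []. Qed.

Lemma same_edge x y : arc_edge x = arc_edge y -> x = y \/ x = arc_inv y.
Proof.
case: x => e o; case: y => e' o'; rewrite /arc_edge /arc_inv /= => ->.
by case: o; case: o'; [left|right|right|left].
Qed.

Lemma endv_cat a s1 s2 : endv a (s1 ++ s2) = endv (endv a s1) s2.
Proof. by rewrite /endv map_cat last_cat. Qed.

Lemma endv_rcons a s x : endv a (rcons s x) = arc_head x.
Proof. by rewrite /endv map_rcons last_rcons. Qed.

Lemma walk_endv a b s : walk a b s -> endv a s = b.
Proof. by elim: s a => [|x s IH] a /= => [/eqP|/andP[_ /IH]]. Qed.

Lemma walk_cat a b s1 s2 :
  walk a b (s1 ++ s2) = walk a (endv a s1) s1 && walk (endv a s1) b s2.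
Proof. by elim: s1 a => [|x s IH] a /=; rewrite ?eqxx //= IH andbA. Qed.

Lemma walk_rcons a b s x :
  walk a b (rcons s x) = walk a (arc_tail x) s && (arc_head x == b).
Proof. by elim: s a => [|y s IH] a /=; rewrite ?IH ?andbA // eq_sym. Qed.

Lemma rev_walk_cons x s : rev_walk (x :: s) = rcons (rev_walk s) (arc_inv x).
Proof. by rewrite /rev_walk /= rev_cons. Qed.

Lemma rev_walk_cat s1 s2 : rev_walk (s1 ++ s2) = rev_walk s2 ++ rev_walk s1.
Proof. by rewrite /rev_walk map_cat rev_cat. Qed.

Lemma rev_walkK : involutive rev_walk.
Proof.
move=> s; rewrite /rev_walk map_rev revK -map_comp -[RHS]map_id.
by apply: eq_map => x; apply: arc_invK.
Qed.

Lemma size_rev_walk s : size (rev_walk s) = size s.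
Proof. by rewrite /rev_walk size_rev size_map. Qed.

Lemma walk_rev a b s : walk a b s -> walk b a (rev_walk s).
Proof.
elim: s a => [|x s IH] a /=; first by rewrite eq_sym.
case/andP=> /eqP ha /IH h.
by rewrite rev_walk_cons walk_rcons arc_tail_inv arc_head_inv ha eqxx andbT.
Qed.

Lemma edges_rev_walk s : edges_of (rev_walk s) = rev (edges_of s).
Proof. by rewrite /edges_of /rev_walk map_rev -map_comp. Qed.

Lemma edges_of_cat s1 s2 : edges_of (s1 ++ s2) = edges_of s1 ++ edges_of s2.
Proof. exact: map_cat. Qed.

Lemma rev_step_edges a s s' : rev_step a s s' -> perm_eq (edges_of s) (edges_of s').
Proof.
move=> [P [Q [R [-> -> _]]]]; rewrite !edges_of_cat edges_rev_walk.
by rewrite perm_cat2l perm_cat2r perm_sym perm_rev.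
Qed.

Lemma rev_step_walk a b s s' : rev_step a s s' -> walk a b s -> walk a b s'.
Proof.
move=> [P [Q [R [-> -> E]]]]; rewrite !walk_cat -endv_cat -E.
case/and3P=> -> hQ hR; have := walk_rev hQ.
by move=> h; rewrite (walk_endv h) h hR.
Qed.

Lemma rev_step_size a s s' : rev_step a s s' -> size s' = size s.
Proof. by move=> /rev_step_edges/perm_size; rewrite !size_map => ->. Qed.

Lemma rev_step_cons f s s' : rev_step (arc_head f) s s' -> forall a, rev_step a (f :: s) (f :: s').
Proof. by move=> [P [Q [R [-> -> E]]]] a; exists (f :: P), Q, R. Qed.

Definition visits a s c : Prop := exists s1 s2, s = s1 ++ s2 /\ endv a s1 = c.

Lemma visits_ends a b s y : walk a b s -> arc_edge y \in edges_of s ->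
  visits a s (arc_tail y) /\ visits a s (arc_head y).
Proof.
move=> w /mapP[x /splitPr xs E]; case: xs w => s1 s2.
rewrite walk_cat /= => /and3P[_ /eqP hx _].
have vt : visits a (s1 ++ x :: s2) (arc_tail x) by exists s1, (x :: s2).
have vh : visits a (s1 ++ x :: s2) (arc_head x).
  by exists (rcons s1 x), s2; rewrite cat_rcons endv_rcons.
by case: (same_edge E) => ->; rewrite ?arc_tail_inv ?arc_head_inv.
Qed.

(** Follow [T] up to its first edge in [S]. The earlier edges lie in [R], so [T] is then at a vertex
    visited by [R], which is also an end of an edge of [S]. *)
Lemma shared_vertex a0 b0 c0 d0 S R T c b : walk a0 b0 S -> walk c0 d0 R -> visits c0 R c ->
  walk c b T -> {subset edges_of T <= edges_of S ++ edges_of R} ->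
  has (fun e => e \in edges_of S) (edges_of T) ->
  exists u, visits a0 S u /\ visits c0 R u.
Proof.
move=> wS wR; elim: T c => [|y T IH] c //= vc /andP[/eqP tc wT] sub.
case: (boolP (arc_edge y \in edges_of S)) => [yS _|nyS /= h].
  by exists c; split=> //; rewrite -tc; case: (visits_ends wS yS).
have yR : arc_edge y \in edges_of R.
  by have := sub (arc_edge y); rewrite mem_cat (negbTE nyS); apply; rewrite inE eqxx.
apply: (IH (arc_head y)) => //; first by case: (visits_ends wR yR).
by move=> e he; apply: sub; rewrite inE he orbT.
Qed.

(** Induction on [T]: reversals bring its first arc [f] to the front, and [Pr] is then read on
    trails with [f] prefixed. Connectedness under reversals is expressed as an induction principle
    for properties that reversals preserve. *)
Lemma kotzig a b s T (Pr : seq (arc_of G) -> Prop) :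
  (forall s1 s2, rev_step a s1 s2 -> Pr s1 -> Pr s2) ->
  walk a b s -> walk a b T -> uniq (edges_of T) -> perm_eq (edges_of s) (edges_of T) ->
  Pr s -> Pr T.
Proof.
elim: T a s Pr => [|f T IH] a s Pr step ws wT uT pe prs.
  by move/perm_nilP: pe; case: s {ws} prs.
suff [s'' [ws'' pe'' pr'']] : exists s'', [/\ walk a b (f :: s''),
    perm_eq (edges_of (f :: s'')) (edges_of (f :: T)) & Pr (f :: s'')].
  apply: (IH (arc_head f) s'' (fun u => Pr (f :: u))) => //.
  - by move=> s1 s2 h; apply: step; apply: rev_step_cons.
  - by case/andP: ws''.
  - by case/andP: wT.
  - by case/andP: uT.
  - by move: pe''; rewrite /= perm_cons.
have go s1 s2 : rev_step a s1 s2 ->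
    [/\ walk a b s1, perm_eq (edges_of s1) (edges_of (f :: T)) & Pr s1] ->
    [/\ walk a b s2, perm_eq (edges_of s2) (edges_of (f :: T)) & Pr s2].
  move=> st [w1 p1 r1]; split; [exact: rev_step_walk st w1 | | exact: step st r1].
  by apply: perm_trans p1; rewrite perm_sym (rev_step_edges st).
have fa : arc_tail f = a by case/andP: wT => /eqP.
have /mapP[x /splitPr xs E] : arc_edge f \in edges_of s by rewrite (perm_mem pe) inE eqxx.
case: xs ws pe prs => S R ws pe prs.
have base := And3 ws pe prs.
move: (ws); rewrite walk_cat /= => /and3P[wS /eqP tx wR].
(* If [f] is traversed backwards, the part of the trail up to and including it is closed at [a], and
   its reversal starts with [f]. *)
case: (same_edge E) => fx; last first.
  have xf : x = arc_inv f by rewrite fx arc_invK.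
  exists (rev_walk S ++ R); apply: (go _ (f :: rev_walk S ++ R) _ base).
  exists [::], (rcons S x), R; split.
  - by rewrite cat_rcons.
  - by rewrite /= /rev_walk map_rcons rev_rcons -fx.
  - by rewrite /= endv_rcons xf arc_head_inv fa.
subst x; rewrite fa in tx.
case: (altP (S =P [::])) => [S0|Sne]; first by exists R; move: base; rewrite S0.
(* If [f] is traversed forwards, [S] is closed at [a]. The target trail has to get from the head of
   [f] to the edges of [S], so [S] and [R] share a vertex. *)
have [u [[S1 [S2 [eS eu]]] [R1 [R2 [eR eu']]]]] :
    exists u, visits a S u /\ visits (arc_head f) R u.
  have [_ wT'] := andP wT.
  apply: (shared_vertex wS wR _ wT'); first by exists [::], R.
    move=> e he; have : e \in edges_of (S ++ f :: R) by rewrite (perm_mem pe) inE he orbT.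
    rewrite edges_of_cat !mem_cat inE => /or3P[-> //|/eqP ef|->]; last by rewrite orbT.
    by move: uT; rewrite /= -ef he.
  case: S Sne pe {ws base prs wS tx} => // y S _ pe.
  apply/hasP; exists (arc_edge y); last by rewrite inE eqxx.
  have : arc_edge y \in edges_of (f :: T) by rewrite -(perm_mem pe) inE eqxx.
  rewrite inE => /orP[/eqP ey|//].
  have := uT; rewrite -(perm_uniq pe) /= => /andP[].
  by rewrite edges_of_cat mem_cat inE /= ey eqxx orbT.
(* Two reversals: the segment [S2 ++ f :: R1], closed at the shared vertex, and then the prefix up
   to the inverse of [f], closed at [a]. The script justifies the second one first. *)
exists (R1 ++ rev_walk S1 ++ rev_walk S2 ++ R2).
apply: (go (S1 ++ rev_walk R1 ++ arc_inv f :: rev_walk S2 ++ R2)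
  (f :: R1 ++ rev_walk S1 ++ rev_walk S2 ++ R2)).
  exists [::], (S1 ++ rcons (rev_walk R1) (arc_inv f)), (rev_walk S2 ++ R2); split.
  - by rewrite /= -!catA -cat_rcons.
  - rewrite /= rev_walk_cat -{1}(rev_walkK R1) /rev_walk map_rcons rev_rcons arc_invK /=.
    by rewrite -/(rev_walk _) -!catA -/(rev_walk (rev_walk R1)) !rev_walkK.
  - by rewrite /= -rcons_cat endv_rcons arc_head_inv fa.
apply: (go _ _ _ base); exists S1, (S2 ++ f :: R1), R2; split.
- by rewrite eS eR -!catA.
- by rewrite rev_walk_cat rev_walk_cons cat_rcons -!catA.
- by rewrite catA -eS endv_cat /= eu -eu'.
Qed.

End Walks.

(** * Trail labels under reversals *)

Section WalkLabels.
Local Open Scope group_scope.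
Variables (Gamma : groupType) (G : graph) (gamma : arc_of G -> Gamma).
Hypothesis gammaV : group_labeling gamma.
Implicit Types (a b : vertex G) (s P Q R : seq (arc_of G)).

Local Notation label := (trail_label gamma).

Lemma label_cat s1 s2 : label (s1 ++ s2) = label s1 * label s2.
Proof. by rewrite /trail_label big_cat. Qed.

Lemma label_rev_walk s : label (rev_walk s) = (label s)^-1.
Proof.
elim: s => [|x s IH]; first by rewrite /trail_label !big_nil invg1.
rewrite rev_walk_cons -cats1 label_cat IH /trail_label big_seq1 big_cons invgM.
by rewrite gammaV.
Qed.

Definition visit_time a s (t : nat) : vertex G := endv a (take t s).
Definition prefix_label s (t : nat) : Gamma := label (take t s).

Lemma visit_time_cat a P Q : visit_time a (P ++ Q) (size P) = endv a P.
Proof. by rewrite /visit_time take_size_cat. Qed.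

Lemma visit_time_cat2 a P Q R :
  visit_time a (P ++ Q ++ R) (size P + size Q) = endv a (P ++ Q).
Proof. by rewrite catA -size_cat visit_time_cat. Qed.

Lemma gdiff_closed P Q R :
  gdiff (prefix_label (P ++ Q ++ R)) (size P) (size P + size Q) =
  label P * label Q * (label P)^-1.
Proof.
rewrite /gdiff /prefix_label takeD take_size_cat // drop_size_cat // take_size_cat //.
by rewrite label_cat.
Qed.

Lemma sq1_closed (x z : Gamma) : sq1 (x * z * x^-1) -> sq1 z.
Proof.
rewrite /sq1 !mulgA mulgVK => h; apply: (mulgI x); apply: (mulIg x^-1).
by rewrite mulg1 mulgV mulgA.
Qed.

Lemma rev_step_reversal a b P Q R : walk a b (P ++ Q ++ R) -> endv a P = endv a (P ++ Q) ->
  sq1 (label Q) ->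
  reversal (size (P ++ Q ++ R)) (size P) (size P + size Q)
    (visit_time a (P ++ Q ++ R)) (prefix_label (P ++ Q ++ R))
    (visit_time a (P ++ rev_walk Q ++ R)) (prefix_label (P ++ rev_walk Q ++ R)).
Proof.
move=> w E sQ; set s := P ++ Q ++ R; set s' := P ++ _.
have tkP : take (size P) s = P by rewrite take_size_cat.
have tkQ : take (size P + size Q) s = P ++ Q by rewrite /s catA take_size_cat // size_cat.
have wPQ : walk (endv a P) (endv a P) Q.
  by move: w; rewrite !walk_cat => /and3P[_ + _]; rewrite -endv_cat -E.
have lQV := sq1V sQ.
(* Inside the segment, the new trail has read the reverse of a suffix [Q2] of [Q], while the
   mirrored time of the old trail has read the complementary prefix [Q1]. *)
have cases t : (t <= size s)%N -> [\/ (t < size P)%N /\ flip (size P) (size P + size Q) t = t,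
    exists Q1 Q2, [/\ Q = Q1 ++ Q2, take t s' = P ++ rev_walk Q2,
       take (flip (size P) (size P + size Q) t) s = P ++ Q1 &
       (size P <= t <= size P + size Q)%N] |
    exists R1, [/\ take t s' = P ++ rev_walk Q ++ R1, take t s = P ++ Q ++ R1,
       flip (size P) (size P + size Q) t = t & ~~ (size P <= t <= size P + size Q)%N]].
  move=> tn; have [h1|h1] := ltnP t (size P).
    by constructor 1; rewrite /flip leqNgt h1.
  have [h2|h2] := leqP t (size P + size Q).
    constructor 2; exists (take (size P + size Q - t) Q), (drop (size P + size Q - t) Q).
    set Q1 := take _ Q; set Q2 := drop _ Q.
    have eQ : Q = Q1 ++ Q2 by rewrite cat_take_drop.
    have sQ1 : size Q1 = (size P + size Q - t)%N by rewrite size_takel //; lia.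
    have sQ2 : (size Q1 + size Q2 = size Q)%N by rewrite eQ size_cat.
    rewrite /flip h1 h2; split=> //.
      rewrite /s' {1}eQ rev_walk_cat -catA catA take_size_cat //.
      by rewrite size_cat size_rev_walk; lia.
    by rewrite /s {2}eQ -catA catA take_size_cat // size_cat; lia.
  constructor 3; exists (take (t - (size P + size Q)) R).
  rewrite /flip h1 leqNgt h2 /=; split=> //.
  - rewrite -{1}(subnKC (ltnW h2)) takeD /s' catA take_size_cat ?size_cat ?size_rev_walk //.
    by rewrite drop_size_cat ?size_cat ?size_rev_walk // catA.
  - rewrite -{1}(subnKC (ltnW h2)) takeD /s catA take_size_cat ?size_cat //.
    by rewrite drop_size_cat ?size_cat // catA.
have gy : gdiff (prefix_label s) (size P) (size P + size Q) = label P * label Q * (label P)^-1.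
  exact: gdiff_closed.
split.
- by rewrite leq_addr !size_cat addnA leq_addr.
- by rewrite /visit_time tkP tkQ.
- by rewrite gy; apply: sq1J.
- move=> t /cases[[h ->]|[Q1 [Q2 [eQ tQ tQ' _]]]|[R1 [tR' tR -> _]]]; rewrite /visit_time.
  + by rewrite /s /s' !take_cat h.
  + rewrite tQ tQ'; move: wPQ; rewrite eQ walk_cat => /andP[_] /walk_rev /walk_endv.
    by rewrite !endv_cat => ->.
  + rewrite tR' tR !endv_cat (walk_endv (walk_rev wPQ)).
    by rewrite (walk_endv wPQ).
- move=> t /cases[[h ->]|[Q1 [Q2 [eQ tQ tQ' h]]]|[R1 [tR' tR -> h]]].
  + by rewrite /prefix_label /s /s' !take_cat h /twist leqNgt h /= mul1g.
  + rewrite /prefix_label tQ tQ' /twist h gy !label_cat -lQV eQ label_cat invgM.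
    by rewrite !mulgA mulgVK mulgVK label_rev_walk.
  + rewrite /prefix_label tR' tR /twist (negbTE h) mul1g !label_cat label_rev_walk.
    by rewrite lQV.
Qed.

(** Relative to the edges of [s] rather than to all edges, because the search applies it to the part
    of a trail behind a fixed prefix. *)
Definition uniform_trail a b s : Prop := forall s', walk a b s' ->
  perm_eq (edges_of s) (edges_of s') -> label s' = label s.

Lemma label_rev_step a b s : uniform_trail a b s -> forall P Q R, walk a b (P ++ Q ++ R) ->
  perm_eq (edges_of s) (edges_of (P ++ Q ++ R)) -> endv a P = endv a (P ++ Q) -> sq1 (label Q).
Proof.
move=> u P Q R w pe E.
have st : rev_step a (P ++ Q ++ R) (P ++ rev_walk Q ++ R) by exists P, Q, R.
have := u _ (rev_step_walk st w) (perm_trans pe (rev_step_edges st)).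
rewrite -(u _ w pe) !label_cat label_rev_walk => /mulgI/mulIg h.
by rewrite /sq1 -{1}h mulVg.
Qed.

Definition good_trail a s : Prop := good (size s) (visit_time a s) (prefix_label s).

Lemma closed_split s r q : (r <= q <= size s)%N ->
  exists P Q R, [/\ s = P ++ Q ++ R, size P = r & (size P + size Q = q)%N].
Proof.
case/andP=> rq qn; exists (take r s), (take (q - r) (drop r s)), (drop (q - r) (drop r s)).
have h : (r <= size s)%N by lia.
have h' : (q - r <= size (drop r s))%N by rewrite size_drop; lia.
by rewrite !cat_take_drop !size_takel // subnKC.
Qed.

Lemma uniform_good_trail a b s : walk a b s -> uniform_trail a b s -> good_trail a s.
Proof.
move=> ws us.
pose U v p := exists s', [/\ walk a b s', perm_eq (edges_of s) (edges_of s'),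
   v = visit_time a s' & p = prefix_label s'].
have key v p r q : U v p -> (r <= q <= size s)%N -> v r = v q ->
    sq1 (gdiff p r q) /\ exists v' p', U v' p' /\ reversal (size s) r q v p v' p'.
  move=> [s' [w' pe -> ->]] rq.
  have szs : size s = size s' by move/perm_size: (pe); rewrite !size_map.
  rewrite szs in rq *; have [P [Q [R [es' <- <-]]]] := closed_split rq.
  subst s'; rewrite visit_time_cat visit_time_cat2 => E;
  have sQ := label_rev_step us w' pe E.
  split; first by rewrite gdiff_closed; apply: sq1J.
  have st : rev_step a (P ++ Q ++ R) (P ++ rev_walk Q ++ R) by exists P, Q, R.
  exists (visit_time a (P ++ rev_walk Q ++ R)), (prefix_label (P ++ rev_walk Q ++ R)).
  split; last exact: rev_step_reversal w' E sQ.
  exists (P ++ rev_walk Q ++ R); split=> //; first exact: rev_step_walk st w'.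
  exact: perm_trans pe (rev_step_edges st).
apply: (@uniform_good _ _ _ U).
- by move=> v p r q h1 h2 h3; case: (key v p r q h1 h2 h3).
- by move=> v p r q h1 h2 h3; case: (key v p r q h1 h2 h3).
- by exists s.
Qed.

Lemma good_closed a P Q R : good_trail a (P ++ Q ++ R) -> endv a P = endv a (P ++ Q) ->
  sq1 (label Q).
Proof.
move=> g E; set s := P ++ Q ++ R in g *.
have c : chord (size s) (visit_time a s) (endv a P) (size P) (size P + size Q).
  split; rewrite ?visit_time_cat ?visit_time_cat2 // /s !size_cat; lia.
have c' : chord (size s) (visit_time a s) (endv a P) (size P) (size P) by case: c.
have := g 0%N _ _ _ _ _ _ c c' erefl; rewrite gdiffxx mulg1 gdiff_closed.
exact: sq1_closed.
Qed.

(** Goodness makes the label of every closed segment an involution, so a reversal keeps the label,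
    and [good_rev] keeps goodness; [kotzig] reaches all trails. *)
Lemma good_uniform_trail a b s : walk a b s -> uniq (edges_of s) -> good_trail a s ->
  uniform_trail a b s.
Proof.
move=> ws us gs T wT pe.
pose Pr s' := [/\ walk a b s', good_trail a s' & label s' = label s].
suff : Pr T by case.
apply: (@kotzig _ a b s T Pr) => //; last by rewrite -(perm_uniq pe).
move=> s1 s2 st [w1 g1 l1]; split; first exact: rev_step_walk st w1.
- have := rev_step_size st; case: st => P [Q [R [e1 e2 E]]] sz.
  subst s1 s2; rewrite /good_trail sz.
  exact: (good_rev (rev_step_reversal w1 E (good_closed g1 E)) g1).
- case: st => P [Q [R [e1 e2 E]]]; subst s1 s2; rewrite -l1 !label_cat label_rev_walk.
  by rewrite (sq1V (good_closed g1 E)).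
Qed.

End WalkLabels.

(** * Programs with bounded loops *)

Inductive bound := BM | BM1 | B2M.

(* Register 1 holds the number [m] of edges and is never overwritten. *)
Definition bound_expr (b : bound) : expr :=
  match b with
  | BM => EReg 1
  | BM1 => EAdd (EReg 1) (ECst 1)
  | B2M => EAdd (EReg 1) (EReg 1)
  end.

Definition bound_val (b : bound) (m : nat) : nat :=
  match b with BM => m | BM1 => m + 1 | B2M => m + m end.

Inductive prog :=
| PSkip
| PSet of nat & expr
| PPut of nat & expr & expr
| PSeq of prog & prog
| PIf of expr & prog & prog
| PFor of nat & bound & prog
| PQuery of nat & nat & expr.

(** The value is twelve times register 1; expressions have no multiplication. *)
Definition query_bound : expr :=
  let e := EAdd (EReg 1) (EAdd (EReg 1) (EReg 1)) in EAdd (EAdd e e) (EAdd e e).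

(* A query is guarded by a test of its length, so that its cost is at most
   [phi (12 * m)] whatever the state. *)
Fixpoint compile (p : prog) : cmd :=
  match p with
  | PSkip => CSkip
  | PSet r e => CSet r e
  | PPut t e1 e2 => CPut t e1 e2
  | PSeq p1 p2 => CSeq (compile p1) (compile p2)
  | PIf e p1 p2 => CIf e (compile p1) (compile p2)
  | PFor i b p1 =>
      CSeq (CSet i (ECst 0))
        (CWhile (ELt (EReg i) (bound_expr b))
           (CSeq (compile p1) (CSet i (EAdd (EReg i) (ECst 1)))))
  | PQuery r t e => CIf (ELt query_bound e) CSkip (CQuery r t e)
  end.

Fixpoint written_regs (p : prog) : seq nat :=
  match p with
  | PSkip | PPut _ _ _ => [::]
  | PSet r _ | PQuery r _ _ => [:: r]
  | PSeq p1 p2 | PIf _ p1 p2 => written_regs p1 ++ written_regs p2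
  | PFor i _ p1 => i :: written_regs p1
  end.

Fixpoint written_arrs (p : prog) : seq nat :=
  match p with
  | PSkip | PSet _ _ | PQuery _ _ _ => [::]
  | PPut t _ _ => [:: t]
  | PSeq p1 p2 | PIf _ p1 p2 => written_arrs p1 ++ written_arrs p2
  | PFor _ _ p1 => written_arrs p1
  end.

Fixpoint wf (p : prog) : bool :=
  match p with
  | PSkip | PPut _ _ _ => true
  | PSet r _ | PQuery r _ _ => r != 1
  | PSeq p1 p2 | PIf _ p1 p2 => wf p1 && wf p2
  | PFor i _ p1 => [&& i != 1, i \notin written_regs p1 & wf p1]
  end.

Definition frame (p : prog) (s s' : state) : Prop :=
  (forall r, r \notin written_regs p -> reg s' r = reg s r) /\
  (forall t, t \notin written_arrs p -> forall i, arr s' t i = arr s t i).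

Section Programs.
Variables (oracle : seq nat -> bool) (phi : nat -> nat).
Hypothesis phi_mono : forall i j, i <= j -> phi i <= phi j.

(** Bounded loops always terminate, so a program denotes a function on states. Correctness is proved
    for this function, and [exec_compile] relates it to execution and time. *)
Fixpoint den (p : prog) (s : state) : state :=
  match p with
  | PSkip => s
  | PSet r e => set_reg s r (eval_expr s e)
  | PPut t e1 e2 => set_arr s t (eval_expr s e1) (eval_expr s e2)
  | PSeq p1 p2 => den p2 (den p1 s)
  | PIf e p1 p2 => if eval_expr s e != 0 then den p1 s else den p2 s
  | PFor i b p1 =>
      iter (bound_val b (reg s 1))
        (fun s1 => let s2 := den p1 s1 in set_reg s2 i (reg s2 i + 1)) (set_reg s i 0)
  | PQuery r t e =>
      if eval_expr s query_bound < eval_expr s e then s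
      else set_reg s r (oracle (mkseq (arr s t) (eval_expr s e)))
  end.

Lemma den_frame p s : frame p s (den p s).
Proof.
elim: p s => [|r e|t e1 e2|p1 IH1 p2 IH2|e p1 IH1 p2 IH2|i b p IH|r t e] s; split=> //=.
- by move=> r'; rewrite inE => /negbTE ->.
- by move=> t'; rewrite inE => /negbTE -> i.
- by move=> r; rewrite mem_cat negb_or => /andP[h1 h2]; rewrite (IH2 _).1 // (IH1 _).1.
- by move=> t; rewrite mem_cat negb_or => /andP[h1 h2] i; rewrite (IH2 _).2 // (IH1 _).2.
- by move=> r; rewrite mem_cat negb_or => /andP[h1 h2]; case: ifP; rewrite ?(IH2 _).1 ?(IH1 _).1.
- by move=> t; rewrite mem_cat negb_or => /andP[h1 h2] i; case: ifP; rewrite ?(IH2 _).2 ?(IH1 _).2.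
- move=> r; rewrite inE negb_or => /andP[h1 h2].
  by elim: (bound_val _ _) => [|n IHn] /=; rewrite (negbTE h1) // (IH _).1.
- by move=> t h j; elim: (bound_val _ _) => [|n IHn] //=; rewrite (IH _).2.
- by move=> r'; rewrite inE => /negbTE h; case: ifP; rewrite //= h.
- by move=> t' _ i; case: ifP.
Qed.

Lemma wf_reg1 p : wf p -> 1 \notin written_regs p.
Proof.
elim: p => //= [r e|p1 IH1 p2 IH2|e p1 IH1 p2 IH2|i b p IH|r t e].
- by rewrite inE eq_sym.
- by case/andP=> /IH1 h1 /IH2 h2; rewrite mem_cat negb_or h1.
- by case/andP=> /IH1 h1 /IH2 h2; rewrite mem_cat negb_or h1.
- by case/and3P=> h _ /IH; rewrite inE negb_or eq_sym h.
- by rewrite inE eq_sym.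
Qed.

Lemma den_reg1 p s : wf p -> reg (den p s) 1 = reg s 1.
Proof. by move/wf_reg1; apply: (den_frame p s).1. Qed.

Lemma frame_trans p s1 s2 s3 : frame p s1 s2 -> frame p s2 s3 -> frame p s1 s3.
Proof.
move=> [a b] [c d]; split=> [r h|t h i]; first by rewrite c // a.
by rewrite d // b.
Qed.

Lemma for_rule i b p s n (I : nat -> state -> Prop) :
  wf (PFor i b p) -> bound_val b (reg s 1) = n ->
  I 0 (set_reg s i 0) ->
  (forall j s', j < n -> reg s' i = j ->
     frame (PFor i b p) s s' -> I j s' -> I j.+1 (set_reg (den p s') i j.+1)) ->
  I n (den (PFor i b p) s).
Proof.
move=> /= /and3P[i1 ip wp] -> I0 step; set F := fun s1 => _.
suff : forall j, j <= n -> let s' := iter j F (set_reg s i 0) in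
    [/\ reg s' i = j, frame (PFor i b p) s s' & I j s'].
  by move=> /(_ n (leqnn _)) [].
elim=> [_|j IH jn] /=.
  split=> //=; first by rewrite eqxx.
  by split=> //= r; rewrite inE negb_or => /andP[/negbTE ->].
have [ri fr Ij] := IH (ltnW jn).
set s1 := iter j F _ in ri fr Ij *.
have E : reg (den p s1) i = j by rewrite (den_frame p s1).1.
rewrite /F /= E addn1; split.
- by rewrite eqxx.
- apply: frame_trans fr _; split=> /= [r|t h l]; last by rewrite (den_frame p s1).2.
  by rewrite inE negb_or => /andP[/negbTE -> h]; rewrite (den_frame p s1).1.
- exact: step.
Qed.

Lemma reg_den p s r : r \notin written_regs p -> reg (den p s) r = reg s r.
Proof. exact: (den_frame p s).1. Qed.

Lemma arr_den p s t : t \notin written_arrs p -> arr (den p s) t =1 arr s t.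
Proof. exact: (den_frame p s).2. Qed.

Lemma den_seq p1 p2 s : den (PSeq p1 p2) s = den p2 (den p1 s).
Proof. by []. Qed.

Lemma den_set r e s : den (PSet r e) s = set_reg s r (eval_expr s e).
Proof. by []. Qed.

Lemma den_put t e1 e2 s :
  den (PPut t e1 e2) s = set_arr s t (eval_expr s e1) (eval_expr s e2).
Proof. by []. Qed.

Lemma den_if e p1 p2 s :
  den (PIf e p1 p2) s = if eval_expr s e != 0 then den p1 s else den p2 s.
Proof. by []. Qed.

Lemma den_skip s : den PSkip s = s.
Proof. by []. Qed.

Lemma den_query r t e s m : reg s 1 = m -> eval_expr s e <= 12 * m ->
  den (PQuery r t e) s = set_reg s r (oracle (mkseq (arr s t) (eval_expr s e))).
Proof.
move=> sm le; have E : eval_expr s query_bound = 12 * m by rewrite /= sm; lia.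
rewrite -[LHS]/(if eval_expr s query_bound < eval_expr s e then s else _).
by rewrite E ltnNge le.
Qed.

Fixpoint cost (m F : nat) (p : prog) : nat :=
  match p with
  | PSkip => 1
  | PSet r e => (expr_cost e).+1
  | PPut t e1 e2 => (expr_cost e1 + expr_cost e2).+1
  | PSeq p1 p2 => cost m F p1 + cost m F p2
  | PIf e p1 p2 => (expr_cost e + (cost m F p1 + cost m F p2)).+1
  | PFor i b p1 => 8 + bound_val b m * (cost m F p1 + 10)
  | PQuery r t e => expr_cost (ELt query_bound e) + expr_cost e + F + 2
  end.

Lemma eval_bound s b : eval_expr s (bound_expr b) = bound_val b (reg s 1).
Proof. by case: b. Qed.

Lemma exec_compile p s m : wf p -> reg s 1 = m ->
  exists2 t, exec oracle phi (compile p) s t (den p s) & t <= cost m (phi (12 * m)) p.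
Proof.
elim: p s => [|r e|t e1 e2|p1 IH1 p2 IH2|e p1 IH1 p2 IH2|i b p IH|r t e] s.
- by move=> *; exists 1 => //; apply: ExecSkip.
- by move=> *; exists (expr_cost e).+1 => //; apply: ExecSet.
- by move=> *; exists (expr_cost e1 + expr_cost e2).+1 => //; apply: ExecPut.
- move=> /= /andP[w1 w2] sm.
  have [t1 e1 l1] := IH1 s w1 sm.
  have [t2 e2 l2] := IH2 (den p1 s) w2 (etrans (den_reg1 s w1) sm).
  by exists (t1 + t2); [apply: ExecSeq e1 e2 | lia].
- move=> /= /andP[w1 w2] sm; case: ifP => h.
    have [t1 e1 l1] := IH1 s w1 sm.
    by exists (expr_cost e + t1).+1; [apply: ExecIfTrue | lia].
  have [t2 e2 l2] := IH2 s w2 sm.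
  by exists (expr_cost e + t2).+1; [apply: ExecIfFalse => //; apply/eqP/negbFE | lia].
- move=> w sm; have := w; rewrite /= => /and3P[i1 ip wp].
  pose F s1 := let s2 := den p s1 in set_reg s2 i (reg s2 i + 1).
  pose n := bound_val b (reg s 1); pose c := cost m (phi (12 * m)) p.
  pose W := CWhile (ELt (EReg i) (bound_expr b))
    (CSeq (compile p) (CSet i (EAdd (EReg i) (ECst 1)))).
  have loop k s1 : reg s1 1 = m -> reg s1 i + k = n ->
      exists2 t, exec oracle phi W s1 t (iter k F s1) & t <= 6 + k * (c + 10).
    have ec : expr_cost (ELt (EReg i) (bound_expr b)) <= 5 by case: (b).
    elim: k s1 => [|k IHk] s1 s1m s1i.
      exists (expr_cost (ELt (EReg i) (bound_expr b))).+1; last by lia.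
      apply: ExecWhileFalse; rewrite /= eval_bound s1m -sm -/n -s1i addn0 ltnn //.
    have [t1 e1 l1] := IH s1 wp s1m.
    have Ei : reg (den p s1) i = reg s1 i by rewrite (den_frame p s1).1.
    have [||t2 e2 l2] := IHk (F s1).
    + by rewrite /= eq_sym (negbTE i1) den_reg1.
    + by rewrite /= eqxx Ei; lia.
    exists (expr_cost (ELt (EReg i) (bound_expr b)) + (t1 + 4) + t2).+1; last first.
      by rewrite mulSn; rewrite -/c in l1; lia.
    rewrite iterSr; apply: ExecWhileTrue e2.
      by rewrite /= eval_bound s1m -sm -/n -s1i; lia.
    by apply: ExecSeq e1 _; apply: ExecSet.
  have [||t e l] := loop n (set_reg s i 0).
  + by rewrite /= eq_sym (negbTE i1).
  + by rewrite /= eqxx.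
  exists (2 + t); first by apply: ExecSeq e; apply: ExecSet.
  by rewrite /= -/c; rewrite /n sm in l; lia.
- move=> _ sm.
  have E : eval_expr s query_bound = 12 * m by rewrite /= sm; lia.
  have dE : den (PQuery r t e) s = if 12 * m < eval_expr s e then s
      else set_reg s r (oracle (mkseq (arr s t) (eval_expr s e))) by rewrite -E.
  have tE : eval_expr s (ELt query_bound e) = (12 * m < eval_expr s e) by rewrite -E.
  rewrite dE; case: ltnP tE => h tE.
    exists (expr_cost (ELt query_bound e) + 1).+1; last by rewrite /=; lia.
    by apply: ExecIfTrue; [rewrite tE | apply: ExecSkip].
  exists (expr_cost (ELt query_bound e) + (expr_cost e + phi (eval_expr s e)).+1).+1; last first.
    by have := phi_mono h; rewrite /=; lia.
  by apply: ExecIfFalse; last exact: ExecQuery.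
Qed.

Fixpoint deg (p : prog) : nat :=
  match p with
  | PSkip | PSet _ _ | PPut _ _ _ => 0
  | PSeq p1 p2 | PIf _ p1 p2 => maxn (deg p1) (deg p2)
  | PFor _ _ p1 => (deg p1).+1
  | PQuery _ _ _ => 1
  end.

Fixpoint coef (p : prog) : nat :=
  match p with
  | PSkip => 1
  | PSet r e => (expr_cost e).+1
  | PPut t e1 e2 => (expr_cost e1 + expr_cost e2).+1
  | PSeq p1 p2 => coef p1 + coef p2
  | PIf e p1 p2 => (expr_cost e + (coef p1 + coef p2)).+1
  | PFor i b p1 => 8 + 2 * (coef p1 + 10)
  | PQuery r t e => expr_cost (ELt query_bound e) + expr_cost e + 2
  end.

(* The innermost loop, or the query, is charged [M] and every further loop [N]. *)
Definition cost_power (N M d : nat) : nat := if d is d'.+1 then N ^ d' * M else 1.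

Lemma cost_le m F p : m <= F ->
  cost m F p <= coef p * cost_power m.+1 F.+1 (deg p).
Proof.
move=> mF; set P := cost_power m.+1 F.+1.
(* For [d = 0] this is [m <= F]: an innermost scan costs no more than a query. *)
have step d : m.+1 * P d <= P d.+1.
  by case: d => [|d] /=; rewrite ?muln1 ?mul1n ?expnS ?mulnA.
have mono d1 d2 : d1 <= d2 -> P d1 <= P d2.
  move=> h; rewrite -(subnKC h); elim: (d2 - d1) => [|k IH]; rewrite ?addn0 // addnS.
  by apply: leq_trans IH _; apply: leq_trans (step _); rewrite leq_pmull.
have pos d : 0 < P d by apply: (leq_trans _ (mono 0 d _)).
elim: p => [|r e|t e1 e2|p1 IH1 p2 IH2|e p1 IH1 p2 IH2|i b p IH|r t e]; rewrite /= ?muln1 //.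
- have h1 := mono _ _ (leq_maxl (deg p1) (deg p2)).
  have h2 := mono _ _ (leq_maxr (deg p1) (deg p2)).
  rewrite mulnDl leq_add //; [apply: leq_trans IH1 _|apply: leq_trans IH2 _];
  by rewrite leq_mul2l ?h1 ?h2 orbT.
- have h1 := mono _ _ (leq_maxl (deg p1) (deg p2)).
  have h2 := mono _ _ (leq_maxr (deg p1) (deg p2)).
  have x0 := pos (maxn (deg p1) (deg p2)); set x := P (maxn _ _) in h1 h2 x0 *.
  have {}IH1 : cost m F p1 <= coef p1 * x by apply: leq_trans IH1 _; rewrite leq_mul2l h1 orbT.
  have {}IH2 : cost m F p2 <= coef p2 * x by apply: leq_trans IH2 _; rewrite leq_mul2l h2 orbT.
  by nia.
- have b2 : bound_val b m <= 2 * m.+1 by case: b; rewrite /=; lia.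
  have hs := step (deg p); have x0 := pos (deg p); rewrite -[_ ^ _ * _]/(P (deg p).+1).
  set x := P (deg p) in hs x0 IH; set z := P _ in hs *.
  have h1 : bound_val b m * (cost m F p + 10) <= 2 * m.+1 * ((coef p + 10) * x).
    by apply: leq_mul => //; nia.
  have h2 : 2 * m.+1 * ((coef p + 10) * x) <= 2 * (coef p + 10) * z by nia.
  by nia.
- by rewrite expn0 mul1n; nia.
Qed.

End Programs.

Arguments den : simpl never.

Definition denE := (den_seq, den_set, den_put, den_if, den_skip).

(** * Completing a trail *)

Section Completions.
Variable G : graph.
Local Notation m := (nedges G).
Implicit Types (a b c p v x : vertex G) (z y f : arc_of G) (s S T P O : seq (arc_of G)).

Lemma arc_code_lt z : arc_code z < m + m.
Proof. by case: z => e []; rewrite /arc_code /=; have := ltn_ord e; lia. Qed.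

Lemma arc_code_inj : injective (@arc_code G).
Proof.
move=> [e o] [e' o']; rewrite /arc_code /=; have := ltn_ord e; have := ltn_ord e'.
by case: o; case: o' => h1 h2 h; first [congr (_, _); apply: val_inj => /=; lia | lia].
Qed.

Lemma arc_code_onto (i : nat) : i < m + m -> exists z, arc_code z = i.
Proof.
move=> h; have [lt|ge] := ltnP i m; first by exists (Ordinal lt, false).
have lt : i - m < m by lia.
by exists (Ordinal lt, true); rewrite /arc_code /=; lia.
Qed.

Lemma size_uniq_edges s : uniq (edges_of s) -> size s <= m.
Proof. by move/card_uniqP; rewrite size_map => <-; rewrite -[X in _ <= X]card_ord max_card. Qed.

Lemma full_edges s e : uniq (edges_of s) -> size s = m -> e \in edges_of s.
Proof.
move=> u sz; have /card_uniqP E := u.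
have /subset_cardP H : #|edges_of s| = #|'I_m| by rewrite card_ord E size_map.
by have /H -> : edges_of s \subset 'I_m by apply/subsetP.
Qed.

Lemma full_edges_size s : uniq (edges_of s) -> (forall e, e \in edges_of s) -> size s = m.
Proof.
move=> u h; rewrite -(size_map (@arc_edge G)) -[RHS]card_ord -(card_uniqP u).
by apply: eq_card => e; rewrite h.
Qed.

Lemma full_perm s s' : uniq (edges_of s) -> uniq (edges_of s') -> size s = m -> size s' = m ->
  perm_eq (edges_of s) (edges_of s').
Proof.
by move=> u u' z z'; apply: uniq_perm => // e; rewrite !full_edges.
Qed.

(** [P] enters only through its edges. With [P] empty these are the Eulerian trails; otherwise they
    are the possible continuations of a prefix that ends at [x]. *)
Definition completes P x b T : Prop :=
  [/\ walk x b T, uniq (edges_of (P ++ T)) & size P + size T = m].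

Lemma completes_perm P x b T T' : completes P x b T -> completes P x b T' ->
  perm_eq (edges_of T) (edges_of T').
Proof.
move=> [_ u z] [_ u' z'].
have := full_perm u u'; rewrite !size_cat => /(_ z z').
by rewrite !edges_of_cat perm_cat2l.
Qed.

Lemma perm_completes P x b T T' : completes P x b T -> walk x b T' ->
  perm_eq (edges_of T) (edges_of T') -> completes P x b T'.
Proof.
move=> [_ u z] w pe; split=> //; last first.
  by rewrite -(size_map (@arc_edge G) T') -(perm_size pe) size_map.
suff /perm_uniq <- : perm_eq (edges_of (P ++ T)) (edges_of (P ++ T')) by [].
by rewrite !edges_of_cat perm_cat2l.
Qed.

Lemma completes_cons P x b f T : completes P x b (f :: T) <->
  arc_tail f = x /\ completes (rcons P f) (arc_head f) b T.
Proof.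
rewrite /completes cat_rcons size_rcons /= addnS addSn.
by split=> [[/andP[/eqP ? ?] ? ?]|[-> [? ? ?]]]; rewrite ?eqxx.
Qed.

Definition incidence v (es : seq (edge G)) : nat :=
  \sum_(e <- es) ((src e == v) + (tgt e == v)).

Lemma walk_incidence a b v s : walk a b s ->
  odd (incidence v (edges_of s)) = (a == v) (+) (b == v).
Proof.
elim: s a => [|[e o] s IH] a /=.
  by move=> /eqP ->; rewrite /incidence big_nil addbb.
case/andP=> /eqP <- /IH E; rewrite /incidence big_cons oddD -/(incidence v _) E.
by case: o E => E; rewrite /arc_tail /arc_head /= oddD !oddb;
  case: (src e == v); case: (tgt e == v); case: (b == v).
Qed.

Definition saturated (es : seq (edge G)) v : Prop :=
  forall z, arc_tail z = v -> arc_edge z \in es.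

Lemma saturated_incidence v es fs : uniq es -> uniq fs -> (forall e, e \in fs) ->
  saturated es v -> incidence v es = incidence v fs.
Proof.
move=> ue uf all sat; rewrite /incidence !big_uniq //=.
rewrite [RHS](eq_bigl predT) => [|e]; last by rewrite all.
rewrite [RHS](bigID (mem es)) /= [X in _ + X]big1 ?addn0 // => e ne.
case: eqP => [E|_]; first by have := sat (e, false) E; rewrite /arc_edge /= (negbTE ne).
by case: eqP => [E|//]; have := sat (e, true) E; rewrite /arc_edge /= (negbTE ne).
Qed.

(** At the saturated vertex [c], [S] and [O] together have the same degree as [T]. When parities are
    compared, the ends [x] and [b] cancel and only [c] and [p] remain. *)
Lemma stuck_vertex P S O T x c p b : uniq (edges_of (P ++ S ++ O)) -> completes P x b T ->
  walk x c S -> walk p b O -> saturated (edges_of (P ++ S ++ O)) c -> c = p.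
Proof.
move=> u [wT uT sT] wS wO sat.
have full e : e \in edges_of (P ++ T) by apply: full_edges; rewrite ?size_cat.
have := saturated_incidence u uT full sat.
rewrite !edges_of_cat /incidence !big_cat /= => /addnI /(congr1 odd).
rewrite oddD -!/(incidence _ _) (walk_incidence _ wS) (walk_incidence _ wO) (walk_incidence _ wT).
by rewrite eqxx; case: (x == c); case: (b == c); case: eqP => // ->.
Qed.

(** A completion [T] starts at [x]. From a saturated vertex its next edge must lie in [O], and it
    leads to a saturated vertex again. So [T] never leaves [O], and [O] is at least as long. *)
Lemma saturated_walk_full P O T x p b : uniq (edges_of (P ++ O)) -> completes P x b T ->
  saturated (edges_of (P ++ O)) x ->
  (forall y, y \in O -> saturated (edges_of (P ++ O)) (arc_head y)) ->
  walk p b O -> p = x -> size P + size O = m.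
Proof.
move=> u [wT uT sT] satx satO wO px; subst p.
(* [T] may use an edge of [O] backwards; it then arrives at the tail of an arc of [O], which is [x]
   or the head of the preceding arc. *)
have sat1 z : arc_edge z \in edges_of O -> saturated (edges_of (P ++ O)) (arc_tail z) ->
    saturated (edges_of (P ++ O)) (arc_head z).
  case/mapP=> y yO E st; case: (same_edge E) => ->; first exact: satO.
  rewrite arc_head_inv; have [s1 [s2 eO]] : exists s1 s2, O = s1 ++ y :: s2.
    by case/splitPr: yO => s1 s2; exists s1, s2.
  case: (lastP s1) eO => [|s1' y'] eO.
    by have : walk x b ([::] ++ y :: s2); [rewrite -eO | case/andP=> /eqP ->].
  have : walk x b (rcons s1' y' ++ y :: s2) by rewrite -eO.
  rewrite cat_rcons walk_cat /= => /and3P[_ _ /andP[/eqP -> _]].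
  by apply: satO; rewrite eO mem_cat mem_rcons inE eqxx.
have sub c T0 : walk c b T0 -> saturated (edges_of (P ++ O)) c ->
    uniq (edges_of (P ++ T0)) -> {subset edges_of T0 <= edges_of O}.
  elim: T0 c => [|z T0 IH] c //= /andP[/eqP tz w] sat.
  rewrite edges_of_cat cat_uniq /= negb_or -andbA => /and5P[uP nP1 nP2 zn uT0].
  have zO : arc_edge z \in edges_of O.
    by have := sat z tz; rewrite edges_of_cat mem_cat (negbTE nP1).
  move=> e; rewrite inE => /orP[/eqP -> //|he]; move: e he; apply: IH w _ _.
    by apply: sat1; rewrite ?tz.
  by rewrite edges_of_cat cat_uniq uP nP2.
apply/eqP; rewrite eqn_leq -{1}size_cat size_uniq_edges //= -sT leq_add2l.
have := uniq_leq_size _ (sub _ _ wT satx uT); rewrite !size_map; apply.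
by move: uT; rewrite edges_of_cat cat_uniq => /and3P[].
Qed.

Fixpoint stored (mem : nat -> nat) (i : nat) s : Prop :=
  if s is z :: s' then mem i = arc_code z /\ stored mem i.+1 s' else True.

Lemma stored_cat mem i s1 s2 :
  stored mem i (s1 ++ s2) <-> stored mem i s1 /\ stored mem (i + size s1) s2.
Proof.
elim: s1 i => [|z s IH] i /=; first by rewrite addn0; split=> [|[]].
by rewrite addnS -addSn; split=> [[-> /IH[? ?]]|[[-> ?] ?]]; split=> //; apply/IH.
Qed.

Lemma stored_ext mem mem' i s : (forall j, i <= j < i + size s -> mem' j = mem j) ->
  stored mem i s -> stored mem' i s.
Proof.
elim: s i => [|z s IH] i //= h [e st]; split; first by rewrite h //; lia.
by apply: IH st => j hj; apply: h; lia.
Qed.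

Lemma split_at s j : j < size s ->
  exists s1 z s2, s = s1 ++ z :: s2 /\ size s1 = j.
Proof.
elim: s j => [|z s IH] [|j] //= h; first by exists [::], z, s.
by have [s1 [y [s2 [-> <-]]]] := IH j h; exists (z :: s1), y, s2.
Qed.

Lemma stored_at mem i s j : stored mem i s -> j < size s ->
  exists s1 z s2, [/\ s = s1 ++ z :: s2, size s1 = j & mem (i + j) = arc_code z].
Proof.
move=> st /split_at[s1 [z [s2 [E <-]]]]; exists s1, z, s2; split=> //.
by move: st; rewrite E stored_cat => -[_ []].
Qed.

Lemma stored_mkseq mem s : stored mem 0 s -> size s = m -> mkseq mem m = [seq arc_code z | z <- s].
Proof.
move=> st <-; rewrite /mkseq; elim: s 0 st => [|z s IH] i //= [-> st].
by rewrite IH.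
Qed.

End Completions.

(** * The programs *)

(* Input registers: 1, 2 and 3 hold [m], [a] and [b].
   Parameters of the procedures: a start position in register 10, a start vertex in
   register 11.  Arrays 10 to 14 tabulate, by arc code, the head, the tail, the label, the
   inverse arc and the edge of an arc; array 15 holds the current trail, array 16 the best
   trail of the search, array 17 the used edges, array 18 a stack, array 19 the vertices
   visited by the trail, array 20 a representative time for each time, array 21 the last
   visit of each vertex, array 22 the class of each time and array 23 a query. *)
Section ProgramText.

Local Notation "e1 =e e2" := (EEq e1 e2) (at level 70).
Local Notation "e1 <e e2" := (ELt e1 e2) (at level 70).
Local Notation "e1 +e e2" := (EAdd e1 e2) (at level 50).
Local Notation "e1 -e e2" := (ESub e1 e2) (at level 50).
Local Notation "t .[ e ]" := (EGet t e).
Local Notation "$ r" := (EReg r) (at level 1, format "$ r").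
Local Notation "p1 ;; p2" := (PSeq p1 p2) (at level 90, right associativity).
Local Notation one := (ECst 1).
Local Notation zero := (ECst 0).

Definition tabulate_arcs : prog :=
  PFor 50 B2M
    (PSet 51 1.[$50] ;;
     PPut 10 $51 2.[$50] ;;
     PPut 12 $51 3.[$50] ;;
     PIf ($51 <e $1)
       (PPut 13 $51 ($51 +e $1) ;; PPut 14 $51 $51)
       (PPut 13 $51 ($51 -e $1) ;; PPut 14 $51 ($51 -e $1))).

(** Entries store heads, and a tail is the head of the inverse arc. A second pass is needed because
    the inverse arc may come later in the lists. *)
Definition tabulate_tails : prog := PFor 50 B2M (PPut 11 $50 10.[13.[$50]]).

Definition init_prog : prog := tabulate_arcs ;; tabulate_tails.

Definition mark_used : prog :=
  PFor 17 BM (PPut 17 $17 zero) ;;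
  PFor 17 BM (PIf ($17 <e $10) (PPut 17 14.[15.[$17]] one) PSkip).

Definition find_arc : prog :=
  PSet 15 zero ;;
  PFor 18 B2M
    (PIf (11.[$18] =e $12)
       (PIf 17.[14.[$18]] PSkip (PSet 15 one ;; PSet 16 $18)) PSkip).

Definition hierholzer_push : prog :=
  PPut 17 14.[$16] one ;; PPut 18 $13 $16 ;; PSet 13 ($13 +e one) ;; PSet 12 10.[$16].

(** The output fills array 15 from its end towards the front, so a completion comes to lie
    immediately behind the prefix. *)
Definition hierholzer_pop : prog :=
  PSet 13 ($13 -e one) ;; PSet 16 18.[$13] ;; PSet 14 ($14 -e one) ;;
  PPut 15 $14 $16 ;; PSet 12 11.[$16].

Definition hierholzer_step : prog :=
  find_arc ;; PIf $15 hierholzer_push (PIf $13 hierholzer_pop PSkip).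

Definition check_arc : prog :=
  PIf ($17 <e $10) PSkip
    (PIf (11.[15.[$17]] =e $12) PSkip (PSet 19 zero) ;; PSet 12 10.[15.[$17]]).

(** The prefix may have no completion. Instead of testing degrees and connectivity beforehand, the
    output is checked afterwards. *)
Definition check_trail : prog :=
  PSet 19 ($14 =e $10) ;; PSet 12 $11 ;; PFor 17 BM check_arc ;;
  PIf ($12 =e $3) PSkip (PSet 19 zero).

Definition euler_prog : prog :=
  mark_used ;; PSet 12 $11 ;; PSet 13 zero ;; PSet 14 $1 ;;
  PFor 17 B2M hierholzer_step ;; check_trail.

Definition append_prefix (t : nat) : prog :=
  PFor 32 BM
    (PIf ($32 <e $10) PSkip
       (PIf ($32 <e $31) (PPut 23 $30 12.[t.[$32]] ;; PSet 30 ($30 +e one)) PSkip)).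

Definition append_inverse (t : nat) : prog :=
  PFor 32 BM
    (PSet 33 ($1 -e one -e $32) ;;
     PIf ($33 <e $10) PSkip
       (PIf ($33 <e $31) (PPut 23 $30 12.[13.[t.[$33]]] ;; PSet 30 ($30 +e one)) PSkip)).

Definition set_visit : prog :=
  PIf ($20 =e $10) (PPut 19 $20 $11) (PPut 19 $20 10.[15.[$20 -e one]]).

Definition record_visits : prog :=
  PFor 20 BM1 (PIf ($20 <e $10) PSkip (set_visit ;; PPut 21 19.[$20] $20)).

Definition set_representatives : prog :=
  PFor 20 BM1 (PPut 20 $20 21.[19.[$20]] ;; PPut 22 $20 21.[19.[$20]]).

Definition visits_prog : prog := record_visits ;; set_representatives.

(** The parity of [cross] computed on 0/1 values: equality is the negation of xor. *)
Definition not_crossing (r1 r2 : nat) : expr :=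
  ((20.[$r1] <e 20.[$r2]) =e ($r1 <e 20.[$r2])) =e ((20.[$r1] <e $r2) =e ($r1 <e $r2)).

(** Relabelling a class by a full scan is affordable, since the scan is charged like one query. *)
Definition merge_prog : prog :=
  PSet 23 22.[$20] ;; PSet 24 22.[$21] ;;
  PFor 22 BM1 (PIf (22.[$22] =e $23) (PPut 22 $22 $24) PSkip).

Definition classes_prog : prog :=
  PFor 20 BM1 (PFor 21 BM1
    (PIf ($20 <e $10) PSkip (PIf ($21 <e $10) PSkip
      (PIf (19.[$20] =e 19.[$21]) PSkip (PIf (not_crossing 20 21) PSkip merge_prog))))).

(** A prefix followed by an inverse prefix: the word evaluates to [gdiff] from the representative
    time to the time in [r]. *)
Definition append_chord (r : nat) : prog :=
  PSet 31 $r ;; append_prefix 15 ;; PSet 31 20.[$r] ;; append_inverse 15.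

Definition query_chords : prog :=
  PSet 30 zero ;;
  append_chord 20 ;; append_chord 21 ;; append_chord 20 ;; append_chord 21 ;;
  PQuery 34 23 $30 ;; PIf $34 PSkip (PSet 25 zero).

Definition test_prog : prog :=
  PSet 25 one ;;
  PFor 20 BM1 (PFor 21 BM1
    (PIf ($20 <e $10) PSkip (PIf ($21 <e $10) PSkip
      (PIf (22.[$20] =e 22.[$21]) query_chords PSkip)))).

Definition good_prog : prog := visits_prog ;; classes_prog ;; test_prog.

Definition start_prog : prog := init_prog ;; PSet 10 zero ;; PSet 11 $2 ;; euler_prog.

Definition decide_prog : prog :=
  start_prog ;; PIf $19 (good_prog ;; PSet 0 $25) (PSet 0 one).

Definition copy_prog (t t' : nat) : prog := PFor 45 BM (PPut t' $45 t.[$45]).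

Definition edge_used : prog :=
  PSet 44 zero ;;
  PFor 45 BM (PIf ($45 <e $40) (PIf (14.[16.[$45]] =e 14.[$41]) (PSet 44 one) PSkip) PSkip).

Definition extend_prog : prog :=
  PFor 45 BM (PIf ($45 <e $40) (PPut 15 $45 16.[$45]) PSkip) ;;
  PPut 15 $40 $41 ;; PSet 10 ($40 +e one) ;; PSet 11 10.[$41] ;; euler_prog.

Definition compare_prog : prog :=
  PSet 10 zero ;; PSet 30 zero ;; PSet 31 $1 ;; append_prefix 16 ;; append_inverse 15 ;;
  PQuery 34 23 $30.

Definition advance_prog : prog := copy_prog 15 16 ;; PSet 43 one.

Definition accept_prog : prog :=
  PSet 10 ($40 +e one) ;; PSet 11 10.[$41] ;; good_prog ;; PIf $25 PSkip advance_prog.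

Definition output_prog : prog := copy_prog 16 0 ;; copy_prog 15 1 ;; PSet 42 one.

Definition try_arc : prog :=
  extend_prog ;; PIf $19 (compare_prog ;; PIf $34 accept_prog output_prog) PSkip.

Definition search_step : prog :=
  PIf $42 PSkip (PIf $43 PSkip
    (PIf (11.[$41] =e 11.[16.[$40]]) (edge_used ;; PIf $44 PSkip try_arc) PSkip)).

Definition search_round : prog := PSet 43 zero ;; PFor 41 B2M search_step.

Definition search_prog : prog :=
  start_prog ;; copy_prog 15 16 ;; PSet 42 zero ;; PFor 40 BM search_round.

End ProgramText.

Lemma wf_decide : wf decide_prog. Proof. by []. Qed.
Lemma wf_search : wf search_prog. Proof. by []. Qed.
Lemma deg_decide : deg decide_prog = 3. Proof. by []. Qed.
Lemma deg_search : deg search_prog = 5. Proof. by []. Qed.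

Section Specs.
Variables (Gamma : groupType) (k : nat) (gen : 'I_k -> Gamma) (oracle : seq nat -> bool).
Variables (G : graph) (gamma : arc_of G -> Gamma) (lab : arc_of G -> word k).
Hypothesis oracleP : solves_word_problem gen oracle.
Hypothesis gammaV : group_labeling gamma.
Hypothesis labP : word_labeling gen gamma lab.
Hypothesis lab1 : forall x, size (lab x) = 1.

Local Notation m := (nedges G).
Local Notation den := (den oracle).
Implicit Types (z y f : arc_of G) (s : state) (P S O T : seq (arc_of G)).

Definition label_code z : nat := head 0 [seq letter_code l | l <- lab z].

Lemma oracle_label (zs : seq (arc_of G)) :
  oracle [seq label_code z | z <- zs] <-> trail_label gamma zs = 1%g.
Proof.
have -> : [seq label_code z | z <- zs] =
    [seq letter_code l | l <- flatten [seq lab z | z <- zs]].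
  rewrite map_flatten -map_comp; elim: zs => //= z zs ->.
  by rewrite /label_code /=; case: (lab z) (lab1 z) => [|l [|? ?]].
have -> : trail_label gamma zs = eval_word gen (flatten [seq lab z | z <- zs]).
  rewrite /trail_label /eval_word; elim: zs => [|z zs IH] /=; first by rewrite !big_nil.
  by rewrite big_cons big_cat IH /= -(labP z).1.
exact: oracleP.
Qed.

Definition tabulated s z : Prop :=
  [/\ arr s 10 (arc_code z) = arc_head z, arr s 12 (arc_code z) = label_code z,
      arr s 13 (arc_code z) = arc_code (arc_inv z) &
      arr s 14 (arc_code z) = arc_edge z].

Definition tables s : Prop :=
  [/\ reg s 1 = m, forall z, tabulated s z &
      forall z, arr s 11 (arc_code z) = arc_tail z].

Lemma tables_frame p s s' :
  frame p s s' -> 1 \notin written_regs p ->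
  all (fun t => t \notin written_arrs p) [:: 10; 11; 12; 13; 14] ->
  tables s -> tables s'.
Proof.
move=> [fr fa] h1 /and5P[h10 h11 h12 h13 /andP[h14 _]] [tm ta tt]; split.
- by rewrite fr.
- by move=> z; case: (ta z) => *; split; rewrite fa.
- by move=> z; rewrite fa.
Qed.

Lemma tables_den p s : 1 \notin written_regs p ->
  all (fun t => t \notin written_arrs p) [:: 10; 11; 12; 13; 14] ->
  tables s -> tables (den p s).
Proof. exact/tables_frame/den_frame. Qed.

(** * The input and its tables by arc code *)

Section Init.
Variables (adj : vertex G -> seq (arc_of G)) (a b : vertex G).
Hypothesis adjP : adjacency_lists adj.
Let entries := adjacency_entries adj.
Let s0 := input_state adj lab a b.

Lemma entries_count z : count_mem z entries = 1.
Proof.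
rewrite /entries /adjacency_entries count_flatten -map_comp.
transitivity (sumn [seq (arc_tail z == v : nat) | v <- enum 'I_(nverts G)]).
  congr sumn; apply: eq_map => v /=.
  by have [u E] := adjP v; rewrite count_uniq_mem // E.
rewrite sumn_count (eq_count (a2 := pred1 (arc_tail z))); last by move=> v /=; rewrite eq_sym.
by rewrite count_uniq_mem ?enum_uniq // mem_enum.
Qed.

Lemma entries_uniq : uniq entries.
Proof.
apply: count_mem_uniq => z; rewrite entries_count.
by rewrite -has_pred1 has_count entries_count.
Qed.

Lemma mem_entries z : z \in entries.
Proof. by rewrite -has_pred1 has_count entries_count. Qed.

Lemma size_entries : size entries = m + m.
Proof.
have /card_uniqP <- := entries_uniq.
rewrite (eq_card (B := {: 'I_m * bool})); last by move=> z; rewrite mem_entries.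
by rewrite card_prod card_ord card_bool muln2 addnn.
Qed.

Lemma input_entry z : let j := index z entries in
  [/\ arr s0 1 j = arc_code z, arr s0 2 j = arc_head z & arr s0 3 j = label_code z].
Proof.
have h : index z entries < size entries by rewrite index_mem mem_entries.
rewrite /s0 /input_state /= -/entries; split; rewrite ?(nth_map z) ?nth_index ?mem_entries //.
have -> : flatten [seq [seq letter_code l | l <- lab x] | x <- entries] =
    [seq label_code x | x <- entries].
  elim: entries => //= y ys ->; rewrite /label_code.
  by case: (lab y) (lab1 y) => [|l [|? ?]].
by rewrite (nth_map z) ?nth_index ?mem_entries.
Qed.

Lemma entry_at j : j < m + m -> exists z, index z entries = j.
Proof.
rewrite -size_entries => h; case E: entries h => [//|z0 zs]; rewrite -E => h.
by exists (nth z0 entries j); rewrite index_uniq // entries_uniq.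
Qed.

Lemma arc_code_inv z :
  arc_code (arc_inv z) = if arc_code z < m then arc_code z + m else arc_code z - m.
Proof.
case: z => e []; rewrite /arc_code /arc_inv /= -?(addnC e) ?ltn_ord //.
by rewrite ltnNge leq_addl addnK.
Qed.

Lemma arc_code_edge z :
  arc_edge z = (if arc_code z < m then arc_code z else arc_code z - m) :> nat.
Proof.
case: z => e []; rewrite /arc_code /= ?ltn_ord //.
by rewrite ltnNge leq_addr addKn.
Qed.

Lemma init_spec : tables (den init_prog s0).
Proof.
rewrite /init_prog den_seq; set p1 := tabulate_arcs; set p2 := tabulate_tails.
have T1 : forall z, index z entries < m + m -> tabulated (den p1 s0) z.
  pose I j s := forall z, index z entries < j -> tabulated s z.
  apply: (for_rule (I := I)) => // j s jm sj [fr fa] IH z zj.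
  have s1 : reg s 1 = m by rewrite fr.
  have [y yj] := entry_at jm; have := input_entry y; rewrite /= yj => -[i1 i2 i3].
  have c1 : arr s 1 j = arc_code y by rewrite fa.
  have c2 : arr s 2 j = arc_head y by rewrite fa.
  have c3 : arr s 3 j = label_code y by rewrite fa.
  rewrite !denE /= sj c1 s1.
  have [zy|zy] := eqVneq z y.
    subst z; rewrite /tabulated arc_code_inv arc_code_edge.
    by case: (arc_code y < m) => /=; rewrite !eqxx /= ?sj ?c1 ?c2 ?c3 ?s1.
  have ne : (arc_code z == arc_code y) = false.
    by apply/eqP => /arc_code_inj/eqP; rewrite (negbTE zy).
  have {}zj : index z entries < j.
    rewrite ltn_neqAle -ltnS zj andbT; apply: contraNneq zy => E.
    by rewrite -(nth_index z (mem_entries z)) E -yj nth_index ?mem_entries.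
  have [t1 t2 t3 t4] := IH z zj.
  by case: (arc_code y < m); split; rewrite /= ?sj ?c1 ne.
have {}T1 z : tabulated (den p1 s0) z by apply: T1; rewrite -size_entries index_mem mem_entries.
have m1 : reg (den p1 s0) 1 = m by rewrite reg_den.
have T2 : forall z, arc_code z < m + m -> arr (den p2 (den p1 s0)) 11 (arc_code z) = arc_tail z.
  pose I j s := forall z, arc_code z < j -> arr s 11 (arc_code z) = arc_tail z.
  apply: (for_rule (I := I)) => //; first by rewrite m1.
  move=> j s jm sj [fr fa] IH z; rewrite denE /= sj.
  case: eqVneq => [zj _|zj]; last by move=> h; apply: IH; lia.
  case: (T1 z) => _ _ t3 _; case: (T1 (arc_inv z)) => t1 _ _ _.
  by rewrite !fa // -zj t3 t1 arc_head_inv.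
split.
- by rewrite reg_den.
- by move=> z; have [t1 t2 t3 t4] := T1 z; split; rewrite arr_den.
- by move=> z; apply: T2; apply: arc_code_lt.
Qed.

End Init.

Lemma mark_used_spec s P q : tables s -> reg s 10 = q -> q <= m ->
  stored (arr s 15) 0 P -> size P = q ->
  forall e : edge G, arr (den mark_used s) 17 e = (e \in edges_of P).
Proof.
move=> ts sq qm st szP; have [sm ta _] := ts; rewrite /mark_used den_seq.
set s1 := den (PFor 17 BM (PPut 17 _ _)) s.
have z1 : forall i, i < m -> arr s1 17 i = 0.
  pose I j s := forall i, i < j -> arr s 17 i = 0.
  apply: (for_rule (I := I)) => //= j s' jm sj _ IH i ij; rewrite denE /= sj.
  by case: eqVneq => // ne; apply: IH; lia.
have m1 : reg s1 1 = m by rewrite reg_den.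
have q1 : reg s1 10 = q by rewrite reg_den.
have st1 : stored (arr s1 15) 0 P.
  by apply: stored_ext st => j _; rewrite arr_den.
have t1 : forall z, arr s1 14 (arc_code z) = arc_edge z.
  by move=> z; rewrite arr_den //; case: (ta z).
rewrite -(take_oversize (n := m) (s := P)) ?szP //.
pose I j s := forall e : edge G, arr s 17 e = (e \in edges_of (take j P)).
apply: (for_rule (I := I)) => //.
  by move=> e; rewrite take0 /= z1.
move=> j s' jm sj [fr fa] IH e; rewrite !denE /= sj fr // q1.
case: ltnP => jq /=; last first.
  by rewrite IH !take_oversize ?szP //; lia.
have [P1 [z [P2 [eP sP1 az]]]] := stored_at st1 (etrans (congr1 (leq _) szP) jq).
rewrite add0n in az; rewrite (fa 14) // (fa 15) // az t1 IH eP.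
have -> : take j.+1 (P1 ++ z :: P2) = rcons P1 z.
  by rewrite -cat_rcons take_size_cat // size_rcons sP1.
rewrite -sP1 take_size_cat // /edges_of map_rcons mem_rcons inE.
by case: (e =P arc_edge z) => [->|ne]; rewrite ?eqxx //; case: eqP => // /val_inj.
Qed.

Lemma find_arc_spec s (U : seq (edge G)) (c : vertex G) : tables s -> reg s 12 = c ->
  (forall e : edge G, arr s 17 e = (e \in U)) ->
  let s' := den find_arc s in
  (reg s' 15 = 0 /\ saturated U c) \/
  (reg s' 15 = 1 /\ exists z, [/\ reg s' 16 = arc_code z, arc_tail z = c & arc_edge z \notin U]).
Proof.
move=> [sm ta tt] sc su; rewrite /find_arc den_seq; set s1 := den (PSet 15 _) s.
pose I j s' := (reg s' 15 = 0 /\ forall z, arc_code z < j -> arc_tail z = c -> arc_edge z \in U) \/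
  (reg s' 15 = 1 /\ exists z, [/\ reg s' 16 = arc_code z, arc_tail z = c & arc_edge z \notin U]).
have : I (m + m) (den (PFor 18 B2M
    (PIf (EEq (EGet 11 (EReg 18)) (EReg 12))
       (PIf (EGet 17 (EGet 14 (EReg 18))) PSkip
          (PSeq (PSet 15 (ECst 1)) (PSet 16 (EReg 18)))) PSkip)) s1).
  apply: (for_rule (I := I)) => //=; first by rewrite sm.
    by left; split.
  move=> j s' jm sj [fr fa] IH; have [y yj] := arc_code_onto jm.
  have [_ _ _ y14] := ta y.
  rewrite !denE /= sj !fa // /s1 !denE /= fr //= -yj tt y14 sc su.
  have [ty|ty] := eqVneq (arc_tail y) c; last first.
    have -> : (nat_of_ord (arc_tail y) == c) = false.
      by apply/negbTE; apply: contraNneq ty => /val_inj ->.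
    case: IH => [[r0 h]|h]; [left|right] => //; split=> // z.
    rewrite ltnS leq_eqVlt => /orP[/eqP/arc_code_inj ->|lt]; last by apply: h; rewrite -yj.
    by move=> E; rewrite E eqxx in ty.
  rewrite ty eqxx /=; case: (boolP (arc_edge y \in U)) => yU /=.
    case: IH => [[r0 h]|h]; [left|right] => //; split=> // z.
    rewrite ltnS leq_eqVlt => /orP[/eqP/arc_code_inj ->|lt] //; by apply: h; rewrite -yj.
  by right; split=> //; exists y; rewrite /= ?sj.
case=> [[r0 h]|h]; [left|right] => //; split=> // z; apply: h; exact: arc_code_lt.
Qed.

(** * Hierholzer's algorithm behind a fixed prefix *)

Section Hierholzer.
Variables (P : seq (arc_of G)) (x b : vertex G).

Definition hierholzer_state s S O (c : vertex G) : Prop :=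
  [/\ reg s 12 = c, reg s 13 = size S & reg s 14 = m - size O] /\
  [/\ stored (arr s 18) 0 S, stored (arr s 15) (m - size O) O & stored (arr s 15) 0 P] /\
  [/\ uniq (edges_of (P ++ S ++ O)), walk x c S &
      forall e : edge G, arr s 17 e = (e \in edges_of (P ++ S ++ O))].

Definition hierholzer_inv (j : nat) s : Prop :=
  exists S O c, [/\ hierholzer_state s S O c,
    (exists T, completes P x b T) ->
      (exists p, walk p b O) /\
      forall y, y \in O -> saturated (edges_of (P ++ S ++ O)) (arc_head y) &
    j = 2 * size O + size S \/ S = [::] /\ saturated (edges_of (P ++ S ++ O)) x].

Lemma hierholzer_step_spec j s : tables s -> hierholzer_inv j s ->
  hierholzer_inv j.+1 (den hierholzer_step s).
Proof.
move=> ts [S [O [c [[[r12 r13 r14] [[st18 st15 stP] [u wS us]]] compl prog]]]].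
rewrite /hierholzer_step den_seq.
have := find_arc_spec ts r12 us; set s1 := den find_arc s => /= found.
have ts1 : tables s1 by apply: tables_den.
have r12' : reg s1 12 = c by rewrite reg_den.
have r13' : reg s1 13 = size S by rewrite reg_den.
have r14' : reg s1 14 = m - size O by rewrite reg_den.
have a15 : arr s1 15 =1 arr s 15 by apply: arr_den.
have a17 : arr s1 17 =1 arr s 17 by apply: arr_den.
have a18 : arr s1 18 =1 arr s 18 by apply: arr_den.
have := size_uniq_edges u; rewrite !size_cat => szm.
have [sm ta tt] := ts1.
rewrite den_if /=; case: found => [[-> sat]|[-> [z [r16 tz zU]]]] /=; last first.
  have [z10 _ _ z14] := ta z.
  have edgesE : edges_of (P ++ rcons S z ++ O) =
      (edges_of P ++ edges_of S) ++ [:: arc_edge z] ++ edges_of O.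
    by rewrite cat_rcons !edges_of_cat /= catA.
  have memE e : (e \in edges_of (P ++ rcons S z ++ O)) =
      (e == arc_edge z) || (e \in edges_of (P ++ S ++ O)).
    by rewrite edgesE !edges_of_cat !mem_cat !inE; do ![case: (_ \in _)]; rewrite ?orbT ?orbF.
  exists (rcons S z), O, (arc_head z); split.
  - split; last split.
    + by rewrite /hierholzer_push !denE /= r16 z10 r13' size_rcons addn1.
    + rewrite /hierholzer_push !denE /=; split.
      * rewrite -cats1 stored_cat; split=> /=; last by rewrite add0n r13' r16 eqxx.
        apply: stored_ext st18 => i; rewrite add0n r13' => /andP[_ h].
        by rewrite ltn_eqF // a18.
      * by apply: stored_ext st15 => i _; rewrite a15.
      * by apply: stored_ext stP => i _; rewrite a15.
    + split; last first.
      * move=> e; rewrite /hierholzer_push !denE /= r16 z14 memE.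
        case: (e =P arc_edge z) => [->|ne]; first by rewrite eqxx.
        by case: eqP => [/val_inj //|_]; rewrite a17 us.
      * by rewrite walk_rcons tz wS eqxx.
      * rewrite edgesE uniq_catCA /= mem_cat -catA -!edges_of_cat.
        move: zU; rewrite !edges_of_cat !mem_cat !negb_or -!edges_of_cat u andbT.
        by case/and3P=> -> -> ->.
  - case/compl=> wO satO; split=> // y yO w tw.
    by rewrite memE (satO y yO w tw) orbT.
  - left; case: prog => [->|[S0 satx]]; first by rewrite size_rcons addnS.
    have xc : x = c by move: wS; rewrite S0 => /eqP.
    by case/negP: zU; apply: satx; rewrite tz xc.
rewrite den_if /= r13'; case: (lastP S) => [|S0 z] in st18 u us wS compl prog r13 r13' sat szm *.
  rewrite /= den_skip; exists [::], O, c; split=> //.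
    split; [by split|split; [split|split]] => //.
    + by apply: stored_ext st15 => i _; rewrite a15.
    + by apply: stored_ext stP => i _; rewrite a15.
    + by move=> e; rewrite a17 us.
  by right; split=> //; move: wS => /eqP ->.
move: st18; rewrite -cats1 stored_cat => -[st18 [stz _]].
rewrite cats1 in wS u us compl prog sat szm r13 r13' *.
rewrite size_rcons in szm prog r13 r13' *.
have z18 : arr s1 18 (size S0) = arc_code z by rewrite a18 -stz.
have [z10 _ _ z14] := ta z; have z11 := tt z.
have catE : P ++ S0 ++ z :: O = P ++ rcons S0 z ++ O by rewrite cat_rcons.
have posE : m - size O - 1 = m - size (z :: O) by rewrite /=; lia.
have lt : m - size O = (m - size (z :: O)).+1 by rewrite /=; lia.
rewrite /= /hierholzer_pop !denE /= r13' subn1 /= z18 r14' posE z11.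
move: wS; rewrite walk_rcons => /andP[wS /eqP hz].
exists S0, (z :: O), (arc_tail z); split.
- split; last split; rewrite /= ?eqxx.
  + by split=> //; rewrite ?posE.
  + split.
    * by apply: stored_ext st18 => i _; rewrite a18.
    * split; first by rewrite ?posE ?eqxx.
      rewrite -lt; apply: stored_ext st15 => i /andP[h _].
      by rewrite ?posE gtn_eqF ?a15 // -lt.
    * apply: stored_ext stP => i; rewrite add0n => /andP[_ h].
      by rewrite ?posE ltn_eqF ?a15 //=; lia.
  + by rewrite catE; split=> // e; rewrite a17 us.
- rewrite catE => hT; have [[p wO] satO] := compl hT; have [T cT] := hT.
  split.
    exists (arc_tail z); rewrite /= eqxx hz.
    rewrite (@stuck_vertex _ P (rcons S0 z) O T x c p b) // walk_rcons wS hz eqxx //.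
  move=> y; rewrite inE => /orP[/eqP ->|/satO //]; by rewrite hz.
- left; case: prog => [->|[/eqP]]; last by rewrite -size_eq0 size_rcons.
  by rewrite /=; lia.
Qed.

End Hierholzer.

Definition trail_found P x b s : Prop :=
  (reg s 19 = 0 /\ forall T, ~ completes P x b T) \/
  (reg s 19 != 0 /\ exists2 O, completes P x b O & stored (arr s 15) (size P) O).

Lemma check_trail_spec s P (x b : vertex G) O : tables s -> reg s 10 = size P -> reg s 11 = x ->
  reg s 3 = b -> reg s 14 = m - size O -> size P + size O <= m ->
  stored (arr s 15) (m - size O) O ->
  reg (den check_trail s) 19 = (size P + size O == m) && walk x b O.
Proof.
move=> ts r10 r11 r3 r14 szm st; rewrite /check_trail !den_seq.
set s1 := den (PSet 12 _) _.
have [sm ta tt] := ts.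
(* The current vertex is tracked only when [P] and [O] fill the array; otherwise the answer is
   already negative. *)
pose I j s' :=
  (size P + size O = m -> reg s' 12 = endv x (take (j - size P) O)) /\
  reg s' 19 = (size P + size O == m) &&
    walk x (endv x (take (j - size P) O)) (take (j - size P) O).
have : I m (den (PFor 17 BM check_arc) s1).
  apply: (for_rule (I := I)) => //.
    rewrite /I /s1 !denE /= sub0n take0 /= eqxx andbT r11 r10 r14; split=> //.
    by congr nat_of_bool; apply/eqP/eqP; lia.
  move=> j s' jm sj [fr fa] [IH1 IH2]; rewrite /I /check_arc !denE /= sj fr // /s1 !denE /= r10.
  case: ltnP => jP /=.
    have -> : j.+1 - size P = j - size P by lia.
    by [].
  case: (altP (size P + size O =P m)) IH1 IH2 => [E|ne] IH1 IH2; last first.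
    split=> [E|]; first by rewrite E eqxx in ne.
    by rewrite /=; case: ifP => _ /=; rewrite ?IH2.
  have jO : j - size P < size O by lia.
  have [O1 [z [O2 [eO sO1 az]]]] := stored_at st jO.
  have az' : arr s' 15 j = arc_code z.
    by rewrite fa // /s1 !denE /= -az; congr arr; lia.
  have [z10 _ _ _] := ta z.
  have t1 : take (j - size P) O = O1 by rewrite eO -sO1 take_size_cat.
  have t2 : take (j.+1 - size P) O = rcons O1 z.
    by rewrite subSn // eO -cat_rcons take_size_cat // size_rcons sO1.
  rewrite t1 in IH1 IH2; have {}IH1 := IH1 E; rewrite t2 endv_rcons walk_rcons eqxx andbT.
  have A10 : arr s' 10 (arc_code z) = arc_head z by rewrite fa // /s1 !denE.
  have A11 : arr s' 11 (arc_code z) = arc_tail z by rewrite fa // /s1 !denE /= tt.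
  rewrite az' A11 IH1 /=.
  have [Ez|Ez] := eqVneq (arc_tail z) (endv x O1).
    by rewrite Ez eqxx /= ?sj ?az' ?A10 IH2.
  have -> : (nat_of_ord (arc_tail z) == endv x O1) = false.
    by apply/negbTE; apply: contraNneq Ez => /val_inj ->.
  rewrite /= ?sj ?az' ?A10; split=> //.
  by case: (boolP (walk x (arc_tail z) O1)) => // /walk_endv E'; rewrite E' eqxx in Ez.
set s2 := den (PFor _ _ _) s1 => -[R12 R19].
have R3 : reg s2 3 = b by rewrite reg_den // /s1 !denE.
have [E|ne] := altP (size P + size O =P m); last first.
  by rewrite den_if /= denE; rewrite (negbTE ne) /= in R19; case: ifP => //=.
have {}R12 := R12 E; rewrite E eqxx in R19.
have tk : take (m - size P) O = O by rewrite take_oversize //; lia.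
rewrite tk in R12 R19; rewrite !denE /= R12 R3.
have [Eb|Eb] := eqVneq (endv x O) b; first by rewrite Eb eqxx /= R19 Eb.
have -> : (nat_of_ord (endv x O) == b) = false.
  by apply/negbTE; apply: contraNneq Eb => /val_inj ->.
by rewrite /=; case: (boolP (walk x b O)) => // /walk_endv E'; rewrite E' eqxx in Eb.
Qed.

Lemma euler_spec s P (x b : vertex G) : tables s -> reg s 10 = size P -> reg s 11 = x ->
  reg s 3 = b -> stored (arr s 15) 0 P -> uniq (edges_of P) ->
  trail_found P x b (den euler_prog s) /\ stored (arr (den euler_prog s) 15) 0 P.
Proof.
move=> ts r10 r11 r3 st uP; have [sm _ _] := ts.
have Pm := size_uniq_edges uP.
pose s1 := den (PSet 14 (EReg 1)) (den (PSet 13 (ECst 0))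
  (den (PSet 12 (EReg 11)) (den mark_used s))).
rewrite -[den euler_prog s]/(den check_trail (den (PFor 17 B2M hierholzer_step) s1)).
have ts1 : tables s1 by do 4!(apply: tables_den => //).
have inv0 : hierholzer_inv P x b 0 (set_reg s1 17 0).
  exists [::], [::], x; split.
  - split; last split; rewrite /s1 !den_set /= ?subn0 ?cats0 ?reg_den //.
    + split=> //; apply: stored_ext st => i _; exact: arr_den.
    + by split=> //; apply: mark_used_spec r10 Pm st _.
  - by move=> _; split=> //; exists b; rewrite /=.
  - by left.
have : hierholzer_inv P x b (m + m) (den (PFor 17 B2M hierholzer_step) s1).
  apply: (for_rule (I := hierholzer_inv P x b)) => //.
    by have [-> _ _] := ts1.
  move=> j s' jm sj fr inv.
  have ts' : tables s' by apply: tables_frame fr _ _ ts1.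
  by have := hierholzer_step_spec ts' inv; rewrite /hierholzer_inv /hierholzer_state.
set s2 := den (PFor _ _ _) s1.
have ts2 : tables s2 by apply: tables_den.
case=> [S [O [c [[[r12 r13 r14] [[st18 st15 stP] [u wS us]]] compl prog]]]].
have szm : size P + (size S + size O) <= m by have := size_uniq_edges u; rewrite !size_cat.
(* After [m + m] steps the first alternative gives [2 * size O + size S = m + m], while
   [size S + size O <= m]. So the stack is empty and all edges are used. *)
have {prog} [S0 satx] : S = [::] /\ saturated (edges_of (P ++ S ++ O)) x.
  case: prog => // prog; split; first by apply: size0nil; lia.
  by move=> z _; apply: full_edges => //; rewrite !size_cat; lia.
subst S; move: wS => /eqP xc; subst c; rewrite cat0s in u us satx compl.
rewrite /= add0n in szm.
have R : reg (den check_trail s2) 19 = (size P + size O == m) && walk x b O.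
  apply: check_trail_spec => //; rewrite reg_den // /s1 !den_set /= reg_den //.
split; last by apply: stored_ext stP => i _; rewrite arr_den.
rewrite /trail_found R; case: (boolP (_ && _)) => [/andP[/eqP E w]|nw]; [right|left]; split=> //.
  exists O => //; apply: (stored_ext (mem := arr s2 15)) => [i _|]; first by rewrite arr_den.
  by have <- : m - size O = size P by lia.
move=> T cT; have [|[p wO] satO] := compl; first by exists T.
have px : x = p by apply: (@stuck_vertex _ P [::] O T x x p b); rewrite //= ?eqxx.
subst p; case/negP: nw; rewrite wO andbT.
by rewrite (saturated_walk_full u cT satx satO wO).
Qed.

Definition holds_word s (w : seq nat) : Prop :=
  reg s 30 = size w /\ forall i, i < size w -> arr s 23 i = nth 0 w i.

Lemma holds_word_mkseq s w : holds_word s w -> mkseq (arr s 23) (reg s 30) = w.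
Proof.
move=> [-> h]; apply: (@eq_from_nth _ 0); rewrite size_mkseq // => i iw.
by rewrite nth_mkseq // h.
Qed.

Lemma holds_word_rcons s w (v : nat) r (u : nat) : holds_word s w -> r != 30 ->
  holds_word (set_reg (set_reg (set_arr s 23 (reg s 30) v) 30 (reg s 30 + 1)) r u) (rcons w v).
Proof.
move=> [r30 h] ne; split; rewrite size_rcons /=.
  by rewrite eq_sym (negbTE ne) r30 addn1.
move=> i; rewrite ltnS leq_eqVlt nth_rcons r30 => /orP[/eqP ->|lt].
  by rewrite eqxx ltnn.
by rewrite (ltn_eqF lt) lt h.
Qed.

(** * Writing query words *)

Section Append.
Variables (t q en : nat) (O : seq (arc_of G)).
Hypotheses (t23 : t != 23) (qO : q + size O = m).
Let prefix := take (en - q) O.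

Lemma append_prefix_spec s w : tables s -> reg s 10 = q -> reg s 31 = en ->
  stored (arr s t) q O -> holds_word s w ->
  holds_word (den (append_prefix t) s) (w ++ [seq label_code z | z <- prefix]).
Proof.
move=> [sm ta _] r10 r31 st hw.
have szp : size prefix <= size O by rewrite size_take; case: ifP => //; lia.
pose I j s' := holds_word s' (w ++ [seq label_code z | z <- take (j - q) prefix]).
have : I m (den (append_prefix t) s); last by rewrite /I take_oversize //; lia.
apply: (for_rule (I := I)) => //; first by rewrite /I sub0n take0 /= cats0; case: hw.
move=> j s' jm sj [fr fa] IH; rewrite /I !denE /= sj !(fr 10, fr 31) // r10 r31.
case: ltnP => jq /=.
  by have -> : j.+1 - q = j - q by lia.
case: ltnP => jen /=; last first.
  have sz : size prefix <= j - q by rewrite size_take; case: ifP; lia.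
  by rewrite take_oversize ?(leq_trans sz) // ?leq_sub2r // -[prefix](take_oversize sz).
have jO : j - q < size O by lia.
have [O1 [z [O2 [eO sO1 az]]]] := stored_at st jO.
have pE : take (j.+1 - q) prefix = rcons (take (j - q) prefix) z.
  rewrite /prefix !take_takel ?leq_sub2r //; last exact: ltnW.
  rewrite eO subSn // -{1}sO1 -cat_rcons take_size_cat ?size_rcons ?sO1 //.
  by rewrite cat_rcons -sO1 take_size_cat.
have lz : arr s' 12 (arr s' t j) = label_code z.
  rewrite !fa ?inE //= -[j in arr s t j](subnKC jq) az.
  by case: (ta z).
rewrite pE map_rcons -rcons_cat lz.
exact: (holds_word_rcons _ _ IH).
Qed.

Lemma append_inverse_spec s w : tables s -> reg s 10 = q -> reg s 31 = en ->
  stored (arr s t) q O -> holds_word s w ->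
  holds_word (den (append_inverse t) s) (w ++ [seq label_code z | z <- rev_walk prefix]).
Proof.
move=> [sm ta _] r10 r31 st hw.
have szp : size prefix <= size O by rewrite size_take; case: ifP => //; lia.
(* Positions are read downwards: after [j] rounds those from [m - j] on are done, and their inverses
   come first in the word. *)
pose I j s' := holds_word s' (w ++ [seq label_code z | z <- rev_walk (drop (m - j - q) prefix)]).
have : I m (den (append_inverse t) s); last by rewrite /I subnn sub0n drop0.
apply: (for_rule (I := I)) => //.
  by rewrite /I drop_oversize /= ?cats0 //; lia.
move=> j s' jm sj [fr fa] IH; rewrite /I !denE /= sj !(fr 10, fr 31, fr 1) // sm r10 r31.
have -> : m - 1 - j = m - j.+1 by lia.
have hw' v : holds_word s' v -> holds_word (set_reg (set_reg s' 33 (m - j.+1)) 32 j.+1) v.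
  by case=> h1 h2; split.
case: ltnP => jq /=.
  apply: hw'; have -> : m - j.+1 - q = m - j - q by lia.
  exact: IH.
case: ltnP => jen /=; last first.
  have sz : size prefix <= m - j.+1 - q by rewrite size_take; case: ifP; lia.
  by apply: hw'; rewrite drop_oversize //; move: IH; rewrite /I drop_oversize //; lia.
have jO : m - j.+1 - q < size O by lia.
have [O1 [z [O2 [eO sO1 az]]]] := stored_at st jO.
have pE : drop (m - j.+1 - q) prefix = z :: drop (m - j - q) prefix.
  have E : m - j - q = (m - j.+1 - q).+1 by lia.
  have lt : m - j.+1 - q < size prefix by rewrite size_take; case: ifP; lia.
  rewrite E (drop_nth z lt) nth_take; last by lia.
  by rewrite eO nth_cat sO1 ltnn subnn.
have lz : arr s' 12 (arr s' 13 (arr s' t (m - j.+1))) = label_code (arc_inv z).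
  rewrite !fa ?inE //= -{1}(subnKC jq) az.
  by case: (ta z) => _ _ -> _; case: (ta (arc_inv z)).
rewrite pE rev_walk_cons map_rcons -rcons_cat lz.
have {}IH : holds_word (set_reg s' 33 (m - j.+1)) _ := IH.
exact: (holds_word_rcons _ _ IH).
Qed.

End Append.

Section Good.
Variables (q : nat) (x : vertex G) (O : seq (arc_of G)).
Hypothesis qO : q + size O = m.
Local Notation n := (size O).
Local Notation vt := (visit_time x O).
Local Notation pl := (prefix_label gamma O).

Definition trail_at s : Prop :=
  [/\ tables s, reg s 10 = q & stored (arr s 15) q O].

Lemma trail_at_frame p s s' : frame p s s' ->
  all (fun r => r \notin written_regs p) [:: 1; 10] ->
  all (fun t => t \notin written_arrs p) [:: 10; 11; 12; 13; 14; 15] ->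
  trail_at s -> trail_at s'.
Proof.
move=> fr /and3P[h1 h10 _] hall [ts r10 st]; split.
- apply: tables_frame fr h1 _ ts; apply/allP=> t ht; apply: (allP hall).
  exact: (mem_subseq (s2 := [:: 10; 11; 12; 13; 14; 15]) (s1 := [:: 10; 11; 12; 13; 14])).
- by rewrite fr.1.
- by apply: stored_ext st => i _; rewrite fr.2 //; apply: (allP hall).
Qed.

Definition visits_at (rp : nat -> nat) s : Prop := forall i, i <= n ->
  [/\ arr s 19 (q + i) = vt i, arr s 20 (q + i) = q + rp i, rp i <= n, vt (rp i) = vt i &
      forall j, vt i = vt j -> rp i = rp j].

Lemma visits_at_frame p rp s s' : frame p s s' ->
  all (fun t => t \notin written_arrs p) [:: 19; 20] -> visits_at rp s -> visits_at rp s'.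
Proof. by move=> [_ fa] /and3P[h1 h2 _] h i /h[? ? ? ? ?]; split; rewrite ?fa. Qed.

(** Array 21 is overwritten at each visit, so its final entry, the last visit, depends on the vertex
    alone and can serve as representative. *)
Lemma visits_spec s : trail_at s -> reg s 11 = x ->
  exists2 rp, visits_at rp (den visits_prog s) &
    forall i, i <= n -> arr (den visits_prog s) 22 (q + i) = q + rp i.
Proof.
move=> [[sm ta _] r10 st] r11; rewrite /visits_prog den_seq.
set s1 := den record_visits s.
have V1 : forall i, q + i < m + 1 -> arr s1 19 (q + i) = vt i /\
    exists r, [/\ q + r < m + 1, arr s1 21 (vt i) = q + r & vt r = vt i].
  pose I j s' := forall i, q + i < j -> arr s' 19 (q + i) = vt i /\
    exists r, [/\ q + r < j, arr s' 21 (vt i) = q + r & vt r = vt i].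
  apply: (for_rule (I := I)) => //; first by rewrite sm.
  move=> j s' jm sj [fr fa] IH i ij.
  rewrite den_if den_skip den_seq den_put [eval_expr s' _]/= sj (fr 10) // r10.
  case: (ltnP j q) => jq /=; first by exfalso; lia.
  have [i0 ej] : exists i0, j = q + i0 by exists (j - q); rewrite subnKC.
  set s2 := den set_visit s'.
  have r10' : reg s' 10 = q by rewrite fr.
  have v0 : arr s2 19 j = vt i0.
    rewrite /s2 /set_visit !denE /= sj r10'.
    case: (eqVneq j q) => jq' /=; rewrite ?sj eqxx /=.
      by rewrite fr // r11 (_ : i0 = 0) ?/visit_time ?take0 //; lia.
    have iO : i0 - 1 < n by lia.
    have [O1 [z [O2 [eO sO1 az]]]] := stored_at st iO.
    rewrite !fa // (_ : j - 1 = q + (i0 - 1)); last by lia.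
    rewrite az; case: (ta z) => -> _ _ _; rewrite /visit_time.
    rewrite (_ : take i0 O = rcons O1 z) ?endv_rcons // eO -cat_rcons take_size_cat //.
    by rewrite size_rcons sO1; lia.
  have vne i' : i' != j -> arr s2 19 i' = arr s' 19 i'.
    by move=> ne; rewrite /s2 /set_visit !denE; case: ifP => _ /=; rewrite sj (negbTE ne).
  have v21 i' : arr s2 21 i' = arr s' 21 i' by rewrite /s2 arr_den.
  have v20 : reg s2 20 = j by rewrite /s2 reg_den.
  rewrite v20 v0 /=.
  have [ei|ne] := eqVneq i i0.
    subst i; rewrite -ej; split=> //; exists i0; rewrite -ej eqxx; split=> //.
  have lt : q + i < j by lia.
  have [e19 [r [rj e21 er]]] := IH i lt.
  split; first by rewrite vne //; lia.
  case: eqP => [/val_inj E|_].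
    by exists i0; rewrite -ej; split=> //; rewrite E.
  by exists r; rewrite v21; split=> //; lia.
set l2 := set_representatives.
have m1 : reg s1 1 = m by rewrite reg_den.
have V2 : forall i, i < m + 1 ->
    arr (den l2 s1) 20 i = arr s1 21 (arr s1 19 i) /\
    arr (den l2 s1) 22 i = arr s1 21 (arr s1 19 i).
  pose I j s' := forall i, i < j -> arr s' 20 i = arr s1 21 (arr s1 19 i) /\
    arr s' 22 i = arr s1 21 (arr s1 19 i).
  apply: (for_rule (I := I)) => //; first by rewrite m1.
  move=> j s' jm sj [fr fa] IH i ij; rewrite !denE /= !sj !(fa 19, fa 21) //.
  by case: eqVneq => [->//|ne]; apply: IH; lia.
have rng i : i <= n -> q + i < m + 1 by lia.
exists (fun i => arr s1 21 (vt i) - q) => i hi.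
  have [e19 [r [rm e21 er]]] := V1 i (rng i hi).
  have [e20 e22] := V2 (q + i) (rng i hi).
  split.
  - by rewrite arr_den.
  - by rewrite e20 e19 e21; lia.
  - by rewrite e21; lia.
  - by rewrite e21 addKn.
  - by move=> j ->.
have [e19 [r [rm e21 er]]] := V1 i (rng i hi).
have [e20 e22] := V2 (q + i) (rng i hi).
by rewrite e22 e19 e21; lia.
Qed.

(** * Representative chords and classes of linked vertices *)

Section Classes.
Variable rp : nat -> nat.
Hypothesis rpP : forall i, i <= n ->
  [/\ rp i <= n, vt (rp i) = vt i & forall j, vt i = vt j -> rp i = rp j].

Definition crossing_pair (i j : nat) : Prop :=
  [/\ i <= n, j <= n, vt i != vt j & cross (rp i) i (rp j) j].

Lemma crossing_pair_interl i j : crossing_pair i j -> interl n vt (vt i) (vt j).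
Proof.
move=> [hi hj ne c]; split=> //; exists (rp i), i, (rp j), j.
by have [? ? _] := rpP hi; have [? ? _] := rpP hj.
Qed.

(** By additivity, whatever crosses the chord [i1], [i2] crosses exactly one of the chords from the
    common representative to [i1] and to [i2]. *)
Lemma interl_crossing_pair u w : interl n vt u w ->
  exists i j, [/\ crossing_pair i j, vt i = u & vt j = w].
Proof.
move=> [uw [i1 [i2 [j1 [j2 [[hi1 hi2 vi1 vi2] [hj1 hj2 vj1 vj2] c]]]]]].
have [_ _ ri] := rpP hi1; have [_ _ rj] := rpP hj1.
have [i [hi vi ci]] : exists i, [/\ i <= n, vt i = u & cross (rp i) i j1 j2].
  move: c; rewrite (cross_transl i1 (rp i1)) cross_swapl.
  case: (boolP (cross (rp i1) i1 j1 j2)) => [h _|_ h]; first by exists i1.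
  by exists i2; split=> //; rewrite -(ri i2) // vi1.
have [j [hj vj cj]] : exists j, [/\ j <= n, vt j = w & cross (rp i) i (rp j) j].
  move: ci; rewrite (cross_transr _ _ j1 (rp j1)) cross_swapr.
  case: (boolP (cross (rp i) i (rp j1) j1)) => [h _|_ h]; first by exists j1.
  by exists j2; split=> //; rewrite -(rj j2) // vj1.
by exists i, j; rewrite /crossing_pair vi vj.
Qed.

(** Only the last clause depends on progress, recorded in [done]; the other two say that the classes
    never split a vertex and never join unlinked ones. *)
Definition classes_at (done : nat -> nat -> Prop) s : Prop :=
  [/\ forall i j, i <= n -> j <= n -> vt i = vt j -> arr s 22 (q + i) = arr s 22 (q + j),
      forall i j, i <= n -> j <= n -> arr s 22 (q + i) = arr s 22 (q + j) ->
        exists k, chain n vt k (vt i) (vt j) &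
      forall i j, crossing_pair i j -> done i j -> arr s 22 (q + i) = arr s 22 (q + j)].

Lemma merge_spec s (done : nat -> nat -> Prop) i0 j0 : reg s 1 = m -> crossing_pair i0 j0 ->
  reg s 20 = q + i0 -> reg s 21 = q + j0 -> classes_at done s ->
  classes_at (fun i j => done i j \/ i = i0 /\ j = j0) (den merge_prog s).
Proof.
move=> sm cp r20 r21 [C1 C2 C3]; have [hi0 hj0 _ _] := cp.
rewrite /merge_prog !den_seq; set s1 := den (PSet 24 _) _; set l := PFor _ _ _.
pose A := arr s 22 (q + i0); pose B := arr s 22 (q + j0).
have E t : t < m + 1 -> arr (den l s1) 22 t = if arr s 22 t == A then B else arr s 22 t.
  pose I j s' := forall t, arr s' 22 t =
    if (t < j) && (arr s 22 t == A) then B else arr s 22 t.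
  suff /(_ t) H : I (m + 1) (den l s1) by move=> h; rewrite H h.
  apply: (for_rule (I := I)) => //; first by rewrite /s1 !denE /= sm.
  move=> j s' jm sj [fr fa] IH u; rewrite !denE /= sj (IH j) ltnn /=.
  rewrite !(fr 23, fr 24) // /s1 !denE /= r20 r21 -/A -/B.
  case: (eqVneq (arr s 22 j) A) => h /=.
    rewrite ?sj; case: eqVneq => [->|ne]; first by rewrite ltnSn h eqxx.
    by rewrite IH ltnS [u <= j]leq_eqVlt (negbTE ne).
  by rewrite IH ltnS [u <= j]leq_eqVlt; case: (eqVneq u j) => [->|//]; rewrite (negbTE h) !andbF.
have E' i : i <= n -> arr (den l s1) 22 (q + i) =
    if arr s 22 (q + i) == A then B else arr s 22 (q + i).
  by move=> h; apply: E; lia.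
have [k0 ch0] : exists k, chain n vt k (vt i0) (vt j0).
  by exists 1, (vt j0) => //; apply: crossing_pair_interl.
split.
- by move=> i j hi hj v; rewrite !E' // (C1 i j).
- move=> i j hi hj; rewrite !E' //.
  case: eqVneq => [ei|ni]; case: eqVneq => [ej|nj].
  + by move=> _; apply: C2 => //; rewrite ei ej.
  + move=> e; have [k1 c1] := C2 _ _ hi hi0 ei; have [k2 c2] := C2 _ _ hj0 hj e.
    by exists (k1 + (k0 + k2)); apply: chain_cat c1 (chain_cat ch0 c2).
  + move=> e; have [k1 c1] := C2 _ _ hi hj0 e; have [k2 c2] := C2 _ _ hi0 hj (esym ej).
    by exists (k1 + (k0 + k2)); apply: chain_cat c1 (chain_cat (chain_sym ch0) c2).
  + exact: C2.
- move=> i j cij [d|[-> ->]]; first by have [hi hj _ _] := cij; rewrite !E' // (C3 i j).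
  by rewrite !E' // eqxx; case: eqP.
Qed.

Lemma classes_spec s : reg s 1 = m -> reg s 10 = q -> visits_at rp s ->
  (forall i, i <= n -> arr s 22 (q + i) = q + rp i) ->
  classes_at (fun _ _ => True) (den classes_prog s).
Proof.
move=> sm r10 va c22.
pose Inv (d : nat -> nat -> Prop) s' := classes_at (fun i j => d (q + i) (q + j)) s'.
have weak (d d' : nat -> nat -> Prop) s' :
    (forall i j, d' (q + i) (q + j) -> i <= n -> j <= n -> d (q + i) (q + j)) ->
    Inv d s' -> Inv d' s'.
  move=> h [C1 C2 C3]; split=> // i j cp d0; apply: C3 => //.
  by case: cp => hi hj _ _; apply: h.
pose I j1 s' := Inv (fun i j => i < j1) s'.
suff : I (m + 1) (den classes_prog s).
  by apply: (weak (fun i _ => i < m + 1) (fun _ _ => True)) => i j _ hi hj; lia.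
apply: (for_rule (I := I)) => //; first by rewrite sm.
  split=> //= i j hi hj; first by move=> v; rewrite !c22 //; have [_ _ E] := rpP hi; rewrite (E j).
  rewrite !c22 // => /addnI e; exists 0 => /=.
  by have [_ <- _] := rpP hi; have [_ <- _] := rpP hj; rewrite e.
move=> j1 s1 j1m s1j [fr1 fa1] IH1.
have m1 : reg s1 1 = m by rewrite fr1.
set inner := PFor 21 BM1 _.
pose done2 j2 (i j : nat) := i < j1 \/ i = j1 /\ j < j2.
pose I2 j2 s' := Inv (done2 j2) s'.
suff : I2 (m + 1) (den inner s1).
  apply: (weak (done2 (m + 1)) (fun i _ => i < j1.+1)) => i j lt hi hj.
  by rewrite /done2; lia.
apply: (for_rule (I := I2)) => //; first by rewrite m1.
  by apply: (weak (fun i _ => i < j1) (done2 0)) IH1 => i j [//|[_ //]].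
move=> j2 s2 j2m s2j [fr2 fa2] IH2.
have r20 : reg s2 20 = j1 by rewrite fr2.
have r10' : reg s2 10 = q by rewrite fr2 // fr1.
have m2 : reg s2 1 = m by rewrite fr2.
have va2 : visits_at rp s2.
  by move=> i hi; have [? ? ? ? ?] := va i hi; split=> //; rewrite fa2 // fa1.
have keep : (forall i j, crossing_pair i j -> done2 j2.+1 (q + i) (q + j) ->
    done2 j2 (q + i) (q + j)) -> I2 j2.+1 (set_reg s2 21 j2.+1).
  by move=> h; case: IH2 => [C1 C2 C3]; split=> // i j cp d; apply: C3 => //; apply: h.
rewrite !den_if !den_skip [eval_expr s2 (ELt _ _)]/= r20 r10'.
case: (ltnP j1 q) => h1 /=.
  by refine (keep _) => i j _ [lt|[e _]]; [left | lia].
rewrite s2j r10' r20; case: (ltnP j2 q) => h2 /=.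
  by refine (keep _) => i j _ [lt|[e lt]]; [left | lia].
have [i0 e1] : exists i0, j1 = q + i0 by exists (j1 - q); rewrite subnKC.
have [j0 e2] : exists j0, j2 = q + j0 by exists (j2 - q); rewrite subnKC.
have hi0 : i0 <= n by lia.
have hj0 : j0 <= n by lia.
have [a19 a20 _ _ _] := va2 i0 hi0; have [b19 b20 _ _ _] := va2 j0 hj0.
rewrite e1 e2 a19 b19 a20 b20 /=.
have skip : ~ crossing_pair i0 j0 ->
    I2 j2.+1 (set_reg s2 21 j2.+1).
  move=> ncp; refine (keep _) => i j cp [lt|[ei ej]]; first by left.
  right; split=> //.
  rewrite ltn_neqAle -ltnS ej andbT; apply/eqP => ej'; apply: ncp.
  have -> : i0 = i by lia.
  by have -> : j0 = j by lia.
have -> : (nat_of_ord (vt i0) == nat_of_ord (vt j0)) = (vt i0 == vt j0) by [].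
case: (eqVneq (vt i0) (vt j0)) => [v|nv] /=.
  by rewrite -e2; refine (skip _) => -[_ _]; rewrite v eqxx.
rewrite !ltn_add2l.
have ce : cross (rp i0) i0 (rp j0) j0 =
    (((rp i0 < rp j0) == (i0 < rp j0)) != ((rp i0 < j0) == (i0 < j0))).
  by rewrite /cross; do 4!case: (_ < _).
have eqb_nat (b1 b2 : bool) : (nat_of_bool b1 == nat_of_bool b2) = (b1 == b2).
  by case: b1; case: b2.
case: (boolP (cross (rp i0) i0 (rp j0) j0)) => cr; last first.
  move: (cr); rewrite ce negbK => /eqP E; rewrite !eqb_nat E eqxx /= -e2.
  by refine (skip _) => -[_ _ _]; rewrite (negbTE cr).
move: (cr); rewrite ce => /negbTE E; rewrite !eqb_nat E /= -e2.
have cp : crossing_pair i0 j0 by [].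
have := merge_spec m2 cp (etrans r20 e1) (etrans s2j e2) IH2.
case=> [C1 C2 C3]; split=> // i j cpij [lt|[ei ej]].
  by apply: C3 => //; left; left.
apply: C3 => //; case: (eqVneq (q + j) j2) => ej'; [right|left; right]; lia.
Qed.

Lemma classes_chain s i j : classes_at (fun _ _ => True) s -> i <= n -> j <= n ->
  (arr s 22 (q + i) = arr s 22 (q + j) <-> exists k, chain n vt k (vt i) (vt j)).
Proof.
move=> [C1 C2 C3] hi hj; split=> [|[l]]; first exact: C2.
elim: l i hi => [|l IH] i hi /=; first exact: C1.
case=> u /interl_crossing_pair[i' [j' [cp vi vj]]] ch.
have [hi' hj' _ _] := cp.
rewrite (C1 i i') // (C3 i' j') //; apply: IH => //; by rewrite vj.
Qed.

(** Representative chords are involutions, by pairing with the trivial chord at [rp i], and commute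
    within a class. Any other chord label is a product of two of them. *)
Lemma good_trailP : good_trail gamma x O <->
  forall i j, i <= n -> j <= n -> (exists l, chain n vt l (vt i) (vt j)) ->
    sq1 (gdiff pl (rp i) i * gdiff pl (rp j) j)%g.
Proof.
split=> [g i j hi hj [l ch]|h l u w i1 i2 j1 j2 [hi1 hi2 vi1 vi2] [hj1 hj2 vj1 vj2] ch].
  have [? ? _] := rpP hi; have [? ? _] := rpP hj.
  by apply: (g l (vt i) (vt j)).
have sq i : i <= n -> sq1 (gdiff pl (rp i) i).
  move=> hi; have [hr vr _] := rpP hi; have [_ _ er] := rpP hr.
  have := h i (rp i) hi hr; rewrite (er i vr) gdiffxx mulg1; apply.
  by exists 0; rewrite /= vr.
have comm i j : i <= n -> j <= n -> vt i = u -> vt j = w ->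
    commute (gdiff pl (rp i) i) (gdiff pl (rp j) j).
  move=> hi hj vi vj; apply: sq1_commute; [exact: sq | exact: sq|].
  by apply: h => //; exists l; rewrite vi vj.
have comm1 i j : i <= n -> j <= n -> vt i = vt j ->
    commute (gdiff pl (rp i) i) (gdiff pl (rp j) j).
  move=> hi hj v; apply: sq1_commute; [exact: sq | exact: sq|].
  by apply: h => //; exists 0.
have split_chord i j : i <= n -> j <= n -> vt i = vt j ->
    gdiff pl i j = (gdiff pl (rp j) j * gdiff pl (rp i) i)%g.
  move=> hi hj v; have [_ _ E] := rpP hi.
  by rewrite -(E j v) (gdiff_trans pl i (rp i) j) -(gdiffV pl (rp i)) (sq1V (sq i hi)).
rewrite (split_chord i1 i2) ?vi1 // (split_chord j1 j2) ?vj1 //.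
apply: sq1M; [apply: sq1M | apply: sq1M |].
- exact: sq.
- exact: sq.
- by apply: comm1; rewrite // vi1.
- exact: sq.
- exact: sq.
- by apply: comm1; rewrite // vj1.
- by apply: commute_prodl; apply: commuteM; apply: comm.
Qed.

Lemma append_chord_spec s w r i : trail_at s -> visits_at rp s -> i <= n ->
  r \notin [:: 30; 31; 32; 33] -> reg s r = q + i -> holds_word s w ->
  holds_word (den (append_chord r) s)
    (w ++ [seq label_code z | z <- take i O ++ rev_walk (take (rp i) O)]).
Proof.
move=> ta va hi; rewrite !inE !negb_or => /and4P[r30 r31 r32 r33] ri hw.
rewrite /append_chord !den_seq map_cat catA.
set s1 := den (PSet 31 _) s; set s2 := den (append_prefix 15) s1.
set s3 := den (PSet 31 _) s2.
have ta1 : trail_at s1 by apply: (trail_at_frame (den_frame _ _ _)) ta.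
have ta2 : trail_at s2 by apply: (trail_at_frame (den_frame _ _ _)) ta1.
have ta3 : trail_at s3 by apply: (trail_at_frame (den_frame _ _ _)) ta2.
have va2 : visits_at rp s2 by apply: (visits_at_frame (den_frame _ _ _)).
have r2 : reg s2 r = q + i.
  rewrite reg_den; last by rewrite /= !inE !negb_or r30 r32.
  by rewrite /s1 den_set /= (negbTE r31).
have [[t1 q1 st1] [t3 q3 st3]] := (ta1, ta3).
have hw2 := @append_prefix_spec 15 q (q + i) O isT qO s1 w t1 q1 ri st1 hw.
have e31 : reg s3 31 = q + rp i.
  by rewrite /s3 den_set /= r2; have [_ -> _ _ _] := va2 i hi.
have := @append_inverse_spec 15 q (q + rp i) O isT qO s3 _ t3 q3 e31 st3.
rewrite !addKn in hw2 *; apply.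
exact: hw2.
Qed.

Lemma query_chords_spec s i j : trail_at s -> visits_at rp s -> i <= n -> j <= n ->
  reg s 20 = q + i -> reg s 21 = q + j ->
  let s' := den query_chords s in
  let g := (gdiff pl (rp i) i * gdiff pl (rp j) j)%g in
  (sq1 g /\ reg s' 25 = reg s 25) \/ (~ sq1 g /\ reg s' 25 = 0).
Proof.
move=> ta va hi hj ri rj s' g; rewrite /s' /query_chords.
pose A := take i O ++ rev_walk (take (rp i) O).
pose B := take j O ++ rev_walk (take (rp j) O).
have step s1 w r l : trail_at s1 /\ visits_at rp s1 -> reg s1 20 = q + i /\ reg s1 21 = q + j ->
    r \notin [:: 30; 31; 32; 33] -> l <= n -> reg s1 r = q + l -> holds_word s1 w ->
    let s2 := den (append_chord r) s1 in
    [/\ trail_at s2 /\ visits_at rp s2, reg s2 20 = q + i /\ reg s2 21 = q + j &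
      holds_word s2 (w ++ [seq label_code z | z <- take l O ++ rev_walk (take (rp l) O)])].
  move=> [ta1 va1] [r20 r21] nr hl rl hw /=; split.
  - split; first by apply: (trail_at_frame (den_frame _ _ _)) ta1.
    by apply: (visits_at_frame (den_frame _ _ _)) va1.
  - by rewrite !reg_den.
  - exact: append_chord_spec.
rewrite den_seq; set s0 := den (PSet 30 _) s.
have h0 : holds_word s0 [::] by [].
have ta0 : trail_at s0 by apply: (trail_at_frame (den_frame _ _ _)) ta.
have va0 : visits_at rp s0 by apply: (visits_at_frame (den_frame _ _ _)) va.
rewrite den_seq; have [tv1 rr1 h1] := step s0 _ 20 i (conj ta0 va0) (conj ri rj) isT hi ri h0.
set s1 := den _ s0 in tv1 rr1 h1 *.
rewrite den_seq; have [tv2 rr2 h2] := step s1 _ 21 j tv1 rr1 isT hj rr1.2 h1.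
set s2 := den _ s1 in tv2 rr2 h2 *.
rewrite den_seq; have [tv3 rr3 h3] := step s2 _ 20 i tv2 rr2 isT hi rr2.1 h2.
set s3 := den _ s2 in tv3 rr3 h3 *.
rewrite den_seq; have [tv4 rr4 h4] := step s3 _ 21 j tv3 rr3 isT hj rr3.2 h3.
set s4 := den _ s3 in tv4 rr4 h4 *.
have r25 : reg s4 25 = reg s 25 by rewrite !reg_den.
have [[[sm _ _] _ _] _] := tv4; clearbody s0 s1 s2 s3 s4.
have {}h4 : holds_word s4 [seq label_code z | z <- A ++ B ++ A ++ B].
  by move: h4; rewrite /A /B cat0s !map_cat -!catA.
have [_ ri' rin _ _] := va i hi; have [_ rj' rjn _ _] := va j hj.
(* Four chord words, each made of two prefixes of at most [m] arcs. *)
have sz4 : eval_expr s4 (EReg 30) <= 12 * m.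
  have [E _] := h4; rewrite [eval_expr _ _]E size_map !size_cat !size_rev_walk !size_takel //.
  by lia.
rewrite den_seq (den_query _ _ _ sm sz4) (holds_word_mkseq h4).
have lab_g : trail_label gamma (A ++ B ++ A ++ B) = (g * g)%g.
  have lA l : trail_label gamma (take l O ++ rev_walk (take (rp l) O)) = gdiff pl (rp l) l.
    by rewrite label_cat label_rev_walk.
  have := lA i; have := lA j; rewrite -/A -/B /g => <- <-.
  by clearbody A B; rewrite !label_cat !mulgA.
have := oracle_label (A ++ B ++ A ++ B); rewrite lab_g => -[o1 o2].
rewrite den_if den_skip /=; case: (boolP (oracle _)) o1 o2 => /= _ o1 o2.
  by left; split=> //; apply: o1.
by right; split=> // sg; have := o2 sg.
Qed.

Lemma test_spec s : trail_at s -> visits_at rp s -> classes_at (fun _ _ => True) s ->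
  (reg (den test_prog s) 25 = 1 /\ good_trail gamma x O) \/
  (reg (den test_prog s) 25 = 0 /\ ~ good_trail gamma x O).
Proof.
move=> ta va cl; rewrite /test_prog den_seq; set s0 := den (PSet 25 _) s.
set loop := PFor 20 BM1 _.
pose bad i j := [/\ i <= n, j <= n, (exists l, chain n vt l (vt i) (vt j)) &
  ~ sq1 (gdiff pl (rp i) i * gdiff pl (rp j) j)%g].
pose Inv (d : nat -> nat -> Prop) s' :=
  (reg s' 25 = 1 /\ forall i j, i <= n -> j <= n -> (exists l, chain n vt l (vt i) (vt j)) ->
     d (q + i) (q + j) -> sq1 (gdiff pl (rp i) i * gdiff pl (rp j) j)%g) \/
  (reg s' 25 = 0 /\ exists i j, bad i j).
pose I j1 s' := Inv (fun i j => i < j1) s'.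
suff : I (m + 1) (den loop s0).
  case=> [[-> h]|[-> [i [j [hi hj ch ns]]]]]; [left|right]; split=> //.
    by apply/good_trailP => i j hi hj ch; apply: h => //; lia.
  by move/good_trailP => g; apply: ns; apply: g.
have ta0 : trail_at s0 by apply: (trail_at_frame (den_frame _ _ _)) ta.
have va0 : visits_at rp s0 by apply: (visits_at_frame (den_frame _ _ _)) va.
have [[sm _ _] _ _] := ta0.
apply: (for_rule (I := I)) => //; first by rewrite sm.
  by left.
move=> j1 s1 j1m s1j fr1 IH1.
have ta1 : trail_at s1 by apply: trail_at_frame fr1 _ _ ta0.
have va1 : visits_at rp s1 by apply: visits_at_frame fr1 _ va0.
have [[sm1 _ _] _ _] := ta1.
set inner := PFor 21 BM1 _.
pose done2 j2 (i j : nat) := i < j1 \/ i = j1 /\ j < j2.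
pose I2 j2 s' := Inv (done2 j2) s'.
have weak (d d' : nat -> nat -> Prop) s' s'' : reg s'' 25 = reg s' 25 ->
    (forall i j, i <= n -> j <= n -> (exists l, chain n vt l (vt i) (vt j)) ->
       d' (q + i) (q + j) ->
       d (q + i) (q + j) \/ sq1 (gdiff pl (rp i) i * gdiff pl (rp j) j)%g) ->
    Inv d s' -> Inv d' s''.
  move=> e h [[r1 g]|[r0 b]]; [left|right]; rewrite e; split=> //.
  by move=> i j hi hj ch /(h i j hi hj ch)[|//]; apply: g.
suff : I2 (m + 1) (den inner s1).
  apply: weak => // i j hi hj _ lt; left; rewrite /done2; lia.
apply: (for_rule (I := I2)) => //; first by rewrite sm1.
  by apply: weak IH1 => // i j hi hj _ [lt|[_ //]]; left.
move=> j2 s2 j2m s2j fr2 IH2.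
have ta2 : trail_at s2 by apply: trail_at_frame fr2 _ _ ta1.
have va2 : visits_at rp s2 by apply: visits_at_frame fr2 _ va1.
have r20 : reg s2 20 = j1 by rewrite fr2.1.
have [_ r10 _] := ta2.
have c22 t : arr s2 22 t = arr s 22 t by rewrite fr2.2 // fr1.2 // arr_den.
rewrite !den_if !den_skip /= r20 r10 s2j.
case: (ltnP j1 q) => h1 /=.
  by apply: (weak (done2 j2)) IH2 => // i j hi hj _ [lt|[e _]]; left; [left | lia].
case: (ltnP j2 q) => h2 /=.
  by apply: (weak (done2 j2)) IH2 => // i j hi hj _ [lt|[e lt]]; left; [left | lia].
have [i0 e1] : exists i0, j1 = q + i0 by exists (j1 - q); rewrite subnKC.
have [j0 e2] : exists j0, j2 = q + j0 by exists (j2 - q); rewrite subnKC.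
have hi0 : i0 <= n by lia.
have hj0 : j0 <= n by lia.
have new i j : done2 j2.+1 (q + i) (q + j) -> done2 j2 (q + i) (q + j) \/ i = i0 /\ j = j0.
  by rewrite /done2; lia.
have cc := classes_chain cl hi0 hj0.
rewrite !c22 e1 e2; case: (eqVneq (arr s 22 (q + i0)) _) => [eq|ne] /=.
  have Q := query_chords_spec ta2 va2 hi0 hj0 (etrans r20 e1) (etrans s2j e2).
  cbv zeta in Q; rewrite -e2; move: (den query_chords s2) Q => s3 [[sg r25]|[ns r25]].
    by apply: (weak (done2 j2) _ s2) IH2 => // i j hi hj _ /new[|[-> ->]]; [left|right].
  by right; split; [exact: r25 | exists i0; exists j0; split=> //; apply/cc].
rewrite -e2; apply: (weak (done2 j2)) IH2 => // i j hi hj ch /new[|[ei ej]]; first by left.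
by exfalso; case/eqP: ne; apply/cc; rewrite -ei -ej.
Qed.

End Classes.

Lemma good_spec s : trail_at s -> reg s 11 = x ->
  (reg (den good_prog s) 25 = 1 /\ good_trail gamma x O) \/
  (reg (den good_prog s) 25 = 0 /\ ~ good_trail gamma x O).
Proof.
move=> ta r11; rewrite -[den good_prog s]/(den test_prog (den classes_prog (den visits_prog s))).
have [rp va c22] := visits_spec ta r11.
have ta1 : trail_at (den visits_prog s) by apply: (trail_at_frame (den_frame _ _ _)) ta.
have rpP i : i <= n -> [/\ rp i <= n, vt (rp i) = vt i & forall j, vt i = vt j -> rp i = rp j].
  by move=> /va[].
have [[sm _ _] r10 _] := ta1.
apply: (test_spec rpP).
- by apply: (trail_at_frame (den_frame _ _ _)) ta1.
- by apply: (visits_at_frame (den_frame _ _ _)) va.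
- exact: (classes_spec rpP).
Qed.

End Good.

Lemma eulerian_completes (a b : vertex G) T : eulerian_trail a b T <-> completes [::] a b T.
Proof.
split=> [[/andP[w u] full]|[w u sz]]; first by split=> //; apply: full_edges_size.
by split; [rewrite /trail w | move=> e; apply: full_edges].
Qed.

Lemma uniform_completes P (x b : vertex G) O : completes P x b O ->
  (uniform_trail gamma x b O <->
   forall T, completes P x b T -> trail_label gamma T = trail_label gamma O).
Proof.
move=> cO; split=> [u T cT|h T wT pe].
  by apply: u; [case: cT | apply: completes_perm cO cT].
exact/h/(perm_completes cO).
Qed.

(** Both programs rest on this: the decision with [P] empty, the search with [P] ending in the
    candidate arc. *)
Lemma good_completes P (x b : vertex G) O : completes P x b O ->
  (good_trail gamma x O <->
   forall T, completes P x b T -> trail_label gamma T = trail_label gamma O).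
Proof.
move=> cO; rewrite -uniform_completes //; have [w u _] := cO; split.
  apply: good_uniform_trail => //.
  by move: u; rewrite edges_of_cat cat_uniq => /and3P[].
exact: uniform_good_trail.
Qed.

Lemma den_start s : den start_prog s =
  den euler_prog (den (PSet 11 (EReg 2)) (den (PSet 10 (ECst 0)) (den init_prog s))).
Proof.
by rewrite /start_prog (den_seq oracle init_prog) (den_seq oracle (PSet 10 _))
  (den_seq oracle (PSet 11 _)).
Qed.

Lemma den_search s : den search_prog s =
  den (PFor 40 BM search_round) (den (PSet 42 (ECst 0)) (den (copy_prog 15 16) (den start_prog s))).
Proof.
by rewrite /search_prog (den_seq oracle start_prog) (den_seq oracle (copy_prog _ _))
  (den_seq oracle (PSet 42 _)).
Qed.

(** * Correctness of the decision and of the search *)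

Section Main.
Variables (adj : vertex G -> seq (arc_of G)) (a b : vertex G).
Hypothesis adjP : adjacency_lists adj.
Let s0 := input_state adj lab a b.

Lemma start_spec : let s := den start_prog s0 in
  [/\ tables s, reg s 10 = 0, reg s 11 = a, reg s 3 = b & trail_found [::] a b s].
Proof.
cbv zeta; rewrite den_start; set s1 := den (PSet 11 _) _.
have t1 : tables s1 by do 2!(apply: tables_den => //); apply: init_spec.
have r10 : reg s1 10 = 0 by rewrite /s1 !den_set.
have r11 : reg s1 11 = a by rewrite /s1 !den_set /= reg_den.
have r3 : reg s1 3 = b by rewrite /s1 !den_set /= reg_den.
clearbody s1.
have [tf _] := @euler_spec s1 [::] a b t1 r10 r11 r3 I isT.
split; [exact: tables_den | | | | exact: tf].
- by rewrite (reg_den oracle (p := euler_prog)).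
- by rewrite (reg_den oracle (p := euler_prog)).
- by rewrite (reg_den oracle (p := euler_prog)).
Qed.

Lemma decide_spec : let s := den decide_prog s0 in
  (reg s 0 = 1 /\ same_eulerian_labels gamma a b) \/
  (reg s 0 = 0 /\ ~ same_eulerian_labels gamma a b).
Proof.
cbv zeta; rewrite /decide_prog den_seq.
have := start_spec; move: (den start_prog s0) => s1 /= [t1 r10 r11 r3 tf].
rewrite den_if; case: tf => [[E none]|[E [O cO st]]].
  rewrite [eval_expr _ _]E /=; left; split=> // T1 T2 /eulerian_completes c1.
  by case: (none T1).
rewrite [eval_expr _ _]/= E den_seq den_set.
have [w u szO] := cO; rewrite /= add0n in szO.
have := @good_spec 0 a O szO s1 (And3 t1 r10 st) r11.
move: (den good_prog s1) => s2 /= [[-> g]|[-> ng]]; [left|right]; split=> //.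
  move=> T1 T2 /eulerian_completes c1 /eulerian_completes c2.
  by rewrite !((good_completes cO).1 g).
move=> same; apply/ng/(good_completes cO) => T cT.
by apply: same; apply/eulerian_completes.
Qed.

Lemma copy_spec t t' s T : reg s 1 = m -> t != t' -> size T = m -> stored (arr s t) 0 T ->
  stored (arr (den (copy_prog t t') s) t') 0 T.
Proof.
move=> sm ne sz; apply: stored_ext => j; rewrite add0n sz => /andP[_ jm].
move: j jm; pose I j s' := forall i, i < j -> arr s' t' i = arr s t i.
apply: (for_rule (I := I)) => // j s' jm sj [fr fa] IH i ij; rewrite denE /= sj eqxx /=.
by case: eqVneq => [->|nj]; [rewrite fa // inE | apply: IH; lia].
Qed.

Definition found_pair s : Prop := reg s 42 != 0 /\ exists p1 p2,
  [/\ stored (arr s 0) 0 p1, stored (arr s 1) 0 p2, completes [::] a b p1,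
      completes [::] a b p2 & trail_label gamma p1 <> trail_label gamma p2].

(** Kept as a negation, which is what a failed goodness test yields; a second label is exhibited
    only when a candidate arc produces it. *)
Definition not_uniform_after (j : nat) W : Prop :=
  ~ forall T, completes (take j W) (endv a (take j W)) b T ->
      trail_label gamma T = trail_label gamma (drop j W).

Definition branching (j : nat) s : Prop := reg s 42 = 0 /\ exists W,
  [/\ stored (arr s 16) 0 W, completes [::] a b W & not_uniform_after j W].

Lemma edge_used_spec s P y : tables s -> reg s 40 = size P -> size P <= m ->
  reg s 41 = arc_code y -> stored (arr s 16) 0 P ->
  reg (den edge_used s) 44 = (arc_edge y \in edges_of P).
Proof.
move=> [sm ta _] r40 Pm r41 st; rewrite /edge_used den_seq; set s1 := den (PSet 44 _) s.
rewrite -(take_oversize Pm).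
pose I j s' := reg s' 44 = (arc_edge y \in edges_of (take j P)).
apply: (for_rule (I := I)) => //; first by rewrite /I take0.
move=> j s' jm sj [fr fa] IH; rewrite /I !denE /= sj !(fr 40, fr 41) // /s1 !denE /= r40 r41.
case: ltnP => jP /=; last by rewrite IH !take_oversize //; lia.
have [P1 [z [P2 [eP sP1 az]]]] := stored_at st jP; rewrite add0n in az.
have [_ _ _ z14] := ta z; have [_ _ _ y14] := ta y.
have e14 i : arr s' 14 i = arr s 14 i by rewrite fa.
have e16 i : arr s' 16 i = arr s 16 i by rewrite fa.
rewrite !e14 !e16 az z14 y14.
have -> : take j.+1 P = rcons (take j P) z.
  have -> : take j P = P1 by rewrite eP -sP1 take_size_cat.
  by rewrite eP -cat_rcons take_size_cat // size_rcons sP1.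
rewrite /edges_of map_rcons mem_rcons inE.
have -> : (nat_of_ord (arc_edge z) == arc_edge y) = (arc_edge y == arc_edge z).
  by rewrite eq_sym.
by case: (arc_edge y =P arc_edge z) => //= _; rewrite IH.
Qed.

(** * One candidate arc of the search *)

Section TryArc.
Variables (P W2 : seq (arc_of G)) (y f : arc_of G).
Local Notation W := (P ++ y :: W2).
Hypotheses (cW : completes [::] a b W) (fy : arc_tail f = arc_tail y).
Hypothesis fP : arc_edge f \notin edges_of P.

Lemma extend_spec s : tables s -> reg s 3 = b -> reg s 40 = size P -> reg s 41 = arc_code f ->
  stored (arr s 16) 0 W -> let s' := den extend_prog s in
  trail_found (rcons P f) (arc_head f) b s' /\ stored (arr s' 15) 0 (rcons P f).
Proof.
move=> ts r3 r40 r41 st.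
have [_ uW szW] := cW; rewrite cat0s in uW; rewrite /= add0n size_cat /= in szW.
have [stP _] := (stored_cat _ _ _ _).1 st; have [sm ta tt] := ts.
set copy := PFor 45 BM
  (PIf (ELt (EReg 45) (EReg 40)) (PPut 15 (EReg 45) (EGet 16 (EReg 45))) PSkip).
pose s1 := den copy s.
pose s2 := den (PPut 15 (EReg 40) (EReg 41)) s1.
pose s3 := den (PSet 11 (EGet 10 (EReg 41))) (den (PSet 10 (EAdd (EReg 40) (ECst 1))) s2).
cbv zeta; rewrite /extend_prog (den_seq oracle (PFor 45 _ _)) (den_seq oracle (PPut 15 _ _)).
rewrite (den_seq oracle (PSet 10 _)) (den_seq oracle (PSet 11 _)) -/copy -/s1 -/s2 -/s3.
have ts3 : tables s3 by do 4!(apply: tables_den => //).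
have r40' : reg s1 40 = size P by rewrite reg_den.
have r41' : reg s1 41 = arc_code f by rewrite reg_den.
have st1 : stored (arr s1 15) 0 P.
  have E : forall i, i < m -> i < size P -> arr s1 15 i = arr s 16 i.
    pose I j s' := forall i, i < j -> i < size P -> arr s' 15 i = arr s 16 i.
    apply: (for_rule (I := I)) => // j s' jm sj [fr fa] IH i ij iP; rewrite !denE /= sj fr // r40.
    case: (eqVneq i j) => [ei|ne].
      by rewrite -ei iP /= ?sj -?ei eqxx fa.
    by case: ifP => _ /=; rewrite ?sj ?(negbTE ne); apply: IH => //; lia.
  by apply: stored_ext stP => i; rewrite add0n => /andP[_ h]; apply: E => //; lia.
apply: euler_spec => //.
- by rewrite /s3 !den_set /= r40' addn1 size_rcons.
- rewrite /s3 !den_set /= r41' arr_den //.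
  by case: (ta f).
- by rewrite /s3 !den_set /= reg_den.
- rewrite -cats1 stored_cat /s3 /s2 !den_set den_put /= r40' r41' add0n eqxx; split=> //.
  by apply: stored_ext st1 => i; rewrite add0n => /andP[_ h]; rewrite ltn_eqF.
- rewrite /edges_of map_rcons rcons_uniq fP /=.
  by move: uW; rewrite edges_of_cat cat_uniq => /and3P[].
Qed.

Lemma compare_spec s V : tables s -> stored (arr s 16) 0 W -> stored (arr s 15) 0 V ->
  size V = m ->
  (reg (den compare_prog s) 34 != 0 <-> trail_label gamma W = trail_label gamma V).
Proof.
move=> ts stW stV szV; have [_ _ szW] := cW; rewrite /= add0n in szW.
pose s1 := den (PSet 31 (EReg 1)) (den (PSet 30 (ECst 0)) (den (PSet 10 (ECst 0)) s)).
pose s2 := den (append_prefix 16) s1; pose s3 := den (append_inverse 15) s2.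
rewrite -[den compare_prog s]/(den (PQuery 34 23 (EReg 30)) s3).
have ts1 : tables s1 by do 3!(apply: tables_den => //).
have ts2 : tables s2 by apply: tables_den.
have [sm _ _] := ts.
have h0 : holds_word s1 [::] by [].
have h1 := @append_prefix_spec 16 0 m W isT szW s1 [::] ts1 erefl sm stW h0.
have e31 : reg s2 31 = m by rewrite reg_den.
have e10 : reg s2 10 = 0 by rewrite reg_den.
have st2 : stored (arr s2 15) 0 V by apply: stored_ext stV => i _; rewrite /s2 arr_den.
have h2 := @append_inverse_spec 15 0 m V isT szV s2 _ ts2 e10 e31 st2 h1.
rewrite subn0 !take_oversize ?szW ?szV // cat0s -map_cat in h2.
have [sm3 _ _] : tables s3 by apply: tables_den.
have h3 : holds_word s3 [seq label_code z | z <- W ++ rev_walk V] := h2.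
have sz3 : eval_expr s3 (EReg 30) <= 12 * m.
  by have [E _] := h3; rewrite [eval_expr _ _]E size_map size_cat size_rev_walk szW szV; lia.
rewrite (den_query _ _ _ sm3 sz3) (holds_word_mkseq h3).
rewrite [reg _ _]/= eqb0 negbK oracle_label label_cat label_rev_walk //.
by split=> [/divg1_eq|->]; rewrite ?mulgV.
Qed.

(** The third outcome eliminates the arc [f]. Eliminating every arc at this vertex would contradict
    that the prefix admits two labels. *)
Definition try_result s : Prop :=
  [\/ found_pair s,
      reg s 43 != 0 /\ branching (size P).+1 s |
      [/\ reg s 42 = 0, reg s 43 = 0, stored (arr s 16) 0 W &
        forall T, completes P (arc_tail y) b (f :: T) ->
          trail_label gamma (f :: T) = trail_label gamma (y :: W2)]].

Lemma output_spec s V : tables s -> stored (arr s 16) 0 W -> stored (arr s 15) 0 V ->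
  completes [::] a b V -> trail_label gamma W <> trail_label gamma V ->
  found_pair (den output_prog s).
Proof.
move=> [sm _ _] stW stV cV neq; have [_ _ szW] := cW; have [_ _ szV] := cV.
rewrite /= add0n in szW szV.
rewrite /output_prog (den_seq oracle (copy_prog 16 0)) (den_seq oracle (copy_prog 15 1)).
have st3 : stored (arr (den (copy_prog 16 0) s) 0) 0 W by apply: copy_spec.
have m3 : reg (den (copy_prog 16 0) s) 1 = m by rewrite reg_den.
have stV3 : stored (arr (den (copy_prog 16 0) s) 15) 0 V.
  by apply: stored_ext stV => i _; rewrite arr_den.
move: (den (copy_prog 16 0) s) st3 m3 stV3 => s3 st3 m3 stV3.
have st4 : stored (arr (den (copy_prog 15 1) s3) 0) 0 W.
  by apply: stored_ext st3 => i _; rewrite arr_den.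
have stV4 : stored (arr (den (copy_prog 15 1) s3) 1) 0 V by apply: copy_spec.
move: (den (copy_prog 15 1) s3) st4 stV4 => s4 st4 stV4.
by rewrite den_set; split=> //; exists W, V.
Qed.

Lemma accept_spec s O : completes (rcons P f) (arc_head f) b O ->
  trail_label gamma W = trail_label gamma (rcons P f ++ O) ->
  completes [::] a b (rcons P f ++ O) ->
  tables s -> reg s 40 = size P -> reg s 41 = arc_code f ->
  reg s 42 = 0 -> reg s 43 = 0 ->
  stored (arr s 16) 0 W -> stored (arr s 15) 0 (rcons P f ++ O) ->
  try_result (den accept_prog s).
Proof.
move=> cO lWV cV ts r40 r41 r42 r43 stW stV.
have [_ _ szO] := cO; have [_ _ szV] := cV; rewrite /= add0n in szV.
have stO : stored (arr s 15) (size (rcons P f)) O.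
  by move: stV; rewrite stored_cat add0n => -[].
rewrite /accept_prog (den_seq oracle (PSet 10 _)) (den_seq oracle (PSet 11 _)).
rewrite (den_seq oracle good_prog).
set s3 := den (PSet 11 _) _.
have ts3 : tables s3 by do 2!(apply: tables_den => //).
have [_ ta _] := ts.
have e10 : reg s3 10 = size (rcons P f) by rewrite /s3 !den_set /= r40 addn1 size_rcons.
have e11 : reg s3 11 = arc_head f by rewrite /s3 !den_set /= r41; case: (ta f).
have e42 : reg s3 42 = 0 by [].
have e43 : reg s3 43 = 0 by [].
have ta3 : trail_at (size (rcons P f)) O s3 by [].
have stV3 : stored (arr s3 15) 0 (rcons P f ++ O) by [].
have stW3 : stored (arr s3 16) 0 W by [].
clearbody s3.
have g4 := good_spec szO ta3 e11.
have st16 : stored (arr (den good_prog s3) 16) 0 W.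
  by apply: stored_ext stW3 => i _; rewrite arr_den.
have st15 : stored (arr (den good_prog s3) 15) 0 (rcons P f ++ O).
  by apply: stored_ext stV3 => i _; rewrite arr_den.
have m4 : reg (den good_prog s3) 1 = m by rewrite reg_den //; case: ta3 => -[].
have {}r42 : reg (den good_prog s3) 42 = 0 by rewrite reg_den.
have {}r43 : reg (den good_prog s3) 43 = 0 by rewrite reg_den.
move: (den good_prog s3) g4 st16 st15 m4 r42 r43 => s4 g4 st16 st15 m4 r42 r43.
rewrite den_if den_skip [eval_expr s4 _]/=.
case: g4 => [[-> g]|[-> ng]] /=.
  constructor 3; split=> // T /completes_cons[_ c].
  have e := (good_completes cO).1 g T c.
  move: lWV; rewrite cat_rcons !label_cat => /mulgI ->.
  by rewrite /trail_label !big_cons -/(trail_label gamma T) e.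
constructor 2; rewrite /advance_prog den_seq den_set.
have st5 := @copy_spec 15 16 s4 _ m4 isT szV st15.
have r5 : reg (den (copy_prog 15 16) s4) 42 = 0 by rewrite reg_den.
move: (den (copy_prog 15 16) s4) st5 r5 => s5 st5 r5.
split=> //; split=> //; exists (rcons P f ++ O); split=> //.
have tk : take (size P).+1 (rcons P f ++ O) = rcons P f by rewrite take_size_cat // size_rcons.
have dr : drop (size P).+1 (rcons P f ++ O) = O by rewrite drop_size_cat // size_rcons.
rewrite /not_uniform_after tk dr endv_rcons => h; apply: ng.
exact/(good_completes cO).
Qed.

Lemma try_arc_spec s : tables s -> reg s 3 = b -> reg s 40 = size P -> reg s 41 = arc_code f ->
  stored (arr s 16) 0 W -> reg s 42 = 0 -> reg s 43 = 0 -> try_result (den try_arc s).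
Proof.
move=> ts r3 r40 r41 st r42 r43; have [wW _ _] := cW.
rewrite /try_arc (den_seq oracle extend_prog).
have [tf stf] := extend_spec ts r3 r40 r41 st.
have ts1 : tables (den extend_prog s) by apply: tables_den.
have st16 : stored (arr (den extend_prog s) 16) 0 W.
  by apply: stored_ext st => i _; rewrite arr_den.
have {}r40 : reg (den extend_prog s) 40 = size P by rewrite reg_den.
have {}r41 : reg (den extend_prog s) 41 = arc_code f by rewrite reg_den.
have {}r42 : reg (den extend_prog s) 42 = 0 by rewrite reg_den.
have {}r43 : reg (den extend_prog s) 43 = 0 by rewrite reg_den.
move: (den extend_prog s) tf stf ts1 st16 r40 r41 r42 r43 => s1 tf stf ts1 st16 r40 r41 r42 r43.
rewrite den_if den_skip [eval_expr s1 _]/=.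
case: tf => [[E none]|[E [O cO stO]]].
  rewrite E eqxx; constructor 3; split=> // T /completes_cons[_ c].
  by case: (none T).
rewrite E (den_seq oracle compare_prog).
have cV : completes [::] a b (rcons P f ++ O).
  have [w u sz] := cO; split; rewrite ?cat0s //= ?add0n ?size_cat //.
  rewrite cat_rcons walk_cat /= fy w andbT.
  by move: wW; rewrite walk_cat /= => /andP[-> /andP[-> _]].
have [_ _ szV] := cV; rewrite /= add0n in szV.
have stV : stored (arr s1 15) 0 (rcons P f ++ O) by rewrite stored_cat add0n.
have cmp := compare_spec ts1 st16 stV szV.
have ts2 : tables (den compare_prog s1) by apply: tables_den.
have {}st16 : stored (arr (den compare_prog s1) 16) 0 W.
  by apply: stored_ext st16 => i _; rewrite arr_den.
have {}stV : stored (arr (den compare_prog s1) 15) 0 (rcons P f ++ O).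
  by apply: stored_ext stV => i _; rewrite arr_den.
have {}r40 : reg (den compare_prog s1) 40 = size P by rewrite reg_den.
have {}r41 : reg (den compare_prog s1) 41 = arc_code f by rewrite reg_den.
have {}r42 : reg (den compare_prog s1) 42 = 0 by rewrite reg_den.
have {}r43 : reg (den compare_prog s1) 43 = 0 by rewrite reg_den.
move: (den compare_prog s1) cmp ts2 st16 stV r40 r41 r42 r43
  => s2 cmp ts2 st16 stV2 r40 r41 r42 r43.
rewrite den_if [eval_expr s2 _]/=.
case: (boolP (reg s2 34 != 0)) cmp => r34 cmp.
  by apply: (accept_spec cO (cmp.1 isT)).
by constructor 1; apply: (output_spec ts2 st16 stV2 cV) => /cmp.2.
Qed.

End TryArc.

Lemma search_step_spec j W c s : j < m -> completes [::] a b W ->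
  (c : nat) < m + m -> tables s -> reg s 3 = b -> reg s 40 = j -> reg s 41 = c ->
  let inv c s := [\/ found_pair s, reg s 43 != 0 /\ branching j.+1 s |
    [/\ reg s 42 = 0, reg s 43 = 0, stored (arr s 16) 0 W &
      forall f T, arc_code f < c -> completes (take j W) (endv a (take j W)) b (f :: T) ->
        trail_label gamma (f :: T) = trail_label gamma (drop j W)]] in
  inv c s -> inv c.+1 (den search_step s).
Proof.
move=> jm cW cm ts r3 r40 r41 inv; rewrite {1}/inv /search_step.
case=> [fd|[ad br]|[r42 r43 st old]].
- by rewrite den_if [eval_expr _ _]/= fd.1 den_skip; constructor 1.
- by rewrite !den_if [eval_expr _ _]/= br.1 /= ad den_skip; constructor 2.
have [wW uW] := cW; rewrite /= add0n => szW.
have jW : j < size W by rewrite szW.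
have [P [y [W2 [eW sP ay]]]] := stored_at st jW; rewrite add0n in ay.
have [f fc] := arc_code_onto cm; have [sm ta tt] := ts.
move: r41 old {cm}; rewrite -{c}fc => r41 old.
have tkW : take j W = P by rewrite eW -sP take_size_cat.
have drW : drop j W = y :: W2 by rewrite eW -sP drop_size_cat.
have ty : arc_tail y = endv a P.
  by move: wW; rewrite eW walk_cat /= => /and3P[_ /eqP].
have skip s' : reg s' 42 = 0 -> reg s' 43 = 0 -> stored (arr s' 16) 0 W ->
    (forall T, completes P (endv a P) b (f :: T) ->
       trail_label gamma (f :: T) = trail_label gamma (y :: W2)) -> inv (arc_code f).+1 s'.
  move=> h1 h2 h3 h4; constructor 3; split=> // f' T; rewrite ltnS leq_eqVlt => /orP[/eqP e|lt].
    have -> : f' = f by apply: arc_code_inj; rewrite e.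
    by rewrite tkW drW; apply: h4.
  exact: old.
rewrite !den_if !den_skip [eval_expr s (EReg 42)]/= r42 [eval_expr s (EReg 43)]/= r43.
rewrite [eval_expr s (EEq _ _)]/= r40 r41 ay !tt.
have -> : (nat_of_ord (arc_tail f) == arc_tail y) = (arc_tail f == arc_tail y) by [].
case: (eqVneq (arc_tail f) (arc_tail y)) => [fy|fy] /=; last first.
  by apply: skip => // T /completes_cons[E]; rewrite E ty eqxx in fy.
rewrite den_seq.
have stP : stored (arr s 16) 0 P by move: st; rewrite eW stored_cat => -[].
have Pm : size P <= m by rewrite sP ltnW.
have r44 := edge_used_spec ts (etrans r40 (esym sP)) Pm r41 stP.
have ts1 : tables (den edge_used s) by apply: tables_den.
have st1 : stored (arr (den edge_used s) 16) 0 W by apply: stored_ext st => i _; rewrite arr_den.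
have e42 : reg (den edge_used s) 42 = 0 by rewrite reg_den.
have e43 : reg (den edge_used s) 43 = 0 by rewrite reg_den.
have e3 : reg (den edge_used s) 3 = b by rewrite reg_den.
have e40 : reg (den edge_used s) 40 = size P by rewrite reg_den // sP.
have e41 : reg (den edge_used s) 41 = arc_code f by rewrite reg_den.
move: (den edge_used s) r44 ts1 st1 e42 e43 e3 e40 e41 => s1 r44 ts1 st1 e42 e43 e3 e40 e41.
rewrite den_if den_skip [eval_expr s1 _]/= r44.
case: (boolP (arc_edge f \in edges_of P)) => fP /=.
  apply: skip => // T [_ + _]; rewrite edges_of_cat cat_uniq => /and3P[_ /hasPn h _].
  by have := h (arc_edge f); rewrite inE eqxx /= fP => /(_ isT).
have cW' := cW; rewrite eW in cW' st1.
have := try_arc_spec cW' fy fP ts1 e3 e40 e41 st1 e42 e43.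
move: (den try_arc s1) => s2 [fd|[ad br]|[h1 h2 h3 h4]].
- by constructor 1.
- by constructor 2; rewrite -sP.
- by apply: skip => //; rewrite ?eW // -ty.
Qed.

Lemma search_spec : ~ same_eulerian_labels gamma a b -> found_pair (den search_prog s0).
Proof.
move=> ns; rewrite den_search.
have := start_spec; move: (den start_prog s0) => s1 /= [t1 _ _ r3 tf].
have {tf} [W cW st] : exists2 W, completes [::] a b W & stored (arr s1 15) 0 W.
  case: tf => [[_ none]|[_ //]]; exfalso; apply: ns => T1 T2 /eulerian_completes c1.
  by case: (none T1).
have [_ _ szW] := cW; rewrite /= add0n in szW.
set s3 := den (PSet 42 _) _.
have t3 : tables s3 by do 2!(apply: tables_den => //).
have e3 : reg s3 3 = b by rewrite /s3 den_set /= reg_den.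
have [sm1 _ _] := t1; have [sm3 _ _] := t3.
have br0 : branching 0 s3.
  split=> //; exists W; split=> //; first exact: copy_spec.
  rewrite /not_uniform_after take0 drop0 => h; apply: ns => T1 T2.
  by move=> /eulerian_completes/h -> /eulerian_completes/h ->.
clearbody s3.
pose I j s := found_pair s \/ branching j s.
have : I m (den (PFor 40 BM search_round) s3).
  apply: (for_rule (I := I)) => //; first by right.
  move=> j s jm sj fr IH.
  have ts : tables s by apply: tables_frame fr _ _ t3.
  have b3 : reg s 3 = b by rewrite fr.1.
  rewrite /search_round den_seq; set s4 := den (PSet 43 _) s.
  have ts4 : tables s4 by apply: tables_den.
  have [sm4 _ _] := ts4.
  suff : found_pair (den (PFor 41 B2M search_step) s4) \/
      branching j.+1 (den (PFor 41 B2M search_step) s4) by [].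
  case: IH => [fd|[r42 [V [stV cV nu]]]].
    left; apply: (for_rule (n := m + m) (I := fun=> found_pair)) => //; first by rewrite sm4.
    move=> c s' _ _ _ fd'.
    by rewrite /search_step den_if [eval_expr _ _]/= fd'.1 den_skip.
  pose I2 c s := [\/ found_pair s, reg s 43 != 0 /\ branching j.+1 s |
    [/\ reg s 42 = 0, reg s 43 = 0, stored (arr s 16) 0 V &
      forall f T, arc_code f < c -> completes (take j V) (endv a (take j V)) b (f :: T) ->
        trail_label gamma (f :: T) = trail_label gamma (drop j V)]].
  have : I2 (m + m) (den (PFor 41 B2M search_step) s4).
    apply: (for_rule (I := I2)) => //; first by rewrite sm4.
      by constructor 3.
    move=> c s' cm s'c fr' IH2.
    have ts' : tables s' by apply: tables_frame fr' _ _ ts4.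
    have b3' : reg s' 3 = b by rewrite fr'.1.
    have j' : reg s' 40 = j by rewrite fr'.1.
    have := search_step_spec jm cV cm ts' b3' j' s'c IH2.
    by move: (den search_step s') => s''.
  (* If every arc is eliminated, each completion, sorted by its first arc, has the label of the rest
     of [V], against [nu]. The empty completion is excluded by [j < m]. *)
  case=> [fd|[_ br]|[_ _ _ h]]; [by left | by right |].
  case: nu => -[|f T] cT; last exact: h (arc_code_lt f) cT.
  have [_ _] := cT; rewrite addn0 size_takel; first by move=> e; rewrite e ltnn in jm.
  by have [_ _] := cV; rewrite /= add0n => ->; apply: ltnW.
(* After [m] rounds the prefix is all of [V], whose only completion is empty, so the search cannot
   still be branching. *)
move: (den _ s3) => s [//|[_ [V [_ cV nu]]]].
have [_ _ szV] := cV; rewrite /= add0n in szV.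
case: nu => T [_ _]; rewrite -szV take_size drop_size -{2}[size V]addn0 => /addnI/size0nil ->.
by [].
Qed.

End Main.

End Specs.

(** Since [m] and [F] are positive, each successor is at most a double: [d] factors 2 come from the
    power of [m.+1], and one more from [F.+1]. *)
Lemma power_bound m F d c : 0 < m -> m <= F ->
  c * cost_power m.+1 F.+1 d.+1 <= (2 ^ d).*2 * c * m ^ d * F.
Proof.
move=> m0 mF; rewrite /=.
have h1 : m.+1 ^ d <= 2 ^ d * m ^ d by case: d => // d; rewrite -expnMn leq_exp2r //; lia.
have h2 : F.+1 <= 2 * F by lia.
have h3 := leq_mul h1 h2.
by rewrite -muln2; nia.
Qed.

Theorem theorem1p2 (Gamma : groupType) (k : nat) (gen : 'I_k -> Gamma)
    (gen_Gamma : generates gen) :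
  exists (decide search : cmd) (C : nat),
  forall (oracle : seq nat -> bool) (phi : nat -> nat),
    solves_word_problem gen oracle ->
    (forall n, n <= phi n) ->
    (forall i j, i <= j -> phi i <= phi j) ->
  forall (G : graph) (gamma : arc_of G -> Gamma) (lab : arc_of G -> word k)
         (adj : vertex G -> seq (arc_of G)) (a b : vertex G),
    connected_graph G ->
    group_labeling gamma ->
    word_labeling gen gamma lab ->
    (forall x, size (lab x) = 1) ->
    adjacency_lists adj ->
    let m := nedges G in
    (exists (t : nat) (s : state),
       [/\ exec oracle phi decide (input_state adj lab a b) t s,
           (0 < m -> t <= C * m ^ 2 * phi (12 * m)) &
           (reg s 0 = 1 /\ same_eulerian_labels gamma a b) \/
           (reg s 0 = 0 /\ ~ same_eulerian_labels gamma a b)]) /\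
    (~ same_eulerian_labels gamma a b ->
     exists (t : nat) (s : state) (p1 p2 : seq (arc_of G)),
       [/\ exec oracle phi search (input_state adj lab a b) t s,
           t <= C * m ^ 4 * phi (12 * m),
           stores_trail s 0 p1 /\ stores_trail s 1 p2,
           eulerian_trail a b p1 /\ eulerian_trail a b p2 &
           trail_label gamma p1 <> trail_label gamma p2]).
Proof.
exists (compile decide_prog), (compile search_prog).
(* The constants of [power_bound] for programs of degree 3 and 5; the sum serves both bounds. *)
exists ((2 ^ 2).*2 * coef decide_prog + (2 ^ 4).*2 * coef search_prog).
move=> oracle phi oracleP phi_ge phi_mono G gamma lab adj a b _ gammaV labP lab1 adjP m.
have mF : m <= phi (12 * m) by apply: leq_trans (phi_ge _); rewrite leq_pmull.
have m1 : reg (input_state adj lab a b) 1 = m by [].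
split.
  have [t ex le] := exec_compile oracle phi_mono wf_decide m1.
  exists t, (den oracle decide_prog (input_state adj lab a b)); split=> //.
    move=> m0; apply: leq_trans le _; apply: leq_trans (cost_le _ mF) _.
    rewrite deg_decide; apply: leq_trans (power_bound _ _ m0 mF) _.
    by rewrite !leq_mul2r leq_addr !orbT.
  exact: (decide_spec oracleP gammaV labP lab1 _ _ adjP).
move=> ns.
have [_ [p1 [p2 [st1 st2 c1 c2 neq]]]] := search_spec oracleP gammaV labP lab1 adjP ns.
have [t ex le] := exec_compile oracle phi_mono wf_search m1.
have [_ _ sz1] := c1; have [_ _ sz2] := c2; rewrite /= add0n in sz1 sz2.
exists t, (den oracle search_prog (input_state adj lab a b)), p1, p2; split=> //.
(* Without edges both trails would be empty and have equal labels. *)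
- have m0 : 0 < m.
    rewrite lt0n; apply/eqP => m0; apply: neq.
    by rewrite -/m m0 in sz1 sz2; rewrite (size0nil sz1) (size0nil sz2).
  apply: leq_trans le _; apply: leq_trans (cost_le _ mF) _.
  rewrite deg_search; apply: leq_trans (power_bound _ _ m0 mF) _.
  by rewrite !leq_mul2r leq_addl !orbT.
- by split; apply: stored_mkseq.
- by split; apply/eulerian_completes.
Qed.
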